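(* Let $\tau\in(0,\infty]$ and $0<\delta<1-\frac{1}{1+\tau}$. Then for every $m\in\mathbb{N}$ there exists a topological dynamical system $(X,f)$ satisfying the non-uniform $\tau$-specification property with gap function $M(n,\varepsilon)$ such that: (1) for all sufficiently small $\varepsilon>0$, $\lim_{n\to\infty}\frac{M(n,\varepsilon)}{n}=\tau$; (2) $(X,f)$ has exactly $m$ ergodic measures of maximal entropy $\nu_1,\dots,\nu_m$; (3) $\nu_1,\dots,\nu_m$ are $m$ isolated points of $\mathcal{M}_f^{erg}(X)$; (4) the irregular set $\mathrm{IR}(f)$ does not carry full Bowen topological entropy; more precisely, $$h_{top}^B(f,\mathrm{IR}(f))\le\Big(\frac{1}{1+\tau}+\delta\Big)h_{top}(f).$$
   Context: Convention: $\frac1{1+\infty}=0$. $\mathbb{N}$ is the set of positive integers. A topological dynamical system $(X,f)$ consists of a compact metric space $(X,d)$ with at least two points and a continuous map $f:X\to X$. $C(X)$ is the space of real continuous functions on $X$. $\mathcal{M}_f^{erg}(X)$ is the set of $f$-ergodic Borel probability measures with the weak$^*$ topology; $h_{top}(f)$ and $h_\mu(f)$ are topological and measure-theoretic entropy. An ergodic measure of maximal entropy is a $\mu\in\mathcal{M}_f^{erg}(X)$ with $h_\mu(f)=h_{top}(f)$. A set $E\subset X$ carries full Bowen topological entropy if $h_{top}^B(f,E)=h_{top}(f)$. Non-uniform specification: $(X,f)$ has the non-uniform specification property with gap function $M:\mathbb{N}\times(0,\infty)\to\mathbb{N}$ if $M(n,\varepsilon)$ is non-decreasing in $n$ and non-increasing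 in $\varepsilon$, and for every $\varepsilon>0$, every integer $k\ge2$, all $x_1,\dots,x_k\in X$ and all non-negative integers $a_1\le b_1<a_2\le b_2<\cdots<a_k\le b_k$ with $a_{i+1}-b_i\ge M(b_i-a_i+1,\varepsilon)$ for $1\le i\le k-1$, there is $z\in X$ with $d(f^{n-a_i}x_i,f^nz)\le\varepsilon$ for all $a_i\le n\le b_i$, $1\le i\le k$. Let $\mathscr{G}(X,f)$ be the set of all such gap functions for $(X,f)$ and $\tau(M)=\sup_{\varepsilon>0}\liminf_{n\to\infty}M(n,\varepsilon)/n\in[0,\infty]$. $(X,f)$ has the non-uniform $\tau$-specification property if there is $M\in\mathscr{G}(X,f)$ with $\tau(M)=\tau$ and every $M'\in\mathscr{G}(X,f)$ satisfies $\tau(M')\ge\tau$; ''with gap function $M$'' means $M\in\mathscr{G}(X,f)$. Irregular set: for $\varphi\in C(X)$, $I_\varphi(f)=\{x\in X:\lim_{n\to\infty}\frac1n\sum_{k=0}^{n-1}\varphi(f^kx)\text{ does not exist}\}$; $\mathrm{IR}(f)=\bigcup_{\varphi\in C(X)}I_\varphi(f)$. Bowen topological entropy of $F\subset X$: let $B_n(x,\varepsilon)=\{y:\max_{0\le i\le n-1}d(f^ix,f^iy)<\varepsilon\}$. For $t\ge0$ let $C(F;t,N,\varepsilon,f)$ be the infimum of $\sum_k e^{-tn_k}$ over finite or countable covers $\{B_{n_k}(x_k,\varepsilon)\}$ of $F$ with $x_k\in F$, $n_k\ge N$; let $C(F;t,\varepsilon,f)=\lim_{N\to\infty}C(F;t,N,\varepsilon,f)$,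 $h_{top}^B(F;\varepsilon,f)=\inf\{t\ge0:C(F;t,\varepsilon,f)=0\}$ and $h_{top}^B(f,F)=\lim_{\varepsilon\to0}h_{top}^B(F;\varepsilon,f)$. *)

(* Defs.v *)
From HB Require Import structures.
From mathcomp Require Import all_boot all_order all_algebra finmap.
From mathcomp Require Import all_classical all_reals all_analysis.

Set Implicit Arguments.
Unset Strict Implicit.
Unset Printing Implicit Defensive.

Import Order.TTheory GRing.Theory Num.Theory.
Import numFieldNormedType.Exports.

Local Open Scope classical_set_scope.
Local Open Scope ring_scope.

(* Measurable types of the library are pointed, so the spaces below carry a
   point; it plays no role besides making the space nonempty. *)
#[short(type="pmetricType")]
HB.structure Definition PointedMetricSpace (R : numDomainType) :=
  {X of Metric R X & Pointed X}.

Notation borel X := (g_sigma_algebraType (@open X)).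

Section dynamical_systems.
Context {R : realType} {X : pmetricType R}.
Implicit Types (f : X -> X) (F : set X).

Definition dynamical_system f : Prop :=
  [/\ compact [set: X], exists x y : X, x <> y & continuous f].

(* Only the values M n eps with 0 < n and 0 < eps are meaningful. *)
Definition gap_function f (M : nat -> R -> nat) : Prop :=
  [/\ forall n eps, (0 < n)%N -> 0 < eps -> (0 < M n eps)%N,
      forall n n' eps, (0 < n)%N -> (n <= n')%N -> 0 < eps ->
        (M n eps <= M n' eps)%N,
      forall n eps eps', (0 < n)%N -> 0 < eps -> eps <= eps' ->
        (M n eps' <= M n eps)%N &
      forall (eps : R) (k : nat) (x : 'I_k -> X) (a b : 'I_k -> nat),
        0 < eps -> (2 <= k)%N ->
        (forall i, (a i <= b i)%N) ->
        (forall i j : 'I_k, j = i.+1 :> nat ->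
          (b i < a j)%N /\ (M (b i - a i + 1)%N eps <= a j - b i)%N) ->
        exists z : X, forall (i : 'I_k) (n : nat), (a i <= n <= b i)%N ->
          mdist (iter (n - a i) f (x i)) (iter n f z) <= eps].

Definition gap_ratio (M : nat -> R -> nat) (eps : R) (n : nat) : \bar R :=
  ((M n eps)%:R / n%:R)%:E.

Definition gap_rate (M : nat -> R -> nat) : \bar R :=
  ereal_sup [set limn_einf (gap_ratio M eps) | eps in [set eps | 0 < eps]].

Definition nonuniform_specification f (tau : \bar R) : Prop :=
  (exists2 M, gap_function f M & gap_rate M = tau) /\
  (forall M, gap_function f M -> (tau <= gap_rate M)%E).

Definition birkhoff_average f (phi : X -> R) (x : X) (n : nat) : R :=
  n%:R^-1 * \sum_(k < n) phi (iter k f x).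

Definition irregular_for f (phi : X -> R) : set X :=
  [set x | ~ cvgn (birkhoff_average f phi x)].

Definition irregular_set f : set X :=
  \bigcup_(phi in [set phi : X -> R | continuous phi]) irregular_for f phi.

Definition bowen_ball f (n : nat) (eps : R) (x : X) : set X :=
  [set y | forall i, (i < n)%N -> mdist (iter i f x) (iter i f y) < eps].

Definition dyn_separated f (n : nat) (eps : R) (A : {fset X}) : Prop :=
  forall x y, x \in A -> y \in A -> x <> y -> ~ bowen_ball f n eps x y.

Definition max_separated f (n : nat) (eps : R) : \bar R :=
  ereal_sup [set (#|` A|%fset%:R)%:E | A in dyn_separated f n eps].

Definition htop_scale f (eps : R) : \bar R :=
  limn_esup (fun n => ((n%:R^-1)%:E * lne (max_separated f n eps))%E).

Definition htop f : \bar R := lim (htop_scale f eps @[eps --> 0^'+]).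

(* A finite or countable family of balls is indexed by some D : set nat. *)
Definition bowen_cover f F (N : nat) (eps : R)
    (D : set nat) (x : nat -> X) (n : nat -> nat) : Prop :=
  (forall k, D k -> F (x k) /\ (N <= n k)%N) /\
  F `<=` \bigcup_(k in D) bowen_ball f (n k) eps (x k).

Definition bowen_C_N f F (t : R) (eps : R) (N : nat) : \bar R :=
  ereal_inf [set c | exists (D : set nat) (x : nat -> X) (n : nat -> nat),
    bowen_cover f F N eps D x n /\
    c = \esum_(k in D) (expR (- t * (n k)%:R))%:E].

Definition bowen_C f F (t : R) (eps : R) : \bar R := limn (bowen_C_N f F t eps).

Definition bowen_htop_scale f F (eps : R) : \bar R :=
  ereal_inf [set t%:E | t in [set t : R | 0 <= t /\ bowen_C f F t eps = 0%E]].

Definition bowen_htop f F : \bar R :=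
  lim (bowen_htop_scale f F eps @[eps --> 0^'+]).

Definition carries_full_bowen_entropy f F : Prop := bowen_htop f F = htop f.

(* A [probability] is a function on all subsets of X which is constrained only
   on the measurable ones.  The first clause fixes its values elsewhere, so
   that Borel measures agreeing on all Borel sets are equal; otherwise neither
   counting measures nor being isolated would have the intended meaning. *)
Definition borel_measures : set (probability (borel X) R) :=
  [set mu | forall A : set (borel X), ~ measurable A -> mu A = 0%E].

Definition ergodic_measures f : set (probability (borel X) R) :=
  [set mu | [/\ borel_measures mu,
    forall A : set (borel X), measurable A -> mu (f @^-1` A) = mu A &
    forall A : set (borel X), measurable A -> f @^-1` A = A ->
      mu A = 0%E \/ mu A = 1%E]].

(* A finite measurable partition {P_0, ..., P_(k-1)} is given by the map P
   sending each point to the index of its cell (cells may be empty); the cell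
   of the n-th join indexed by w is the set of points of P-itinerary w. *)
Definition join_cell f k (P : borel X -> 'I_k) n (w : {ffun 'I_n -> 'I_k}) :
    set (borel X) :=
  [set x | forall i : 'I_n, P (iter i f x) = w i].

(* Library convention: ln 0 = 0, so empty cells contribute 0. *)
Definition join_entropy f (mu : probability (borel X) R) k
    (P : borel X -> 'I_k) (n : nat) : R :=
  - \sum_(w : {ffun 'I_n -> 'I_k})
      fine (mu (join_cell f P w)) * ln (fine (mu (join_cell f P w))).

Definition partition_entropy f (mu : probability (borel X) R) k
    (P : borel X -> 'I_k) : \bar R :=
  limn (fun n => (n%:R^-1 * join_entropy f mu P n)%:E).

Definition measure_entropy f (mu : probability (borel X) R) : \bar R :=
  ereal_sup [set h | exists (k : nat) (P : borel X -> 'I_k),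
    (forall i, measurable (P @^-1` [set i])) /\ h = partition_entropy f mu P].

Definition max_entropy_measures f : set (probability (borel X) R) :=
  [set mu | ergodic_measures f mu /\ measure_entropy f mu = htop f].

Definition integrate (mu : probability (borel X) R) :
    {ptws continuousType X R -> R} :=
  fun phi : continuousType X R => \int[mu]_(x in [set: borel X]) phi x.

End dynamical_systems.

Notation weak_star X := (initial_topology (@integrate _ X)).

(* Main.v *)
(* Start from the letters of a finite alphabet [B] and let the blocks of level [k+1]
   be the concatenations of all blocks of level [k], each used once, in any order.
   There are enough orders for the language of subwords of blocks to have positive
   entropy [h], while each word occurs with the same asymptotic frequency in all long
   words of the language.  The space consists of the sequences over [m] disjoint
   copies of this language and a gap symbol, where a stretch of [r] letters stays in
   one copy and, if it ends, is followed by at least [g r] gaps, with [g r / r]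
   tending to [tau].

   Gaps separate arbitrary words, so [g] governs specification.  A point with
   infinitely many gaps has infinitely many prefixes in which the letters have
   proportion at most about [1 / (1 + tau)], which bounds the Bowen entropy; any other
   point ends up in one copy and is regular, as words have frequencies.  Likewise an
   ergodic measure either charges one copy only, and is then determined by the
   frequencies and has entropy [h], or gives the letters mass at most [q / (1 + q)],
   where [r <= q * g r], and has entropy less than [h] if [g] is large; the mass of
   the letters of one copy isolates the measures of the first kind. *)

Require Import Defs.
From HB Require Import structures.
From mathcomp Require Import all_boot all_order all_algebra finmap.
From mathcomp Require Import all_classical all_reals all_analysis.
From mathcomp Require Import zify ring lra.

Set Implicit Arguments.
Unset Strict Implicit.
Unset Printing Implicit Defensive.

Import Order.TTheory GRing.Theory Num.Theory.
Import numFieldNormedType.Exports.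

Local Open Scope classical_set_scope.
Local Open Scope ring_scope.

(** * Words and occurrences *)

(** The obstacle is to have entropy without freedom: a copy has to carry exactly one invariant
    measure and no irregular point, so word frequencies must be uniform over the whole language, and
    yet the number of words must grow exponentially. Permutations achieve both: a block of the next
    level sees every block once, while passing from [N] blocks to [N!] costs, by Stirling, at most
    [1 / block_len] of entropy. As lengths double, the total loss is at most 2, and an alphabet of
    more than [e^2] letters leaves [h > 0]. The upper bounds below [h] come from one estimate.
    Weighting a word by [exp (- s * letters)], with [s] slightly above [h], gives a sum of growth
    rate at most [kappa], which is as small as desired if all gaps are long. Words with letter
    proportion [rho] then have rate at most [kappa + s * rho]; [rho = 1 / T] serves the Bowen
    entropy, and a version for measures serves the ergodic measures. Hence the order of choices: [T]
    and [q] depend on [tau] and [delta] only, then come [kappa] and [s], the constant [K], the least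
    gap length [L], and at last [g]. *)

Section words.
Context {A : finType}.
Implicit Types (w : seq A) (a : A) (n : nat).

Fixpoint words n : seq (seq A) :=
  if n is n'.+1 then [seq a :: w | a <- enum A, w <- words n'] else [:: [::]].

Lemma mem_words n w : (w \in words n) = (size w == n).
Proof.
elim: n w => [|n IH] [|a w] //=.
- by apply/allpairsP => -[[b v] /= [_ _]].
- apply/allpairsP/idP => [[[b v] /= [_ hv [_ ->]]]|hw].
    by rewrite eqSS -IH.
  by exists (a, w); rewrite mem_enum IH -eqSS.
Qed.

Lemma words_uniq n : uniq (words n).
Proof.
elim: n => //= n IH; apply: allpairs_uniq => //; first exact: enum_uniq.
by move=> [a w] [b v] _ _ /= [-> ->].
Qed.

Lemma big_words_cons (V : nmodType) n (F : seq A -> V) :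
  \sum_(w <- words n.+1) F w = \sum_(a : A) \sum_(w <- words n) F (a :: w).
Proof. by rewrite /= big_allpairs_dep big_enum. Qed.

End words.

Section sums.
Context {R : realType}.

Lemma ler_sum_subseq (I : eqType) (s t : seq I) (F : I -> R) :
  uniq s -> {subset s <= t} -> (forall i, 0 <= F i) ->
  \sum_(i <- s) F i <= \sum_(i <- t) F i.
Proof.
move=> + + F0; elim: s t => [|x s IH] t /=.
  by move=> _ _; rewrite big_nil; apply: sumr_ge0.
move=> /andP[xs us] st.
have xt : x \in t by apply: st; rewrite mem_head.
rewrite big_cons (perm_big _ (perm_to_rem xt)) big_cons lerD2l; apply: IH => //.
move=> y ys; apply: rem_mem; last by apply: st; rewrite inE ys orbT.
by apply: contraNneq xs => <-.
Qed.

Lemma ler_sum_uniq_cst (I : eqType) (s : seq I) (F : I -> R) c :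
  (forall i, i \in s -> F i <= c) -> \sum_(i <- s) F i <= c * (size s)%:R.
Proof.
move=> h; rewrite big_seq; apply: (@le_trans _ _ (\sum_(i <- s | i \in s) c)).
  exact: ler_sum.
by rewrite -big_seq big_const_seq count_predT iter_addr addr0 mulr_natr.
Qed.

Lemma gibbs_term (p q : R) : 0 <= p -> 0 <= q -> (0 < p -> 0 < q) ->
  p * ln q - p * ln p <= q - p.
Proof.
move=> p0 q0 pq; have [->|pn0] := eqVneq p 0; first by lra.
have {pn0}p0' : 0 < p by rewrite lt_neqAle eq_sym pn0.
have q0' := pq p0'.
have h : ln q - ln p <= q / p - 1.
  rewrite -ln_div ?posrE//.
  have -> : q / p = 1 + (q / p - 1) by lra.
  by rewrite [leRHS]addrAC subrr add0r le_ln1Dx// ltrBrDl subrr divr_gt0.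
rewrite -mulrBr.
have -> : q - p = p * (q / p - 1) by field; rewrite gt_eqF.
by rewrite ler_pM2l.
Qed.

(** Summed from [ln x <= x - 1]. Since [ln 0] is [0] and not infinite, positivity of [q] wherever
    [p] is positive has to be required. *)
Lemma gibbs (I : eqType) (s : seq I) (p q : I -> R) :
  (forall i, i \in s -> 0 <= p i) -> (forall i, i \in s -> 0 <= q i) ->
  (forall i, i \in s -> 0 < p i -> 0 < q i) ->
  \sum_(i <- s) q i <= \sum_(i <- s) p i ->
  - \sum_(i <- s) p i * ln (p i) <= - \sum_(i <- s) p i * ln (q i).
Proof.
move=> p0 q0 pq qp; rewrite lerN2 -subr_le0 -sumrB.
apply: (@le_trans _ _ (\sum_(i <- s) (q i - p i))).
  by rewrite big_seq [leRHS]big_seq; apply: ler_sum => i si; apply: gibbs_term;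
    auto.
by rewrite sumrB subr_le0.
Qed.

End sums.

Local Arguments prefix : simpl never.
Local Arguments infix : simpl never.

Section occurrences.
Context {B : finType}.
Implicit Types (u v w s : seq B) (bs : seq (seq B)).

(** Starting positions lie strictly before the end of [w], so the empty word occurs [size w] times
    and gets frequency 1. *)
Fixpoint occ u w : nat :=
  if w is _ :: w' then (prefix u w + occ u w')%N else 0%N.

Lemma occ_le_size u w : (occ u w <= size w)%N.
Proof. by elim: w => //= a w IH; rewrite -add1n leq_add// leq_b1. Qed.

Lemma occ_nil w : occ [::] w = size w.
Proof. by elim: w => //= a w ->; rewrite add1n. Qed.

Lemma occ_cat_ge u v w : (occ u v + occ u w <= occ u (v ++ w))%N.
Proof.
elim: v => //= a v IH; rewrite -addnA leq_add//.
case: (boolP (prefix u (a :: v))) => // h.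
by rewrite -cat_cons (prefix_trans h)// prefix_prefix.
Qed.

Lemma prefix_cat_size u v w : (size u <= size v)%N ->
  prefix u (v ++ w) = prefix u v.
Proof. by move=> h; rewrite !prefixE takel_cat. Qed.

Lemma occ_cat_le u v w :
  (occ u (v ++ w) <= occ u v + occ u w + minn (size v) (size u))%N.
Proof.
elim: v => [|a v IH]; first by rewrite leq_addr.
rewrite [occ _ _]/= [occ u (a :: v)]/=.
case: (leqP (size u) (size (a :: v))) => h.
  rewrite -cat_cons prefix_cat_size//.
  have := leq_trans IH (leq_add (leqnn _) (geq_minr _ _)); lia.
have hv : (size v <= size u)%N by apply: ltnW; apply: ltnW.
rewrite (minn_idPl hv) in IH.
by move: (leq_b1 (prefix u (a :: v ++ w))) IH => /=; lia.
Qed.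

Lemma occ_flatten_ge u bs : (\sum_(b <- bs) occ u b <= occ u (flatten bs))%N.
Proof.
elim: bs => [|b bs IH]; first by rewrite big_nil.
by rewrite big_cons /= (leq_trans _ (occ_cat_ge _ _ _))// leq_add2l.
Qed.

Lemma occ_flatten_le u bs :
  (occ u (flatten bs) <= \sum_(b <- bs) occ u b + size bs * size u)%N.
Proof.
elim: bs => [|b bs IH]; first by rewrite big_nil.
rewrite big_cons /= (leq_trans (occ_cat_le _ _ _))//.
have := geq_minr (size b) (size u); rewrite mulSn; lia.
Qed.

Lemma occ_small u w : (size w < size u)%N -> occ u w = 0%N.
Proof.
elim: w => [//|a w IH] h /=; rewrite IH; last exact: ltnW.
case: (boolP (prefix _ _)) => // /prefixP[t e].
by move: h; rewrite e size_cat ltnNge leq_addr.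
Qed.

Lemma prefix_rcons_sum u w :
  (\sum_(a : B) prefix (rcons u a) w)%N = (prefix u w && (size u < size w)%N).
Proof.
elim: u w => [|b u IH] [|c w] //=.
- by rewrite big1.
- rewrite (bigD1 c)//= prefix_cons eqxx prefix0s/= big1// => a ac.
  by rewrite prefix_cons (negbTE ac).
- by rewrite big1// => a _; rewrite prefixs0.
- under eq_bigr do rewrite prefix_cons.
  rewrite prefix_cons; case: eqVneq => /= _; last by rewrite big1.
  by rewrite IH ltnS.
Qed.

(** Every occurrence of [u] extends to the right by exactly one letter, except one that ends [w]. *)
Lemma occ_rcons_sum u w :
  (\sum_(a : B) occ (rcons u a) w <= occ u w <=
   (\sum_(a : B) occ (rcons u a) w).+1)%N.
Proof.
elim: w => [|c w IH] /=; first by rewrite big1.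
rewrite big_split/= prefix_rcons_sum.
case: (ltngtP (size u) (size (c :: w))) => h /=; rewrite ?andbT ?andbF.
- by move: IH => /andP[h1 h2]; rewrite leq_add2l h1 -addnS leq_add2l.
- have -> : prefix u (c :: w) = false.
    by apply: contraTF h => /prefixP[t ->]; rewrite size_cat -leqNgt leq_addr.
  have h' : (size w < size u)%N by apply: ltn_trans h.
  rewrite (occ_small h') big1// => a _.
  by rewrite occ_small// size_rcons ltnS; exact: ltnW.
- move: h => /= h; rewrite (@occ_small u w) ?h// addn0 add0n big1 ?leq0n ?leq_b1//.
  by move=> a _; rewrite occ_small// size_rcons h ltnS leqnSn.
Qed.

Lemma prefix_cons_sum u w : (\sum_(a : B) prefix (a :: u) w)%N =
  (if w is _ :: w' then prefix u w' : nat else 0)%N.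
Proof.
case: w => [|c w]; first by rewrite big1.
rewrite (bigD1 c)//= prefix_cons eqxx/= big1 ?addn0// => a ac.
by rewrite prefix_cons (negbTE ac).
Qed.

(** Every occurrence of [u] extends to the left by exactly one letter, except one that begins
    [w]. *)
Lemma occ_cons_sum u w :
  (\sum_(a : B) occ (a :: u) w <= occ u w <=
   (\sum_(a : B) occ (a :: u) w).+1)%N.
Proof.
case: u => [|d u]; first exact: (occ_rcons_sum [::] w).
move: {d u}(d :: u) (isT : d :: u != [::]) => u u0.
suff h c w' : ((\sum_(a : B) occ (a :: u) (c :: w')) = occ u w')%N.
  case: w => [|c w]; first by rewrite big1.
  by rewrite h /= leq_addl -add1n leq_add2r leq_b1.
elim: w' c => [|c' w' IH] c /=.
  rewrite big1// => a _; rewrite addn0 prefix_cons.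
  by rewrite prefixs0 (negbTE u0) andbF.
rewrite big_split/= prefix_cons_sum -/(occ _ _).
by congr addn; rewrite -[RHS](IH c').
Qed.

Lemma occ_gt0_infix u w : (0 < occ u w)%N -> infix u w.
Proof.
elim: w => [//|a w IH] /=; rewrite addn_gt0 lt0b => /orP[|/IH h].
  exact: prefixW.
by apply: infix_trans h _; rewrite -cat1s; apply: suffixW; exact: suffix_suffix.
Qed.

Lemma infix_occ_gt0 u w : infix u w -> (0 < size w)%N -> (0 < occ u w)%N.
Proof.
move=> /infixP[p [s ->]] h.
case: u h => [|d u]; first by rewrite occ_nil.
move: {d u}(d :: u) (isT : d :: u != [::]) => u u0 h.
elim: p h => [|a p IH] /= h.
  by case: (u ++ s) h (prefix_prefix u s) => //= a t _ ->.
have h' : (0 < size (p ++ u ++ s))%N.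
  by rewrite !size_cat addnCA addn_gt0 lt0n size_eq0 u0.
by rewrite addn_gt0 IH ?orbT.
Qed.

Lemma occ_infix_flatten l bs v : (forall b, b \in bs -> size b = l) ->
  infix v (flatten bs) ->
  exists s bs' p, [/\ v = s ++ flatten bs' ++ p, (size s <= l)%N,
    (size p <= l)%N & {subset bs' <= bs}].
Proof.
elim: bs v => [|b bs IH] v hb /=.
  by rewrite infixs0 => /eqP ->; exists [::], [::], [::]; split.
have hbs : forall c, c \in bs -> size c = l.
  by move=> c cb; apply: hb; rewrite inE cb orbT.
have sb : size b = l by apply: hb; rewrite mem_head.
(* The same decomposition for prefixes, where no incomplete block is left at the beginning. *)
have hpre t bs1 : prefix t (flatten bs1) -> (forall c, c \in bs1 -> size c = l) ->
    exists bs' p, [/\ t = flatten bs' ++ p, (size p <= l)%N & {subset bs' <= bs1}].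
  elim: bs1 t => [|c bs1 IH1] t /=.
    by rewrite prefixs0 => /eqP -> _; exists [::], [::]; split.
  move=> /prefixP[r e] hc.
  have sc : size c = l by apply: hc; rewrite mem_head.
  case: (leqP (size c) (size t)) => h; last first.
    by exists [::], t; split => //; rewrite -sc ltnW.
  have tE : t = c ++ drop (size c) t.
    rewrite -{1}(cat_take_drop (size c) t); congr (_ ++ _).
    by rewrite -(takel_cat r h) -e take_size_cat.
  have /IH1 : prefix (drop (size c) t) (flatten bs1).
    apply/prefixP; exists r; rewrite -(drop_size_cat (flatten bs1) (erefl (size c))).
    rewrite e {1}tE -catA drop_size_cat//.
  move=> [|bs' [p [e1 e2 e3]]].
    by move=> d db; apply: hc; rewrite inE db orbT.
  exists (c :: bs'), p; split => //; first by rewrite tE e1 /= catA.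
  move=> d; rewrite !inE => /orP[->//|/e3 ->]; by rewrite orbT.
move=> /infixP[q [r e]].
case: (leqP (size b) (size q)) => h.
  have qE : q = b ++ drop (size b) q.
    rewrite -{1}(cat_take_drop (size b) q); congr (_ ++ _).
    by rewrite -(takel_cat (v ++ r) h) -e take_size_cat.
  have [|s [bs' [p [e1 e2 e3 e4]]]] := IH v hbs.
    apply/infixP; exists (drop (size b) q), r.
    by move: e; rewrite {1}qE -catA => /eqP; rewrite eqseq_cat// eqxx/= => /eqP.
  by exists s, bs', p; split => // d /e4; rewrite inE orbC => ->.
have bE : b = q ++ drop (size q) b.
  rewrite -{1}(cat_take_drop (size q) b); congr (_ ++ _).
  by rewrite -(takel_cat (flatten bs) (ltnW h)) e take_size_cat.
have e' : drop (size q) b ++ flatten bs = v ++ r.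
  by move: e; rewrite {1}bE -catA => /eqP; rewrite eqseq_cat// eqxx/= => /eqP.
set b' := drop (size q) b in bE e'.
have sb' : (size b' <= l)%N by rewrite /b' size_drop -sb leq_subr.
case: (leqP (size b') (size v)) => h'; last first.
  exists v, [::], [::]; split => //; rewrite ?cats0//.
  by apply: leq_trans (ltnW h') _.
have vE : v = b' ++ drop (size b') v.
  rewrite -{1}(cat_take_drop (size b') v); congr (_ ++ _).
  by rewrite -(takel_cat r h') -e' take_size_cat.
have [|//|bs' [p [e1 e2 e3]]] := hpre (drop (size b') v) bs.
  apply/prefixP; exists r; move: e'; rewrite {1}vE -catA => /eqP.
  by rewrite eqseq_cat// eqxx/= => /eqP.
exists b', bs', p; split => //; first by rewrite {1}vE e1.
by move=> d /e3; rewrite inE orbC => ->.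
Qed.

End occurrences.

(** * The language of iterated permutations *)

Lemma eq_of_norm_le {R : realFieldType} (x y : R) :
  (forall e, 0 < e -> `|x - y| <= e) -> x = y.
Proof.
move=> h; apply/eqP; rewrite -subr_eq0 -normr_le0; apply/ler_addgt0Pr => e e0.
by rewrite add0r h.
Qed.

Section permutation_language.
Context {R : realType} {B : finType}.
Implicit Types (u v w : seq B) (bs : seq (seq B)) (k n q : nat).

Fixpoint blocks k : seq (seq B) :=
  if k is k'.+1 then [seq flatten bs | bs <- permutations (blocks k')]
  else [seq [:: a] | a <- enum B].

Fixpoint block_len k : nat :=
  if k is k'.+1 then (size (blocks k') * block_len k')%N else 1%N.

Definition perm_lang u : Prop := exists k w, w \in blocks k /\ infix u w.

Lemma size_flatten_cst l bs : (forall b, b \in bs -> size b = l) ->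
  size (flatten bs) = (size bs * l)%N.
Proof.
elim: bs => //= b bs IH h; rewrite size_cat h ?mem_head// IH ?mulSn//.
by move=> c cb; apply: h; rewrite inE cb orbT.
Qed.

Lemma flatten_cst_inj l bs bs' : (0 < l)%N ->
  (forall b, b \in bs -> size b = l) -> (forall b, b \in bs' -> size b = l) ->
  flatten bs = flatten bs' -> bs = bs'.
Proof.
move=> l0; elim: bs bs' => [|b bs IH] [|c bs'] //= h h' e.
- by have := h' c (mem_head _ _); move/(congr1 size): e; rewrite size_cat/=; lia.
- by have := h b (mem_head _ _); move/(congr1 size): e; rewrite size_cat/=; lia.
- move/eqP: e; rewrite eqseq_cat; last by rewrite h ?h' ?mem_head.
  move=> /andP[/eqP -> /eqP e]; congr cons; apply: IH => // d db.
    by apply: h; rewrite inE db orbT.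
  by apply: h'; rewrite inE db orbT.
Qed.

Hypothesis B_gt2 : (2 < #|B|)%N.

(** The four facts support each other: equal lengths make concatenations uniquely decodable, so
    distinct orders of distinct blocks give distinct blocks, and the factorial keeps their number
    above two. *)
Lemma blocksP k : [/\ uniq (blocks k), (2 < size (blocks k))%N,
  (0 < block_len k)%N & forall w, w \in blocks k -> size w = block_len k].
Proof.
elim: k => [|k [u1 s1 l1 h1]] /=.
  split => //.
  - by rewrite map_inj_uniq ?enum_uniq// => a b [].
  - by rewrite size_map -cardE.
  - by move=> w /mapP[a _ ->].
have hp bs : bs \in permutations (blocks k) -> forall b, b \in bs -> size b = block_len k.
  by rewrite mem_permutations => /perm_mem e b; rewrite e; exact: h1.
split => //.
- rewrite map_inj_in_uniq ?permutations_uniq// => bs bs' hb hb'.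
  by apply: flatten_cst_inj l1 _ _; exact: hp.
- rewrite size_map size_permutations// (leq_trans s1)//.
  by case: (size _) => // n; rewrite factS leq_pmulr// fact_gt0.
- by rewrite muln_gt0 l1 (ltn_trans _ s1).
- move=> w /mapP[bs hb ->]; rewrite (size_flatten_cst (hp _ hb)).
  by move: hb; rewrite mem_permutations => /perm_size ->.
Qed.

Lemma blocks_uniq k : uniq (blocks k). Proof. by case: (blocksP k). Qed.
Lemma size_blocks_gt2 k : (2 < size (blocks k))%N. Proof. by case: (blocksP k). Qed.
Lemma size_blocks_gt0 k : (0 < size (blocks k))%N.
Proof. exact: ltn_trans (size_blocks_gt2 k). Qed.
Lemma block_len_gt0 k : (0 < block_len k)%N. Proof. by case: (blocksP k). Qed.
Lemma size_block k w : w \in blocks k -> size w = block_len k.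
Proof. by case: (blocksP k) => _ _ _; apply. Qed.

Lemma size_blocksS k : size (blocks k.+1) = (size (blocks k))`!.
Proof. by rewrite size_map size_permutations// blocks_uniq. Qed.

Lemma block_len_double k : (2 * block_len k <= block_len k.+1)%N.
Proof. by rewrite /= leq_mul2r ltnW ?orbT// size_blocks_gt2. Qed.

Lemma block_len_expn k : (2 ^ k <= block_len k)%N.
Proof.
elim: k => // k IH; rewrite expnS; apply: leq_trans (block_len_double k).
by rewrite leq_mul2l IH.
Qed.

Lemma block_len_gtn k : (k < block_len k)%N.
Proof. exact: leq_trans (ltn_expl k (ltnSn 1)) (block_len_expn k). Qed.

Lemma block_len_unbounded (C e : R) : 0 < e ->
  exists k, C / (block_len k)%:R <= e.
Proof.
move=> e0; exists (Num.truncn (`|C| / e)).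
set k := Num.truncn _; have hk : `|C| / e < (block_len k)%:R.
  apply: lt_le_trans (_ : k.+1%:R <= _); last by rewrite ler_nat block_len_gtn.
  exact: Num.Theory.truncnS_gt.
rewrite ler_pdivrMr ?ltr0n ?block_len_gt0// (le_trans (ler_norm _))//.
by rewrite mulrC -ler_pdivrMr// ltW.
Qed.

Lemma blocksSP k w : w \in blocks k.+1 ->
  exists2 bs, w = flatten bs & perm_eq bs (blocks k).
Proof. by move=> /mapP[bs]; rewrite mem_permutations => h ->; exists bs. Qed.

Lemma blocks_decomp k j w : w \in blocks (j + k) ->
  exists2 bs, w = flatten bs & {subset bs <= blocks k}.
Proof.
elim: j w => [|j IH] w.
  by move=> h; exists [:: w] => [|b]; rewrite /= ?cats0// inE => /eqP ->.
rewrite addSn => /blocksSP[bs -> /perm_mem h].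
have : {subset bs <= blocks (j + k)} by move=> b; rewrite h.
elim: bs {h} => [|b bs IHb] hb; first by exists [::].
have [|bs' e' h'] := IHb; first by move=> c cb; apply: hb; rewrite inE cb orbT.
have [bs1 e1 h1] := IH b (hb _ (mem_head _ _)).
exists (bs1 ++ bs'); first by rewrite flatten_cat /= -e' -e1.
by move=> c; rewrite mem_cat => /orP[/h1|/h'].
Qed.

Lemma infix_block_up k w : w \in blocks k -> exists2 w', w' \in blocks k.+1 & infix w w'.
Proof.
move=> h; exists (flatten (blocks k)).
  by apply/mapP; exists (blocks k) => //; rewrite mem_permutations.
have /path.splitPr[p1 p2] := h.
by rewrite flatten_cat /=; apply/infixP; exists (flatten p1), (flatten p2).
Qed.

(** A block is a factor of some block of the next level, so the word containing [u] may be taken in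
    a level above [k] and cut into blocks of level [k]. *)
Lemma perm_lang_level u k : perm_lang u ->
  exists2 w, infix u w & exists2 bs, w = flatten bs & {subset bs <= blocks k}.
Proof.
move=> [j [w [hw uw]]].
have [w' hw' uw'] : exists2 w', w' \in blocks (k + j) & infix u w'.
  elim: k => [|k [w1 h1 u1]]; first by exists w.
  by have [w2 h2 i2] := infix_block_up h1; exists w2 => //; exact: infix_trans u1 i2.
by exists w' => //; move: hw'; rewrite addnC; exact: blocks_decomp.
Qed.

Lemma perm_lang_infix u v : infix u v -> perm_lang v -> perm_lang u.
Proof. by move=> uv [k [w [hw vw]]]; exists k, w; split=> //; exact: infix_trans vw. Qed.

Lemma perm_lang_block k w : w \in blocks k -> perm_lang w.
Proof. by move=> h; exists k, w; split => //; exact: infix_refl. Qed.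

Lemma perm_lang_take n : exists2 u, perm_lang u & size u = n.
Proof.
have : (0 < size (blocks n))%N := size_blocks_gt0 n.
case e : (blocks n) => [//|w s] _.
have hw : w \in blocks n by rewrite e mem_head.
exists (take n w).
  apply: perm_lang_infix (perm_lang_block hw).
  by apply: prefixW; exact: prefix_take.
by rewrite size_takel// (size_block hw) ltnW// block_len_gtn.
Qed.

Lemma perm_lang_split u k : perm_lang u -> exists s bs p,
  [/\ u = s ++ flatten bs ++ p, (size s <= block_len k)%N,
      (size p <= block_len k)%N & {subset bs <= blocks k}].
Proof.
move=> /(perm_lang_level k)[w uw [bs wE hbs]].
have hs b : b \in bs -> size b = block_len k by move=> /hbs/size_block.
rewrite wE in uw.
have [s [bs' [p [h1 h2 h3 h4]]]] := occ_infix_flatten hs uw.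
by exists s, bs', p; split => // b /h4/hbs.
Qed.

Definition block_occ u k : nat := \sum_(w <- blocks k) occ u w.

(** Each block of level [k.+1] contains these [block_occ u k] occurrences inside its constituents,
    hence the length [block_len k.+1]; occurrences across a junction are neglected. *)
Definition block_freq u k : R := (block_occ u k)%:R / (block_len k.+1)%:R.

Lemma block_len_gt0R k : 0 < (block_len k)%:R :> R.
Proof. by rewrite ltr0n block_len_gt0. Qed.

Lemma occ_block_bounds u k w : w \in blocks k.+1 ->
  (block_occ u k <= occ u w <= block_occ u k + size (blocks k) * size u)%N.
Proof.
move=> /blocksSP[bs -> pbs]; rewrite /block_occ -(perm_big _ pbs)/=.
by rewrite occ_flatten_ge -(perm_size pbs) occ_flatten_le.
Qed.

Lemma block_occS u k :
  (size (blocks k.+1) * block_occ u k <= block_occ u k.+1 <=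
   size (blocks k.+1) * (block_occ u k + size (blocks k) * size u))%N.
Proof.
rewrite {2 3}/block_occ; apply/andP; split.
  rewrite mulnC -iter_addn_0 -[X in iter X]count_predT -big_const_seq.
  rewrite big_seq [leqRHS]big_seq; apply: leq_sum => w hw.
  by have /andP[] := occ_block_bounds u hw.
rewrite mulnC -iter_addn_0 -[X in iter X]count_predT -big_const_seq.
rewrite big_seq [leqRHS]big_seq; apply: leq_sum => w hw.
by have /andP[] := occ_block_bounds u hw.
Qed.

(** The increase comes from occurrences across junctions: at most [size u] for each constituent of
    length [block_len k]. *)
Lemma block_freqS u k : block_freq u k <= block_freq u k.+1 <=
  block_freq u k + (size u)%:R / (block_len k)%:R.
Proof.
have /andP[h1 h2] := block_occS u k.
have N0 : 0 < (size (blocks k.+1))%:R :> R by rewrite ltr0n size_blocks_gt0.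
have M0 : 0 < (size (blocks k))%:R :> R by rewrite ltr0n size_blocks_gt0.
have l0 := block_len_gt0R k; have l1 := block_len_gt0R k.+1.
have E : (block_len k.+2)%:R = (size (blocks k.+1))%:R * (block_len k.+1)%:R :> R.
  by rewrite -natrM.
have E1 : (block_len k.+1)%:R = (size (blocks k))%:R * (block_len k)%:R :> R.
  by rewrite -natrM.
move: h1 h2; rewrite -!(ler_nat R) !natrM natrD natrM /block_freq E => h1 h2.
apply/andP; split.
  rewrite ler_pdivrMr//.
  rewrite [leRHS](_ : _ = (block_occ u k.+1)%:R / (size (blocks k.+1))%:R); last first.
    by field; rewrite !gt_eqF.
  by rewrite ler_pdivlMr// mulrC.
rewrite ler_pdivrMr ?mulr_gt0//; apply: (le_trans h2).
rewrite le_eqVlt; apply/orP; left; apply/eqP; rewrite E1; field.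
by rewrite !gt_eqF.
Qed.

(** The factor 2 makes this bound non-increasing: of [2 * size u / block_len k], one half pays for
    the junctions and the other half suffices at the next level, as lengths at least double. *)
Definition block_freq_ub u k : R :=
  block_freq u k + 2 * (size u)%:R / (block_len k)%:R.

Lemma block_freq_ubS u k : block_freq_ub u k.+1 <= block_freq_ub u k.
Proof.
rewrite /block_freq_ub; have /andP[_ h] := block_freqS u k.
apply: (le_trans (lerD h (lexx _))).
rewrite -addrA lerD2l -mulrA -lerBrDl.
have -> : 2 * (size u)%:R / (block_len k)%:R - (size u)%:R / (block_len k)%:R =
   (size u)%:R / (block_len k)%:R :> R by lra.
rewrite mulrA ler_pdivrMr ?block_len_gt0R// mulrAC ler_pdivlMr ?block_len_gt0R//.
rewrite mulrAC [leRHS]mulrC ler_wpM2r// -natrM ler_nat.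
exact: block_len_double.
Qed.

Definition word_freq u : R := sup (range (block_freq u)).

Lemma block_freq_mono u : {homo block_freq u : i j / (i <= j)%N >-> i <= j}.
Proof.
apply: homo_leq => //; first exact: le_trans.
by move=> k; have /andP[] := block_freqS u k.
Qed.

Lemma block_freq_le_ub u i j : block_freq u i <= block_freq_ub u j.
Proof.
apply: (@le_trans _ _ (block_freq u (maxn i j))).
  by apply: block_freq_mono; rewrite leq_maxl.
apply: (@le_trans _ _ (block_freq_ub u (maxn i j))).
  by rewrite /block_freq_ub lerDl divr_ge0// mulr_ge0.
have : (j <= maxn i j)%N by rewrite leq_maxr.
apply: (@homo_leq _ (block_freq_ub u) (fun x y : R => y <= x)) => //.
- by move=> x y z h1 h2; exact: le_trans h2 h1.
- exact: block_freq_ubS.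
Qed.

Lemma word_freq_bounds u k : block_freq u k <= word_freq u <= block_freq_ub u k.
Proof.
have ub : ubound (range (block_freq u)) (block_freq_ub u k).
  by move=> _ [j _ <-]; exact: block_freq_le_ub.
apply/andP; split; last by apply: ge_sup => //; exists (block_freq u 0%N), 0%N.
apply: ub_le_sup; last by exists k.
by exists (block_freq_ub u k).
Qed.

Lemma block_freq_ge0 u k : 0 <= block_freq u k.
Proof. by rewrite divr_ge0. Qed.

Lemma word_freq_ge0 u : 0 <= word_freq u.
Proof. by have /andP[h _] := word_freq_bounds u 0; exact: le_trans (block_freq_ge0 _ _) h. Qed.

Lemma word_freq_unique u (x : R) C :
  (forall k, `|block_freq u k - x| <= C / (block_len k)%:R) -> word_freq u = x.
Proof.
move=> h; apply: eq_of_norm_le => e e0.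
have [k hk] := block_len_unbounded (C + 2 * (size u)%:R) e0.
apply: le_trans hk; rewrite mulrDl -(subrKA (block_freq u k)).
apply: (le_trans (ler_normD _ _)); rewrite addrC lerD//.
have /andP[h1 h2] := word_freq_bounds u k.
by rewrite ger0_norm ?subr_ge0// lerBlDl.
Qed.

Lemma word_freq_nil : word_freq [::] = 1.
Proof.
apply: (@word_freq_unique _ _ 0) => k; rewrite mul0r normr_le0 subr_eq0.
rewrite /block_freq (_ : block_occ _ _ = block_len k.+1) ?divff//.
  by rewrite gt_eqF// block_len_gt0R.
rewrite /block_occ; under eq_bigr do rewrite occ_nil.
rewrite big_seq (eq_bigr (fun=> block_len k)); last by move=> w /size_block.
by rewrite -big_seq big_const_seq count_predT iter_addn_0 mulnC.
Qed.

(** An error of one occurrence per block disappears in the limit. The two instances below are the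
    consistency and the shift invariance of the frequencies, regarded as masses of cylinders. *)
Lemma block_occ_sum_unif (F : B -> seq B) u :
  (forall w, \sum_(a : B) occ (F a) w <= occ u w <= (\sum_(a : B) occ (F a) w).+1)%N ->
  word_freq u = \sum_(a : B) word_freq (F a).
Proof.
move=> h; apply: (@word_freq_unique _ _ (1 + \sum_a 2 * (size (F a))%:R)) => k.
rewrite mulrDl mulr_suml.
rewrite -(subrKA (\sum_a block_freq (F a) k)); apply: (le_trans (ler_normD _ _)).
apply: lerD; last first.
  rewrite -sumrB; apply: (le_trans (ler_norm_sum _ _ _)); apply: ler_sum => a _.
  have /andP[h1 h2] := word_freq_bounds (F a) k.
  by rewrite distrC ger0_norm ?subr_ge0// lerBlDl.
rewrite /block_freq -mulr_suml -mulrBl normrM [X in _ * X]ger0_norm ?invr_ge0//.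
rewrite ler_pdivrMr ?block_len_gt0R// div1r /= natrM mulrCA mulVf ?mulr1; last first.
  by rewrite gt_eqF// block_len_gt0R.
rewrite -natr_sum.
have /andP[h1 h2] : (\sum_a block_occ (F a) k <= block_occ u k <=
    \sum_a block_occ (F a) k + size (blocks k))%N.
  rewrite /block_occ exchange_big/=; apply/andP; split.
    by apply: leq_sum => w _; have /andP[] := h w.
  rewrite -[X in (_ + X)%N]mul1n -iter_addn_0 -[X in iter X]count_predT -big_const_seq.
  by rewrite -big_split/=; apply: leq_sum => w _; have /andP[_] := h w; rewrite addn1.
rewrite -natrB// ger0_norm// ler_nat; lia.
Qed.

Lemma word_freq_rcons u : word_freq u = \sum_(a : B) word_freq (rcons u a).
Proof. by apply: block_occ_sum_unif => w; exact: occ_rcons_sum. Qed.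

Lemma word_freq_cons u : word_freq u = \sum_(a : B) word_freq (a :: u).
Proof. by apply: block_occ_sum_unif => w; exact: occ_cons_sum. Qed.

Lemma word_freq_gt0_lang u : 0 < word_freq u -> perm_lang u.
Proof.
move=> h.
have [k hk] : exists k, 0 < block_freq u k.
  apply: contrapT => /forallNP hN; move: h; rewrite ltNge => /negP; apply.
  apply: ge_sup; first by exists (block_freq u 0%N), 0%N.
  by move=> _ [k _ <-]; rewrite leNgt; apply/negP; exact: hN.
have : (0 < block_occ u k)%N.
  rewrite lt0n; apply: contraTneq hk => e.
  by rewrite /block_freq e mul0r ltxx.
rewrite /block_occ lt0n sum_nat_seq_neq0 => /hasP[w hw].
by rewrite -lt0n => /occ_gt0_infix uw; exists k, w.
Qed.

Lemma word_freq_gt0 u k w : w \in blocks k -> (0 < occ u w)%N -> 0 < word_freq u.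
Proof.
move=> hw h; have /andP[h1 _] := word_freq_bounds u k; apply: lt_le_trans h1.
rewrite divr_gt0 ?block_len_gt0R// ltr0n lt0n sum_nat_seq_neq0.
by apply/hasP; exists w => //; rewrite -lt0n.
Qed.

Lemma size_decomp u s p bs k : {subset bs <= blocks k} ->
  u = s ++ flatten bs ++ p -> size u = (size s + size bs * block_len k + size p)%N.
Proof.
move=> hbs ->; rewrite !size_cat (size_flatten_cst (l := block_len k)) ?addnA//.
by move=> b /hbs/size_block.
Qed.

(* Every word of level [k.+1] contains each block of level [k] exactly once, so
   occurrences of [u] are equidistributed in all words of the language. *)
Lemma occ_word_freq u k : exists C : R, forall v, perm_lang v ->
  `|(occ u v)%:R - (size v)%:R * word_freq u| <=
    (size v)%:R * (2 * (size u)%:R / (block_len k)%:R) + C.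
Proof.
set l1 := block_len k.+1; set m := size u.
exists (2 * l1%:R * (1 + word_freq u) + 2 * m%:R) => v.
move=> /(perm_lang_split k.+1)[s [bs [p [vE hs hp hbs]]]].
have sv := size_decomp hbs vE; rewrite -/l1 in sv hs hp.
have /andP[b1 b2] := word_freq_bounds u k.
set c := word_freq u in b1 b2 *; set ck := block_freq u k in b1 b2.
have c0 : 0 <= c := word_freq_ge0 u.
have l10 : 0 < l1%:R :> R := block_len_gt0R k.+1.
have l0 : 0 < (block_len k)%:R :> R := block_len_gt0R k.
have occk : (block_occ u k)%:R = l1%:R * ck by rewrite /ck /block_freq; field; rewrite gt_eqF.
have sumlb : (size bs * block_occ u k <= \sum_(b <- bs) occ u b)%N.
  rewrite mulnC -iter_addn_0 -[X in iter X]count_predT -big_const_seq.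
  rewrite big_seq [leqRHS]big_seq; apply: leq_sum => b /hbs hb.
  by have /andP[] := occ_block_bounds u hb.
have sumub : (\sum_(b <- bs) occ u b <= size bs * (block_occ u k + size (blocks k) * m))%N.
  rewrite mulnC -iter_addn_0 -[X in iter X]count_predT -big_const_seq.
  rewrite big_seq [leqRHS]big_seq; apply: leq_sum => b /hbs hb.
  by have /andP[] := occ_block_bounds u hb.
have lb : (size bs * block_occ u k <= occ u v)%N.
  rewrite vE; apply: leq_trans (occ_cat_ge _ _ _); apply: leq_trans (leq_addl _ _).
  apply: leq_trans (occ_cat_ge _ _ _); apply: leq_trans (leq_addr _ _).
  by apply: leq_trans sumlb _; exact: occ_flatten_ge.
have ub : (occ u v <= size bs * (block_occ u k + size (blocks k) * m) + size bs * m
    + 2 * l1 + 2 * m)%N.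
  have q1 := occ_cat_le u s (flatten bs ++ p).
  have q2 := occ_cat_le u (flatten bs) p.
  have q3 := occ_flatten_le u bs.
  have q4 := occ_le_size u s; have q5 := occ_le_size u p.
  have q6 := geq_minr (size s) (size u); have q7 := geq_minr (size (flatten bs)) (size u).
  rewrite vE /m; rewrite -/m in sumub q3; move: sumub q1 q2 q3 q4 q5 q6 q7 hs hp.
  move: (size bs * _)%N (size bs * size u)%N => X Y; rewrite -/m; lia.
have E1 : l1%:R = (size (blocks k))%:R * (block_len k)%:R :> R by rewrite -natrM.
move: lb ub sv hs hp; rewrite -!(ler_nat R) => lb ub sv hs hp.
have svR : (size v)%:R = (size s)%:R + (size bs)%:R * l1%:R + (size p)%:R :> R.
  by rewrite sv !natrD natrM.
rewrite !natrD !natrM !natrD !natrM occk in lb ub.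
have m0 : 0 <= m%:R :> R by [].
set e := 2 * m%:R / (block_len k)%:R.
have e0 : 0 <= e by rewrite divr_ge0// mulr_ge0.
have eE : m%:R = e * (block_len k)%:R / 2 by rewrite /e; field; rewrite gt_eqF.
have hM : (size (blocks k))%:R * m%:R = l1%:R * e / 2 :> R by rewrite E1 eE; field.
have hm : m%:R <= l1%:R * e / 2.
  rewrite -hM ler_peMl// -[1]/(1%:R) ler_nat; exact: size_blocks_gt0.
rewrite hM in ub.
rewrite ler_norml; apply/andP; split.
  have : (size bs)%:R * (l1%:R * ck) >= (size bs)%:R * (l1%:R * (c - e)).
    by rewrite ler_wpM2l// ler_wpM2l ?(ltW l10)// lerBlDr.
  rewrite svR; set X := (size bs)%:R * _ in lb * => h.
  have s1 : (size s)%:R * c <= l1%:R * c by rewrite ler_wpM2r.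
  have p1 : (size p)%:R * c <= l1%:R * c by rewrite ler_wpM2r.
  have s2 : 0 <= (size s)%:R * e by rewrite mulr_ge0.
  have p2 : 0 <= (size p)%:R * e by rewrite mulr_ge0.
  lra.
have : (size bs)%:R * (l1%:R * ck) <= (size bs)%:R * (l1%:R * c).
  by rewrite ler_wpM2l// ler_wpM2l ?(ltW l10).
have : (size bs)%:R * m%:R <= (size bs)%:R * (l1%:R * e / 2) by rewrite ler_wpM2l.
rewrite svR => h1 h2.
have s1 : 0 <= (size s)%:R * c by rewrite mulr_ge0.
have p1 : 0 <= (size p)%:R * c by rewrite mulr_ge0.
have s2 : 0 <= (size s)%:R * e by rewrite mulr_ge0.
have p2 : 0 <= (size p)%:R * e by rewrite mulr_ge0.
have lc : 0 <= l1%:R * c by rewrite mulr_ge0// ltW.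
rewrite mulrDr in ub.
lra.
Qed.

End permutation_language.

Local Arguments words : simpl never.

(** * Entropy of the permutation language *)

Section language_entropy.
Context {R : realType} {B : finType}.
Implicit Types (u v w : seq B) (bs : seq (seq B)) (k n q : nat).
Hypothesis B_gt2 : (2 < #|B|)%N.

Local Notation blocks := (@blocks B).
Local Notation block_len := (@block_len B).

Definition level_entropy k : R := ln (size (blocks k))%:R / (block_len k)%:R.

Definition lang_entropy : R := inf (range level_entropy).

Lemma ln_nat_ge0 n : 0 <= ln (n%:R : R).
Proof. by case: n => [|n]; [rewrite ln0|rewrite ln_ge0// ler1n]. Qed.

(** The weak form of Stirling's formula that controls the entropy lost from one level to the
    next. *)
Lemma ln_fact_bounds n :
  n%:R * ln n%:R - n%:R <= ln (n`!%:R : R) <= n%:R * ln n%:R.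
Proof.
elim: n => [|n /andP[h1 h2]]; first by rewrite fact0 ln1 !mul0r subr0 lexx.
rewrite factS natrM lnM ?posrE ?ltr0n ?fact_gt0// -natr1 mulrDl mul1r.
case: n h1 h2 => [|n] h1 h2.
  by rewrite add0r (_ : 0`!%:R = 1)// ln1; apply/andP; split; lra.
have mono : ln n.+1%:R <= ln (n.+1%:R + 1) :> R.
  by rewrite ler_ln ?posrE// ?addr_gt0// lerDl.
have step : n.+1%:R * (ln (n.+1%:R + 1) - ln n.+1%:R) <= 1 :> R.
  rewrite -ln_div ?posrE// ?addr_gt0// mulrC -ler_pdivlMr// div1r.
  rewrite mulrDl divff ?gt_eqF// mul1r; apply: le_ln1Dx.
  by apply: lt_trans (_ : 0 < _); rewrite ?ltrN10// invr_gt0.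
apply/andP; split.
  by move: h1 step; rewrite mulrBr; lra.
have : n.+1%:R * ln n.+1%:R <= n.+1%:R * ln (n.+1%:R + 1) :> R by rewrite ler_wpM2l.
by move: h2; lra.
Qed.

(** With [N] blocks of length [l], the next level has [N!] blocks of length [N * l]; the term [- N]
    in Stirling's bound becomes the loss [1 / l]. *)
Lemma level_entropyS k :
  level_entropy k - (block_len k)%:R^-1 <= level_entropy k.+1 <= level_entropy k.
Proof.
have N0 : 0 < (size (blocks k))%:R :> R by rewrite ltr0n (size_blocks_gt0 B_gt2).
have l0 : 0 < (block_len k)%:R :> R := block_len_gt0R B_gt2 k.
have -> : level_entropy k.+1 = ln (size (blocks k))`!%:R /
    ((size (blocks k))%:R * (block_len k)%:R).
  by rewrite /level_entropy (size_blocksS B_gt2) -natrM.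
rewrite /level_entropy.
have /andP[h1 h2] := ln_fact_bounds (size (blocks k)).
set N := (size _)%:R in N0 h1 h2 *; set l := (block_len k)%:R in l0 *.
apply/andP; split.
  rewrite ler_pdivlMr ?mulr_gt0//; apply: le_trans h1.
  rewrite le_eqVlt; apply/orP; left; apply/eqP; field; exact: lt0r_neq0.
rewrite ler_pdivrMr ?mulr_gt0//; apply: (le_trans h2).
rewrite le_eqVlt; apply/orP; left; apply/eqP; field; exact: lt0r_neq0.
Qed.

(** Since lengths double, [level_entropy i - 2 / block_len i] is non-decreasing in [i], whereas
    [level_entropy] itself is non-increasing; both are compared at [maxn k j]. *)
Lemma level_entropy_lb k j :
  level_entropy k - 2 / (block_len k)%:R <= level_entropy j.
Proof.
have up i : level_entropy i - 2 / (block_len i)%:R <=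
    level_entropy i.+1 - 2 / (block_len i.+1)%:R.
  have /andP[h _] := level_entropyS i.
  have : 2 / (block_len i.+1)%:R <= (block_len i)%:R^-1 :> R.
    rewrite ler_pdivrMr ?(block_len_gt0R B_gt2)// ler_pdivlMl ?(block_len_gt0R B_gt2)//.
    by rewrite mulrC -natrM ler_nat block_len_double.
  by move: h; lra.
apply: (@le_trans _ _ (level_entropy (maxn k j) - 2 / (block_len (maxn k j))%:R)).
  apply: (@homo_leq _ (fun i => level_entropy i - 2 / (block_len i)%:R) <=%R) => //.
    by move=> x y z; exact: le_trans.
  exact: leq_maxl.
apply: (@le_trans _ _ (level_entropy (maxn k j))).
  by rewrite gerBl divr_ge0.
apply: (@homo_leq _ level_entropy (fun x y : R => y <= x)) => //.
- by move=> x y z h1 h2; exact: le_trans h2 h1.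
- by move=> i; have /andP[] := level_entropyS i.
- exact: leq_maxr.
Qed.

Lemma lang_entropy_le k : lang_entropy <= level_entropy k.
Proof.
apply: ge_inf; last by exists k.
exists (level_entropy 0 - 2 / (block_len 0)%:R) => _ [j _ <-].
exact: level_entropy_lb.
Qed.

Lemma lang_entropy_ge k : level_entropy k - 2 / (block_len k)%:R <= lang_entropy.
Proof.
apply: lb_le_inf; first by exists (level_entropy 0), 0%N.
by move=> _ [j _ <-]; exact: level_entropy_lb.
Qed.

(** At level 0 the entropy is [ln #|B|], blocks have length 1, and all later losses add up to at
    most 2. *)
Lemma lang_entropy_gt0 : 2 < ln #|B|%:R :> R -> 0 < lang_entropy.
Proof.
move=> h; apply: lt_le_trans (lang_entropy_ge 0).
by rewrite /level_entropy /= divr1 size_map -cardE subr_gt0 divr1.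
Qed.

Lemma level_entropy_approx (e : R) : 0 < e -> exists k, level_entropy k <= lang_entropy + e.
Proof.
move=> e0; have [k hk] := block_len_unbounded B_gt2 2 e0.
by exists k; have := lang_entropy_ge k; move: hk; lra.
Qed.

Definition lang_words (L : seq B -> Prop) n := [seq u <- words n | `[< L u >]].

Lemma lang_words_uniq L n : uniq (lang_words L n).
Proof. by rewrite filter_uniq// words_uniq. Qed.

Lemma mem_lang_words L n u : (u \in lang_words L n) = `[< L u >] && (size u == n).
Proof. by rewrite mem_filter mem_words. Qed.

Fixpoint block_seqs k q : seq (seq (seq B)) :=
  if q is q'.+1 then [seq b :: bs | b <- blocks k, bs <- block_seqs k q'] else [:: [::]].

Lemma mem_block_seqs k bs : {subset bs <= blocks k} -> bs \in block_seqs k (size bs).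
Proof.
elim: bs => //= b bs IH h; apply/allpairsP; exists (b, bs) => /=; split => //.
  by apply: h; rewrite mem_head.
by apply: IH => c cb; apply: h; rewrite inE cb orbT.
Qed.

Lemma size_block_seqs k q : size (block_seqs k q) = (size (blocks k) ^ q)%N.
Proof. by elim: q => //= q IH; rewrite size_allpairs IH expnS. Qed.

(** A word of length [n] is determined by its two incomplete end blocks, which range over a finite
    list independent of [n], and by the at most [n / block_len k] whole blocks between them. *)
Lemma lang_count_le k : exists K : R, forall n,
  (size (lang_words perm_lang n))%:R <= K * expR (level_entropy k * n%:R).
Proof.
set l := block_len k; set N := size (blocks k).
pose short := flatten [seq @words B i | i <- iota 0 l.+1].
have memshort s : (size s <= l)%N -> s \in short.
  move=> hs; apply/flattenP; exists (words (size s)); last by rewrite mem_words.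
  by apply/mapP; exists (size s) => //; rewrite mem_iota.
have l0 : (0 < l)%N := block_len_gt0 B_gt2 k.
have l0R : 0 < l%:R :> R by rewrite ltr0n.
have N0 : 0 < N%:R :> R by rewrite ltr0n (size_blocks_gt0 B_gt2).
exists ((size short)%:R ^+ 2) => n.
pose cov := flatten [seq [seq sp.1 ++ flatten bs ++ sp.2 |
   bs <- block_seqs k ((n - size sp.1 - size sp.2) %/ l)] | sp <- [seq (s, p) | s <- short, p <- short]].
have sub : {subset lang_words perm_lang n <= cov}.
  move=> u; rewrite mem_lang_words => /andP[/asboolP /(perm_lang_split B_gt2 k)].
  move=> [s [bs [p [uE hs hp hbs]]]] /eqP su.
  have e := size_decomp B_gt2 hbs uE; rewrite -/l su in e.
  apply/flattenP; eexists; first by apply/mapP; exists (s, p) => //;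
    apply/allpairsP; exists (s, p) => /=; split => //; exact: memshort.
  apply/mapP; exists bs => //=.
  have -> : ((n - size s - size p) = size bs * l)%N by rewrite e; lia.
  by rewrite mulnK//; exact: mem_block_seqs.
have := uniq_leq_size (lang_words_uniq _ _) sub.
rewrite -(ler_nat R) => /le_trans; apply.
rewrite size_flatten /shape -map_comp sumnE big_map natr_sum.
apply: (le_trans (ler_sum_uniq_cst (c := expR (level_entropy k * n%:R)) _)).
  move=> [s p] _ /=; rewrite size_map size_block_seqs natrX.
  rewrite -[N%:R]lnK ?posrE// -expRM_natr ler_expR.
  rewrite /level_entropy -/N -/l -mulrA ler_wpM2l ?ln_nat_ge0//.
  rewrite ler_pdivlMl// -natrM ler_nat mulnC.
  by apply: leq_trans (leq_divM _ _) _; rewrite -subnDA leq_subr.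
by rewrite size_allpairs natrM mulrC -expr2.
Qed.

Lemma lang_count_exp (e : R) : 0 < e -> exists2 K : R, 0 < K & forall n,
  (size (lang_words perm_lang n))%:R <= K * expR ((lang_entropy + e) * n%:R).
Proof.
move=> /level_entropy_approx[k hk]; have [K hK] := lang_count_le k.
exists (1 + `|K|); first by rewrite ltr_pwDl.
move=> n; apply: (le_trans (hK n)).
apply: (@le_trans _ _ ((1 + `|K|) * expR (level_entropy k * n%:R))).
  by rewrite ler_wpM2r ?expR_ge0// (le_trans (ler_norm _))// lerDr.
by rewrite ler_wpM2l ?addr_ge0// ler_expR ler_wpM2r.
Qed.

Local Notation word_freq := (@word_freq R B).

Definition word_entropy q : R := - \sum_(u <- words q) word_freq u * ln (word_freq u).

(* The Markov weight extends words to the left; Gibbs' inequality against it on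
   the blocks of a level bounds the conditional entropies from below. *)
Fixpoint markov q w : R :=
  if w is a :: w' then
    (if (size w' < q)%N then #|B|%:R^-1
     else word_freq (a :: take q w') / word_freq (take q w')) * markov q w'
  else 1.

Lemma markov_ge0 q w : 0 <= markov q w.
Proof.
elim: w => //= a w IH; rewrite mulr_ge0//; case: ifP => _; first by rewrite invr_ge0.
by rewrite divr_ge0// word_freq_ge0.
Qed.

(** Possibly less than 1: after a context of frequency zero, division by zero makes all transition
    weights vanish. *)
Lemma markov_sum q n : \sum_(w <- words n) markov q w <= 1.
Proof.
elim: n => [|n IH]; first by rewrite /= big_seq1.
rewrite big_words_cons exchange_big/=; apply: le_trans IH.
rewrite big_seq [leRHS]big_seq; apply: ler_sum => w; rewrite mem_words => /eqP sw.
rewrite -mulr_suml ler_piMl ?markov_ge0//; case: (ltnP (size w) q) => h.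
  rewrite sumr_const -[X in X <= _]mulr_natl divff//.
  by rewrite pnatr_eq0 -lt0n; apply: leq_trans B_gt2.
rewrite -mulr_suml -word_freq_cons//.
have [->|nz] := eqVneq (word_freq (take q w)) 0; first by rewrite mul0r.
by rewrite divff.
Qed.

(** Minus the logarithm of the Markov transition weight: the information of the first letter of [u]
    given the letters after it. *)
Definition cond_info u : R := ln (word_freq (behead u)) - ln (word_freq u).

Lemma word_freq_cons_le a u : word_freq (a :: u) <= word_freq u.
Proof.
rewrite [leRHS](word_freq_cons B_gt2) (bigD1 a)//= lerDl sumr_ge0// => b _.
exact: word_freq_ge0.
Qed.

Lemma word_freq_infix_gt0 u w k : w \in blocks k -> infix u w -> 0 < word_freq u.
Proof.
move=> hw uw; apply: (word_freq_gt0 B_gt2 hw); apply: infix_occ_gt0 => //.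
by rewrite (size_block B_gt2 hw) (block_len_gt0 B_gt2).
Qed.

(** A letter of [t] followed by at least [q] others contributes the [cond_info] of the [q.+1]
    letters read there, and each of the last [q] letters contributes [ln #|B|]. The weight is
    positive because factors of a block have positive frequency. *)
Lemma ln_markov q k w t : w \in blocks k -> suffix t w ->
  0 < markov q t /\
  - ln (markov q t) <= q%:R * ln #|B|%:R + \sum_(u <- words q.+1) (occ u t)%:R * cond_info u.
Proof.
move=> hw.
have B0 : 0 < #|B|%:R :> R by rewrite ltr0n; apply: leq_trans B_gt2.
(* For the induction, the initial cost must count only the letters already read. *)
suff h : suffix t w -> 0 < markov q t /\
  - ln (markov q t) <= (minn (size t) q)%:R * ln #|B|%:R
     + \sum_(u <- words q.+1) (occ u t)%:R * cond_info u.
  move=> /h[h1 h2]; split => //; apply: (le_trans h2).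
  by rewrite lerD2r ler_wpM2r ?ln_nat_ge0// ler_nat geq_minr.
elim: t => [|a t IH] tw.
  rewrite /= ln1 oppr0; split => //.
  by rewrite min0n mul0r add0r big1// => u _; rewrite mul0r.
have tw' : suffix t w by apply: suffix_trans tw; rewrite -cat1s; exact: suffix_suffix.
have [m0 IH2] := IH tw'.
rewrite [markov _ _]/=; case: ifP => h.
  have C0 : 0 < #|B|%:R^-1 :> R by rewrite invr_gt0.
  rewrite mulr_gt0//; split => //.
  rewrite lnM ?posrE// lnV ?posrE// opprD opprK.
  have -> : minn (size (a :: t)) q = (minn (size t) q).+1 by rewrite /=; lia.
  rewrite -natr1 mulrDl mul1r [_ + ln _]addrC -addrA lerD2l.
  apply: (le_trans IH2); rewrite lerD2l big_seq [leRHS]big_seq.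
  apply: ler_sum => u; rewrite mem_words => /eqP su.
  by rewrite !occ_small// su/= ltnS// ltnW.
move/negbT: h; rewrite -leqNgt => h.
have iu : infix (a :: take q t) w.
  apply: infix_trans (suffixW tw); apply: prefixW.
  by rewrite prefix_cons eqxx prefix_take.
have iv : infix (take q t) w.
  by apply: infix_trans iu; rewrite -cat1s; apply: suffixW; exact: suffix_suffix.
have p1 := word_freq_infix_gt0 hw iu; have p2 := word_freq_infix_gt0 hw iv.
rewrite mulr_gt0 ?divr_gt0//; split => //.
rewrite lnM ?posrE ?divr_gt0// ln_div ?posrE// opprD opprB.
have -> : minn (size (a :: t)) q = minn (size t) q by rewrite /=; lia.
have mu : a :: take q t \in words q.+1 by rewrite mem_words/= size_takel.
have -> : \sum_(u <- words q.+1) (occ u (a :: t))%:R * cond_info u =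
    cond_info (a :: take q t) + \sum_(u <- words q.+1) (occ u t)%:R * cond_info u.
  under eq_bigr do rewrite /= natrD mulrDl.
  rewrite big_split/=; congr (_ + _).
  rewrite (bigD1_seq _ mu)/= ?words_uniq// prefix_cons eqxx prefix_take mul1r.
  rewrite big_seq_cond big1 ?addr0// => u; rewrite mem_words => /andP[/eqP su une].
  rewrite (_ : prefix u _ = false) ?mul0r//.
  by apply: contraNF une; rewrite prefixE su /= eq_sym.
by move: IH2; rewrite {2}/cond_info [behead _]/=; lra.
Qed.

Lemma sum_cond_info q :
  \sum_(u <- words q.+1) word_freq u * cond_info u = word_entropy q.+1 - word_entropy q.
Proof.
rewrite /word_entropy opprK addrC.
under eq_bigr do rewrite mulrBr.
rewrite sumrB; congr (_ - _).
rewrite big_words_cons exchange_big/=; apply: eq_bigr => u _.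
by rewrite -mulr_suml -(word_freq_cons B_gt2).
Qed.

Lemma cond_info_ge0 u : 0 < word_freq u -> 0 <= cond_info u.
Proof.
move=> h; rewrite /cond_info subr_ge0; case: u h => [|a u] h //=.
have h' := word_freq_cons_le a u.
by rewrite ler_ln ?posrE// (lt_le_trans h).
Qed.

(** The uniform distribution on the [N] blocks of level [k] has entropy [ln N]. By Gibbs this is at
    most the mean of [- ln markov], which is the initial cost plus at most [block_len k] times the
    conditional entropy, as [block_freq] lies below [word_freq]. Divided by [block_len k], the
    initial cost tends to zero. *)
Lemma cond_entropy_ge q : lang_entropy <= word_entropy q.+1 - word_entropy q.
Proof.
apply/ler_addgt0Pr => e e0.
have [k hk] := block_len_unbounded B_gt2 (q%:R * ln #|B|%:R) e0.
apply: (le_trans (lang_entropy_le k)).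
have l0 : 0 < (block_len k)%:R :> R := block_len_gt0R B_gt2 k.
have N0 : 0 < (size (blocks k))%:R :> R by rewrite ltr0n (size_blocks_gt0 B_gt2).
set N := size (blocks k) in N0; set l := block_len k in l0 hk *.
rewrite /level_entropy -/N -/l ler_pdivrMr//.
suff h : ln N%:R <= q%:R * ln #|B|%:R + l%:R * (word_entropy q.+1 - word_entropy q).
  apply: (le_trans h); rewrite mulrDl addrC mulrC lerD2l.
  by rewrite -ler_pdivrMr.
have hG : - \sum_(w <- blocks k) N%:R^-1 * ln (N%:R^-1) <=
    - \sum_(w <- blocks k) N%:R^-1 * ln (markov q w).
  apply: gibbs.
  - by move=> w _; rewrite invr_ge0.
  - by move=> w _; exact: markov_ge0.
  - by move=> w hw _; have [] := ln_markov q hw (suffix_refl w).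
  - rewrite big_const_seq count_predT iter_addr addr0 -[X in _ <= X]mulr_natr mulVf ?gt_eqF//.
    apply: le_trans (markov_sum q l).
    apply: ler_sum_subseq; [exact: blocks_uniq| |exact: markov_ge0].
    by move=> w hw; rewrite mem_words (size_block B_gt2 hw).
move: hG; rewrite big_const_seq count_predT iter_addr addr0 lnV ?posrE//.
rewrite -mulNrn mulrN opprK -[X in X <= _]mulr_natl mulrA divff ?gt_eqF// mul1r.
move=> /le_trans; apply; rewrite -mulr_sumr -mulrN -sumrN ler_pdivrMl//.
apply: (@le_trans _ _ (\sum_(w <- blocks k) (q%:R * ln #|B|%:R +
   \sum_(u <- words q.+1) (occ u w)%:R * cond_info u))).
  rewrite big_seq [leRHS]big_seq; apply: ler_sum => w hw.
  by have [] := ln_markov q hw (suffix_refl w).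
rewrite big_split/= big_const_seq count_predT iter_addr addr0 -[X in X + _ <= _]mulr_natl.
rewrite mulrDr lerD2l exchange_big/= -sum_cond_info mulrA mulr_sumr.
apply: ler_sum => u _; rewrite -mulr_suml mulrA -natr_sum.
rewrite -[\sum_(w <- blocks k) occ u w]/(block_occ u k).
have /andP[hb _] := @word_freq_bounds R B B_gt2 u k.
have [c0|c0] := ltP 0 (word_freq u).
  rewrite ler_wpM2r ?cond_info_ge0// mulrC; move: hb.
  rewrite /block_freq ler_pdivrMr ?(block_len_gt0R B_gt2)//.
  by rewrite -natrM.
(* A word of frequency zero has no occurrence in a block, so its term vanishes whatever the sign of
   [cond_info u]. *)
have c00 : word_freq u = 0 by apply/eqP; rewrite eq_le c0 word_freq_ge0.
have : block_freq u k = 0 :> R.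
  by apply/eqP; rewrite eq_le block_freq_ge0 -[X in _ <= X]c00 hb.
move=> /eqP; rewrite /block_freq mulf_eq0 invr_eq0 [X in _ || X]gt_eqF ?(block_len_gt0R B_gt2)//.
by rewrite orbF => /eqP ->; rewrite c00 mulr0 !mul0r.
Qed.

Lemma word_entropy_ge q : q%:R * lang_entropy <= word_entropy q.
Proof.
elim: q => [|q IH].
  by rewrite mul0r /word_entropy /= big_seq1 (word_freq_nil B_gt2) ln1 mulr0 oppr0.
rewrite -natr1 mulrDl mul1r; have := cond_entropy_ge q; move: IH; lra.
Qed.

End language_entropy.

(** * Laws and entropies of finite-valued maps *)

Lemma ln_prodr {R : realType} (I : Type) (s : seq I) (F : I -> R) :
  (forall i, 0 < F i) -> ln (\prod_(i <- s) F i) = \sum_(i <- s) ln (F i).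
Proof.
move=> F0; elim: s => [|i s IH]; first by rewrite !big_nil ln1.
by rewrite !big_cons lnM ?posrE ?prodr_gt0// IH.
Qed.

Definition lshift_sum n j (i : 'I_n) (t : 'I_j) : 'I_(n + j).
Proof. by apply: (@Ordinal _ (i + t)%N); rewrite -addSn leq_add// ltnW. Defined.

Section finite_laws.
Context {R : realType} {X : pmetricType R}.
Local Notation T := (borel X).
Variable mu : probability T R.

Definition measurable_fibers (W : finType) (Z : T -> W) :=
  forall w, measurable (Z @^-1` [set w]).

Definition law (W : finType) (Z : T -> W) (w : W) : R := fine (mu (Z @^-1` [set w])).

Definition law_entropy (W : finType) (Z : T -> W) : R :=
  - \sum_(w : W) law Z w * ln (law Z w).

Lemma measurable_fibers_pred (W : finType) (Z : T -> W) (S : set W) :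
  measurable_fibers Z -> measurable (Z @^-1` S).
Proof.
move=> mZ; rewrite (_ : Z @^-1` S = \bigcup_(w in S) (Z @^-1` [set w])).
  by apply: fin_bigcup_measurable => //; exact: finite_finset.
by apply/seteqP; split => [x Sx|x [w /= Sw Zx]]; [exists (Z x)|rewrite /= Zx].
Qed.

Lemma law_ge0 (W : finType) (Z : T -> W) w : 0 <= law Z w.
Proof. by rewrite fine_ge0. Qed.

Lemma law_sum (W : finType) (Z : T -> W) (S : pred W) : measurable_fibers Z ->
  \sum_(w | S w) law Z w = fine (mu (Z @^-1` [set w | S w])).
Proof.
move=> mZ; rewrite (_ : Z @^-1` _ = \bigcup_(w in [set w | S w]) (Z @^-1` [set w])).
  have fS : finite_set [set w | S w] by apply: (@finite_finset W).
  rewrite measure_fin_bigcup//.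
  - rewrite fsbig_finite//=.
    rewrite -sum_fine; last by move=> w _; rewrite fin_num_measure.
    rewrite (_ : \sum_(w | S w) law Z w = \sum_(w <- enum S) law Z w); last first.
      by rewrite big_enum.
    apply: perm_big; apply: uniq_perm; rewrite ?enum_uniq ?fset_uniq//.
    move=> w; rewrite mem_enum in_fset_set//.
    by apply/idP/idP; rewrite ?inE.
  - apply/trivIsetP => i j _ _ /eqP ij; apply/seteqP; split => // x [/= Zi Zj].
    by case: ij; rewrite -Zi -Zj.
by apply/seteqP; split => [x Sx|x [w /= Sw Zx]]; [exists (Z x)|rewrite /= Zx].
Qed.

Lemma law_sum1 (W : finType) (Z : T -> W) : measurable_fibers Z ->
  \sum_(w : W) law Z w = 1.
Proof.
move=> mZ; rewrite law_sum// (_ : _ @^-1` _ = setT); last by apply/seteqP; split.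
by rewrite probability_setT.
Qed.

Lemma measurable_fibers_comp (W V : finType) (Z : T -> W) (g : W -> V) :
  measurable_fibers Z -> measurable_fibers (g \o Z).
Proof. by move=> mZ w; rewrite comp_preimage; exact: measurable_fibers_pred. Qed.

Lemma law_comp (W V : finType) (Z : T -> W) (g : W -> V) v : measurable_fibers Z ->
  law (g \o Z) v = \sum_(w | g w == v) law Z w.
Proof.
move=> mZ; rewrite law_sum// /law; congr (fine (mu _)).
by apply/seteqP; split => x /= /eqP.
Qed.

Lemma law_expect_comp (W V : finType) (Z : T -> W) (g : W -> V) (F : V -> R) :
  measurable_fibers Z ->
  \sum_(w : W) law Z w * F (g w) = \sum_(v : V) law (g \o Z) v * F v.
Proof.
move=> mZ; rewrite (partition_big g predT)//=; apply: eq_bigr => v _.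
by rewrite law_comp// mulr_suml; apply: eq_bigr => w /eqP ->.
Qed.

Lemma law_le_comp (W V : finType) (Z : T -> W) (g : W -> V) w : measurable_fibers Z ->
  law Z w <= law (g \o Z) (g w).
Proof.
move=> mZ; rewrite law_comp// (bigD1 w)//= lerDl sumr_ge0// => v _; exact: law_ge0.
Qed.

Lemma law_entropy_gibbs (W : finType) (Z : T -> W) (q : W -> R) : measurable_fibers Z ->
  (forall w, 0 <= q w) -> (forall w, 0 < law Z w -> 0 < q w) ->
  \sum_(w : W) q w <= 1 -> law_entropy Z <= - \sum_(w : W) law Z w * ln (q w).
Proof.
move=> mZ q0 pq q1; apply: gibbs => //.
- by move=> w _; exact: law_ge0.
- by move=> w _; exact: pq.
- by rewrite law_sum1.
Qed.

Lemma measurable_fibers_pair (W V : finType) (Z : T -> W) (Y : T -> V) :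
  measurable_fibers Z -> measurable_fibers Y -> measurable_fibers (fun x => (Z x, Y x)).
Proof.
move=> mZ mY [w v].
rewrite (_ : _ @^-1` _ = Z @^-1` [set w] `&` Y @^-1` [set v]); first exact: measurableI.
by apply/seteqP; split => x /= [<- <-].
Qed.

Lemma law_entropy_pair_le (W V : finType) (Z : T -> W) (Y : T -> V) :
  measurable_fibers Z -> measurable_fibers Y ->
  law_entropy Z <= law_entropy (fun x => (Z x, Y x)).
Proof.
move=> mZ mY; have mZY := measurable_fibers_pair mZ mY.
rewrite /law_entropy lerN2.
rewrite -(law_expect_comp fst (fun w => ln (law Z w)) mZY)//.
apply: ler_sum => w _.
have [->|n0] := eqVneq (law (fun x => (Z x, Y x)) w) 0; first by rewrite !mul0r.
have p0 : 0 < law (fun x => (Z x, Y x)) w by rewrite lt_neqAle eq_sym n0 law_ge0.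
have le := law_le_comp fst w mZY.
by rewrite ler_wpM2l ?(ltW p0)// ler_ln ?posrE// (lt_le_trans p0).
Qed.

Variable f : X -> X.
Hypothesis mf : forall A : set T, measurable A -> measurable (f @^-1` A : set T).
Hypothesis invf : forall A : set T, measurable A -> mu (f @^-1` A) = mu A.

Lemma iter_preimageS n (A : set T) : iter n.+1 f @^-1` A = iter n f @^-1` (f @^-1` A).
Proof. by []. Qed.

Lemma measurable_iter_preimage n (A : set T) : measurable A -> measurable (iter n f @^-1` A : set T).
Proof. by elim: n A => // n IH A mA; rewrite iter_preimageS; apply: IH; exact: mf. Qed.

Lemma measure_iter_preimage n (A : set T) : measurable A -> mu (iter n f @^-1` A) = mu A.
Proof.
elim: n A => // n IH A mA; rewrite iter_preimageS IH ?invf//; exact: mf.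
Qed.

Definition itinerary (K : finType) (P : T -> K) n (x : T) : {ffun 'I_n -> K} :=
  [ffun i : 'I_n => P (iter i f x)].

Lemma itinerary_cell (k : nat) (P : T -> 'I_k) n (w : {ffun 'I_n -> 'I_k}) :
  join_cell f P w = itinerary P n @^-1` [set w].
Proof.
apply/seteqP; split => [x /= h|x /= <- i]; last by rewrite ffunE.
by apply/ffunP => i; rewrite ffunE h.
Qed.

Lemma join_entropyE (k : nat) (P : T -> 'I_k) n :
  join_entropy f mu P n = law_entropy (itinerary P n).
Proof. by congr (- _); apply: eq_bigr => w _; rewrite itinerary_cell. Qed.

Lemma measurable_itinerary (K : finType) (P : T -> K) n :
  measurable_fibers P -> measurable_fibers (itinerary P n).
Proof.
move=> mP w; rewrite (_ : _ @^-1` _ = \bigcap_(i in [set: 'I_n]) (iter i f @^-1` (P @^-1` [set w i]))).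
  apply: fin_bigcap_measurable => [|i _]; first exact: finite_finset.
  exact: measurable_iter_preimage.
apply/seteqP; split => [x <- i _ /=|x h]; first by rewrite ffunE.
by apply/ffunP => i; rewrite ffunE; exact: h.
Qed.

Definition window (K : Type) n j (v : {ffun 'I_(n + j) -> K}) (i : 'I_n) :
    {ffun 'I_j -> K} := [ffun t : 'I_j => v (lshift_sum i t)].

Section approximation.
Variables (k : nat) (A : finType) (P : T -> 'I_k) (Q : T -> A) (j : nat).
Variables (phi : {ffun 'I_j -> A} -> 'I_k) (e : R).
Hypotheses (mP : measurable_fibers P) (mQ : measurable_fibers Q).
Hypotheses (e_gt0 : 0 < e) (e_lt1 : e < 1).
Hypothesis approx : fine (mu [set x | P x != phi (itinerary Q j x)]) <= e.

Let kap (a b : 'I_k) : R := if a == b then 1 - e else e / k%:R.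

Let kap_gt0 a b : 0 < kap a b.
Proof.
rewrite /kap; case: ifP => _; first by rewrite subr_gt0.
by rewrite divr_gt0// ltr0n; case: a => i; apply: leq_ltn_trans.
Qed.

Let kap_sum b : \sum_a kap a b <= 1.
Proof.
rewrite (bigD1 b)//= {1}/kap eqxx.
rewrite (eq_bigr (fun=> e / k%:R)); last by move=> a; rewrite /kap => /negbTE ->.
rewrite sumr_const -[X in _ + X]mulr_natr mulrAC.
have k0 : 0 < k%:R :> R by rewrite ltr0n; case: b => i; apply: leq_ltn_trans.
suff : e * (#|[pred i | i != b]|%:R) / k%:R <= e by lra.
rewrite ler_pdivrMr// ler_wpM2l ?(ltW e_gt0)// ler_nat.
by rewrite -[X in (_ <= X)%N](card_ord k); exact: max_card.
Qed.

Let ln_kap a b : - ln (kap a b) <= - ln (1 - e) + (a != b)%:R * - ln (e / k%:R).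
Proof.
rewrite /kap; case: eqVneq => _ /=; first by rewrite mul0r addr0.
by rewrite mul1r lerDr oppr_ge0 ln_le0// gerBl ltW.
Qed.

(* If [P] agrees with a function of the first [j] symbols of the [Q]-name up to
   measure [e], then Gibbs' inequality for the noisy channel [kap] bounds the
   entropy of the [P]-name by that of the [Q]-name. *)
Lemma join_entropy_approx n :
  law_entropy (itinerary P n) <= law_entropy (itinerary Q (n + j)) +
    n%:R * (- ln (1 - e) - e * ln (e / k%:R)).
Proof.
set U := itinerary P n; set V := itinerary Q (n + j).
have mU : measurable_fibers U := measurable_itinerary (n:=n) mP.
have mV : measurable_fibers V := measurable_itinerary (n:=n + j) mQ.
set Z := fun x => (U x, V x).
have mZ : measurable_fibers Z := measurable_fibers_pair mU mV.
apply: (le_trans (law_entropy_pair_le mU mV)).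
pose q (w : {ffun 'I_n -> 'I_k} * {ffun 'I_(n + j) -> A}) :=
  law V w.2 * \prod_(i < n) kap (w.1 i) (phi (window w.2 i)).
have prod_gt0 (w : {ffun 'I_n -> 'I_k} * {ffun 'I_(n + j) -> A}) : 0 < \prod_(i < n) kap (w.1 i) (phi (window w.2 i)).
  by apply: prodr_gt0 => i _; exact: kap_gt0.
apply: (le_trans (law_entropy_gibbs (Z := Z) (q := q) mZ _ _ _)).
- by move=> w; rewrite mulr_ge0 ?law_ge0// ltW.
- move=> w w0; rewrite mulr_gt0//; apply: lt_le_trans w0 _.
  exact: (law_le_comp snd w mZ).
- rewrite (eq_bigr (fun w => q (w.1, w.2))); last by case.
  rewrite -(pair_big predT predT (fun u v => q (u, v)))/= exchange_big/=.
  rewrite -[leRHS](law_sum1 mV); apply: ler_sum => v _; rewrite /q /= -mulr_sumr.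
  rewrite ler_piMr ?law_ge0//.
  rewrite -(bigA_distr_bigA (fun i a => kap a (phi (window v i)))).
  apply: prodr_ile1 => i _; rewrite kap_sum andbT sumr_ge0// => a _.
  by rewrite ltW.
apply: (@le_trans _ _ (- (\sum_w law Z w * (ln (law V w.2) +
    \sum_(i < n) ln (kap (w.1 i) (phi (window w.2 i))))))).
  rewrite lerN2; apply: ler_sum => w _.
  have [->|n0] := eqVneq (law Z w) 0; first by rewrite !mul0r.
  have p0 : 0 < law Z w by rewrite lt_neqAle eq_sym n0 law_ge0.
  have v0 : 0 < law V w.2 := lt_le_trans p0 (law_le_comp snd w mZ).
  rewrite ler_wpM2l ?(ltW p0)// lnM ?posrE// lerD2l.
  rewrite le_eqVlt; apply/orP; left; apply/eqP.
  by rewrite ln_prodr.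
under eq_bigr do rewrite mulrDr.
rewrite big_split/= opprD (law_expect_comp snd (fun v => ln (law V v)) mZ).
rewrite lerD2l.
apply: (@le_trans _ _ (\sum_(i < n) \sum_w law Z w * (- ln (1 - e) +
   (w.1 i != phi (window w.2 i))%:R * - ln (e / k%:R)))).
  rewrite exchange_big/= -sumrN; apply: ler_sum => w _.
  rewrite -mulrN -mulr_sumr ler_wpM2l ?law_ge0// -sumrN; apply: ler_sum => i _.
  exact: ln_kap.
have -> x : n%:R * x = \sum_(i < n) x by rewrite sumr_const card_ord mulr_natl.
apply: ler_sum => i _.
under eq_bigr do rewrite mulrDr mulrA.
rewrite big_split/= -!mulr_suml law_sum1// mul1r lerD2l -mulrN ler_wpM2r//.
  case: (k) P phi approx mP => [P0|k' *].
    by have := P0 point; case.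
  rewrite oppr_ge0 ln_le0// ler_pdivrMr ?ltr0n// mul1r (le_trans (ltW e_lt1))//.
  by rewrite ler1n.
apply: le_trans approx.
rewrite (eq_bigr (fun w : {ffun 'I_n -> 'I_k} * {ffun 'I_(n + j) -> A} => if w.1 i != phi (window w.2 i) then law Z w else 0)); last first.
  by move=> w _; case: ifP => _; rewrite ?mulr1 ?mulr0.
rewrite -big_mkcond law_sum// le_eqVlt; apply/orP; left; apply/eqP.
congr fine; rewrite -[RHS](measure_iter_preimage i).
  congr (mu _); apply/seteqP; split => x /=; rewrite ffunE;
  rewrite (_ : window _ _ = itinerary Q j (iter i f x))//;
  by apply/ffunP => t; rewrite !ffunE/= addnC iterD.
rewrite [X in measurable X](_ : _ = (fun x => (P x, itinerary Q j x)) @^-1` [set w | w.1 != phi w.2]).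
  by apply: measurable_fibers_pred; apply: measurable_fibers_pair => //; exact: measurable_itinerary.
by [].
Qed.

End approximation.

End finite_laws.

(** * Gap shifts *)

Record gap_data := GapData {
  gap_letter : finType;
  gap_lang : seq gap_letter -> Prop;
  gap_len : nat -> nat;
  gap_lang_nil : gap_lang [::];
  gap_lang_infix : forall u v, infix u v -> gap_lang v -> gap_lang u;
  gap_len_mono : {homo gap_len : i j / (i <= j)%N};
  gap_len_gt0 : forall n, (0 < gap_len n)%N
}.

(* [None] is the gap symbol; the words read between two gaps belong to the
   language, and a word of length [r] is followed by at least [gap_len r] gaps.
   Both conditions are imposed on all subwords rather than on maximal ones, which
   is equivalent because the language is factorial and [gap_len] monotone. *)
Definition admissible (D : gap_data) (x : nat -> option (gap_letter D)) : Prop :=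
  (forall i v, mkseq (fun k => x (i + k)%N) (size v) = map Some v -> gap_lang v) /\
  (forall i r, (0 < r)%N -> (forall k, (k < r)%N -> x (i + k)%N != None) ->
     x (i + r)%N = None -> forall k, (k < gap_len D r)%N -> x (i + r + k)%N = None).

(** The field [R] is recorded in the type so that the metric structure, with distances in [R], can
    be attached to it. *)
Record gap_shift (R : realType) (D : gap_data) := GapShift {
  gap_seq :> nat -> option (gap_letter D);
  gap_adm : admissible gap_seq
}.

Lemma gap_shift_eq (R : realType) (D : gap_data) (x y : gap_shift R D) : x =1 y -> x = y.
Proof.
case: x y => [x ax] [y ay] /= /funext xy.
by case: y / xy ay => ay; rewrite (Prop_irrelevance ax ay).
Qed.

HB.instance Definition _ (R : realType) (D : gap_data) := gen_eqMixin (gap_shift R D).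
HB.instance Definition _ (R : realType) (D : gap_data) := gen_choiceMixin (gap_shift R D).

Lemma no_letter_admissible (D : gap_data) :
  admissible (fun _ : nat => None : option (gap_letter D)).
Proof.
split => // i [|a v]; last by [].
by move=> _; exact: gap_lang_nil.
Qed.

HB.instance Definition _ (R : realType) (D : gap_data) :=
  isPointed.Build (gap_shift R D) (GapShift R (@no_letter_admissible D)).

Section gap_metric.
Context {R : realType} {D : gap_data}.
Implicit Types x y z : gap_shift R D.

Definition first_diff x y (h : exists n, x n != y n) : nat := ex_minn h.

Definition gap_dist x y : R :=
  if pselect (exists n, x n != y n) is left h then (first_diff h).+1%:R^-1 else 0.

Lemma gap_dist_ge x y n : x n != y n -> n.+1%:R^-1 <= gap_dist x y.
Proof.
rewrite /gap_dist; case: pselect => [h|h] xy; last by case: h; exists n.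
rewrite lef_pV2 ?posrE// ler_nat ltnS /first_diff.
by case: ex_minnP => i _; exact.
Qed.

Lemma gap_dist_le x y n : (forall k, (k < n)%N -> x k = y k) ->
  gap_dist x y <= n.+1%:R^-1.
Proof.
rewrite /gap_dist; case: pselect => [h|h] xy; last by rewrite invr_ge0.
rewrite lef_pV2 ?posrE// ler_nat ltnS /first_diff leqNgt.
by case: ex_minnP => i xi _; apply: contra xi => /xy ->.
Qed.

Lemma gap_dist_lt x y n : gap_dist x y < n.+1%:R^-1 -> forall k, (k <= n)%N -> x k = y k.
Proof.
move=> h k kn; apply/eqP; apply: contraTT h => /gap_dist_ge h; rewrite -leNgt.
by apply: le_trans h; rewrite lef_pV2 ?posrE// ler_nat ltnS.
Qed.

Lemma gap_distxx x : gap_dist x x = 0.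
Proof.
by rewrite /gap_dist; case: pselect => // h; exfalso; case: h => n; rewrite eqxx.
Qed.

Lemma gap_dist_ge0 x y : 0 <= gap_dist x y.
Proof. by rewrite /gap_dist; case: pselect. Qed.

Lemma gap_dist_eq0 x y : gap_dist x y = 0 -> x = y.
Proof.
move=> h; apply: gap_shift_eq => n; apply: (@gap_dist_lt _ _ n) => //.
by rewrite h invr_gt0.
Qed.

Lemma gap_dist_sym x y : gap_dist x y = gap_dist y x.
Proof.
suff h u v : gap_dist u v <= gap_dist v u by apply/eqP; rewrite eq_le !h.
rewrite {1}/gap_dist; case: pselect => [h|h]; last exact: gap_dist_ge0.
by apply: gap_dist_ge; rewrite eq_sym /first_diff; case: ex_minnP.
Qed.

Lemma gap_dist_triangle y x z : gap_dist x z <= gap_dist x y + gap_dist y z.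
Proof.
rewrite {1}/gap_dist; case: pselect => [h|h]; last by rewrite addr_ge0 ?gap_dist_ge0.
rewrite /first_diff; case: ex_minnP => n xz _.
have [e|/gap_dist_ge xy] := eqVneq (x n) (y n).
  by rewrite e in xz; rewrite (le_trans (gap_dist_ge xz))// lerDr gap_dist_ge0.
by rewrite (le_trans xy)// lerDl gap_dist_ge0.
Qed.

HB.instance Definition _ := isMetric.Build R (gap_shift R D)
  gap_distxx gap_dist_eq0 gap_dist_sym gap_dist_triangle.

End gap_metric.

(** * Compactness, cylinders and continuous functions *)

Section gap_topology.
Context {R : realType} {D : gap_data}.
Local Notation X := (gap_shift R D).
Local Notation S := (option (gap_letter D)).
Implicit Types x y z : X.

Definition gap_pmetric : pmetricType R := X.

Lemma gap_mdistE x y : mdist x y = gap_dist x y.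
Proof. by []. Qed.

Lemma nbhs_prefix x n : nbhs x [set y : X | forall k, (k < n)%N -> y k = x k].
Proof.
apply/nbhs_ballP; exists (n.+1%:R^-1) => /=; first by rewrite invr_gt0.
move=> y; rewrite ballEmdist /= gap_mdistE => h k kn.
by apply/esym; apply: gap_dist_lt h _ _; exact: ltnW.
Qed.

Lemma nbhs_prefixP x (B : set X) :
  nbhs x B <-> exists n, [set y : X | forall k, (k < n)%N -> y k = x k] `<=` B.
Proof.
split; last by case=> n h; apply: filterS h (nbhs_prefix x n).
move=> /nbhs_ballP[e /= e0 h]; exists (Num.truncn e^-1) => y /= hy; apply: h.
rewrite ballEmdist /= gap_mdistE.
apply: (le_lt_trans (gap_dist_le (n := Num.truncn e^-1) _)).
  by move=> k /hy ->.
by rewrite invf_plt ?posrE// Num.Theory.truncnS_gt.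
Qed.

Lemma shift_admissible (x : X) : admissible (fun n => x n.+1).
Proof.
have [h1 h2] := gap_adm x; split.
  by move=> i v; apply: (h1 i.+1).
by move=> i r r0; exact: (h2 i.+1).
Qed.

Definition shift (x : X) : X := GapShift R (shift_admissible x).

Lemma iter_shift i x n : iter i shift x n = x (i + n)%N.
Proof. by elim: i n => // i IH n; rewrite iterS /= IH addnS addSn. Qed.

Lemma continuous_shift : continuous shift.
Proof.
move=> x B /nbhs_prefixP[n h]; apply/nbhs_prefixP; exists n.+1 => y hy.
by apply: h => k kn; exact: hy.
Qed.

Lemma ultra_finite (T : Type) (W : finType) (F : set_system T) (Z : T -> W) :
  UltraFilter F -> exists w, F (Z @^-1` [set w]).
Proof.
move=> UF; apply: contrapT => /forallNP h.
have h' w : F (~` (Z @^-1` [set w])).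
  by have [/h//|] := in_ultra_setVsetC (Z @^-1` [set w]) UF.
have /filter_ex[t /(_ (Z t))//] : F [set t | forall w, Z t <> w].
exact: filter_forall.
Qed.

(** Along an ultrafilter every coordinate, having finitely many values, is eventually constant. Each
    instance of admissibility involves finitely many coordinates, so the limit sequence inherits
    it. *)
Lemma gap_compact : compact [set: X].
Proof.
rewrite compact_ultra => F UF _.
pose c n := sval (cid (ultra_finite (fun x : X => x n) UF)).
have hc n : F [set x : X | x n = c n].
  exact: (svalP (cid (ultra_finite (fun x : X => x n) UF))).
have hcn n : F [set x : X | forall k, (k < n)%N -> x k = c k].
  elim: n => [|n IH]; first by apply: filterS filterT.
  apply: filterS2 IH (hc n) => x h1 h2 k; rewrite ltnS leq_eqVlt => /orP[/eqP ->//|].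
  exact: h1.
have adm : admissible c.
  split => [i v e|i r r0 h e k kr].
    have [x hx] := filter_ex (hcn (i + size v)%N).
    apply: (proj1 (gap_adm x) i); rewrite -e; apply/eq_in_map => k.
    by rewrite mem_iota => /andP[_ kv]; apply: hx; rewrite ltn_add2l.
  have [x hx] := filter_ex (hcn (i + r + k).+1).
  rewrite -hx//; apply: (proj2 (gap_adm x)) kr => //.
    by move=> j jr; rewrite hx ?h//; lia.
  by rewrite hx//; lia.
exists (GapShift R adm); split => // B /nbhs_prefixP[n h].
by apply: filterS (hcn n) => y hy; apply: h.
Qed.

Definition cylinder (w : seq S) : set X := [set x | mkseq x (size w) = w].

Lemma cylinderP w x : cylinder w x <-> forall k, (k < size w)%N -> x k = nth None w k.
Proof.
split; first by move=> <- k; rewrite size_mkseq => kn; rewrite nth_mkseq.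
move=> h; apply: (@eq_from_nth _ None); rewrite size_mkseq// => k kn.
by rewrite nth_mkseq// h.
Qed.

Lemma open_cylinder w : open (cylinder w).
Proof.
rewrite openE => x /cylinderP h; apply/nbhs_prefixP; exists (size w) => y hy.
by apply/cylinderP => k kn; rewrite hy ?h.
Qed.

Lemma measurable_cylinder w : measurable (cylinder w : set (borel X)).
Proof. by apply: sub_sigma_algebra; exact: open_cylinder. Qed.

Lemma open_bigcup_cylinder (B : set X) : open B ->
  B = \bigcup_(w in [set w | cylinder w `<=` B]) cylinder w.
Proof.
move=> oB; apply/seteqP; split => [x Bx|x [w /= h]]; last exact: h.
have /nbhs_prefixP[n h] : nbhs x B by move: oB; rewrite openE; exact.
exists (mkseq x n); last by rewrite /cylinder/= size_mkseq.
move=> y /= /cylinderP; rewrite size_mkseq => hy; apply: h => k kn.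
by rewrite hy// nth_mkseq.
Qed.

Lemma measurable_shift (A : set (borel X)) :
  measurable A -> measurable (shift @^-1` A : set (borel X)).
Proof.
move=> mA; rewrite -[X in measurable X]setTI.
have mf : measurable_fun [set: borel X] (shift : borel X -> borel X).
  apply: (@measurability _ _ (borel X) (borel X) setT shift (@open X) erefl).
  move=> _ [B oB <-].
  rewrite setTI; apply: sub_sigma_algebra.
  by move: oB; apply: (continuousP _).1; exact: continuous_shift.
exact: mf.
Qed.

(** Uniform continuity in terms of prefixes: counterexamples for all [q] would accumulate, by
    compactness, at a point where [phi] is continuous. *)
Lemma gap_unif_continuous (phi : X -> R) (e : R) : continuous phi -> 0 < e ->
  exists q, forall x y : X, (forall k, (k < q)%N -> x k = y k) -> `|phi x - phi y| <= e.
Proof.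
move=> cphi e0; apply: contrapT => /forallNP h.
have {}h q : exists p : X * X, (forall k, (k < q)%N -> p.1 k = p.2 k) /\ e < `|phi p.1 - phi p.2|.
  have /existsNP[x /existsNP[y /not_implyP[h1 /negP]]] := h q.
  by rewrite -ltNge => h2; exists (x, y).
pose p q := sval (cid (h q)).
have hp q := svalP (cid (h q)); rewrite -/(p _) in hp.
have [z [_ cz]] := gap_compact (fmap_proper_filter (fun q => (p q).1) _ : ProperFilter ((fun q => (p q).1) @ \oo)) filterT.
have hz : nbhs z [set y | `|phi z - phi y| < e / 2].
  have /cvgrPdist_lt := cphi z; apply; exact: divr_gt0.
have /nbhs_prefixP[n hn] := hz.
have [y [[q /= qn qy] hy]] := cz [set y | exists2 q, (n <= q)%N & (p q).1 = y] _
  ltac:(by exists n => // q nq; exists q) (nbhs_prefix z n).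
have h1 : `|phi z - phi (p q).1| < e / 2 by apply: hn => k kn; rewrite qy hy.
have [h2 h3] := hp q.
have h4 : `|phi z - phi (p q).2| < e / 2.
  by apply: hn => k kn; rewrite -h2 ?qy ?hy// (leq_trans kn).
move: h3; rewrite ltNge => /negP; apply.
have -> : phi (p q).1 - phi (p q).2 = - (phi z - phi (p q).1) + (phi z - phi (p q).2) by lra.
apply: (le_trans (ler_normD _ _)); rewrite normrN; move: h1 h4; lra.
Qed.

End gap_topology.

(** * Specification *)

Section gap_specification.
Context {R : realType} {D : gap_data}.
Local Notation X := (gap_shift R D).
Local Notation S := (option (gap_letter D)).
Local Notation g := (gap_len D).

Definition run_seq (s : nat) (u : seq (gap_letter D)) (n : nat) : S :=
  if (n < s)%N then None else nth None (map Some u) (n - s).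

Lemma run_seq_some s u n : run_seq s u n != None ->
  (s <= n)%N /\ (n - s < size u)%N.
Proof.
rewrite /run_seq; case: ltnP => // sn; split => //.
by rewrite ltnNge; apply: contra_neqN H => h; rewrite nth_default// size_map.
Qed.

Lemma run_seq_admissible s u : gap_lang u -> admissible (run_seq s u).
Proof.
move=> Lu; split => [i [|a v] e|i r r0 h e k kr]; first exact: gap_lang_nil.
- set w := a :: v in e *.
  have hk k : (k < size w)%N -> run_seq s u (i + k) = nth None (map Some w) k.
    by move=> kw; rewrite -e nth_mkseq.
  have hs k : (k < size w)%N -> (s <= i + k)%N /\ (i + k - s < size u)%N.
    by move=> kw; apply: run_seq_some; rewrite hk// (nth_map a).
  have [si _] := hs 0%N isT; rewrite addn0 in si.
  have [_ h2] := hs (size v) (ltnSn _).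
  apply: gap_lang_infix Lu; apply/infixP.
  exists (take (i - s) u), (drop (size w) (drop (i - s) u)).
  suff wE : w = take (size w) (drop (i - s) u) by rewrite {1}wE !cat_take_drop.
  apply: (inj_map (@Some_inj _)); apply: (@eq_from_nth _ None).
    by rewrite !size_map size_takel// size_drop/=; lia.
  move=> k; rewrite size_map => kw; rewrite -hk//.
  have [h3 h4] := hs k kw.
  rewrite /run_seq ltnNge h3/= map_take nth_take// map_drop nth_drop.
  by congr nth; lia.
- have [h1 h2] := run_seq_some (h 0%N r0); rewrite addn0 in h1 h2.
  have h3 : (size u <= i + r - s)%N.
    rewrite leqNgt; apply/negP => h4; move: e; rewrite /run_seq ltnNge (leq_trans h1) ?leq_addr//=.
    by case: (u) h4 => // b u' h4; rewrite (nth_map b).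
  rewrite /run_seq; case: ifP => // _; rewrite nth_default// size_map.
  by apply: (leq_trans h3); lia.
Qed.

Definition run s u (Lu : gap_lang u) : X := GapShift R (run_seq_admissible s Lu).

Lemma gap_dynamical_system : (exists2 u, @gap_lang D u & size u = 1%N) ->
  dynamical_system (@shift R D : gap_pmetric -> gap_pmetric).
Proof.
move=> [[|a [|]] //= La _]; split; [exact: gap_compact| |exact: continuous_shift].
exists (run 0 La), (run 0 (gap_lang_nil D)) => /(congr1 (fun x : X => x 0%N)).
by [].
Qed.

Definition scale_len (eps : R) : nat := Num.truncn eps^-1.

Lemma scale_lenP eps (x y : X) : 0 < eps ->
  (forall k, (k < scale_len eps)%N -> x k = y k) -> gap_dist x y < eps.
Proof.
move=> e0 h; apply: (le_lt_trans (gap_dist_le h)).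
by rewrite invf_plt ?posrE// Num.Theory.truncnS_gt.
Qed.

(* To shadow within [eps], [scale_len eps] further symbols have to be prescribed. *)
Definition spec_gap (n : nat) (eps : R) : nat :=
  (g (n + scale_len eps) + scale_len eps + 1)%N.

Section glue.
Variables (k j : nat) (x : 'I_k -> X) (a b : 'I_k -> nat).
Hypothesis ab : forall i, (a i <= b i)%N.
Hypothesis sep : forall i i' : 'I_k, (i < i')%N ->
  (b i + (g (b i - a i + 1 + j) + j + 1) <= a i')%N.

Definition glue_seq (t : nat) : S :=
  if [pick i | (a i <= t <= b i + j)%N] is Some i then x i (t - a i)%N else None.

Lemma glue_uniq i i' t : (a i <= t <= b i + j)%N -> (a i' <= t <= b i' + j)%N -> i = i'.
Proof.
move=> h h'; apply/eqP; rewrite -val_eqE; case: ltngtP => // /sep.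
  by have := gap_len_gt0 D (b i - a i + 1 + j); lia.
by have := gap_len_gt0 D (b i' - a i' + 1 + j); lia.
Qed.

Lemma glue_in i t : (a i <= t <= b i + j)%N -> glue_seq t = x i (t - a i)%N.
Proof.
move=> h; rewrite /glue_seq; case: pickP => [i' h'|/(_ i)]; last by rewrite h.
by rewrite (glue_uniq h h').
Qed.

Lemma glue_some t : glue_seq t != None -> exists i, (a i <= t <= b i + j)%N.
Proof. by rewrite /glue_seq; case: pickP => // i h _; exists i. Qed.

Lemma glue_stretch s r : (0 < r)%N -> (forall l, (l < r)%N -> glue_seq (s + l) != None) ->
  exists i, forall l, (l < r)%N -> (a i <= s + l <= b i + j)%N.
Proof.
move=> r0 h; have [i hi] := glue_some (h 0%N r0); exists i; elim => // l IH lr.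
have {}IH := IH (ltnW lr); have [i' hi'] := glue_some (h _ lr).
suff -> : i = i' by [].
apply/eqP; rewrite -val_eqE; case: ltngtP => // /sep.
  by have := gap_len_gt0 D (b i - a i + 1 + j); lia.
by have := gap_len_gt0 D (b i' - a i' + 1 + j); lia.
Qed.

(** Separated intervals leave a gap between them, so a run of letters stays in one extended interval
    and is a factor of the corresponding point. It has length at most [b i - a i + 1 + j]; by
    monotonicity of [gap_len], the gaps it forces beyond its interval fit into the separation. *)
Lemma glue_admissible : admissible glue_seq.
Proof.
split => [s v e|s r r0 h e l lr].
  have [v0|v0] := posnP (size v); first by rewrite (size0nil v0); exact: gap_lang_nil.
  have [l lv|i hi] := glue_stretch (s := s) v0.
    rewrite (_ : glue_seq _ = nth None (map Some v) l); last by rewrite -e nth_mkseq.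
    by case: (v) lv => // c v' lv; rewrite (nth_map c).
  have := proj1 (gap_adm (x i)) (s - a i)%N v; apply; rewrite -e.
  apply/eq_in_map => l; rewrite mem_iota => /andP[_ lv]; rewrite (glue_in (hi l lv)).
  by congr (x i _); have := hi _ v0; lia.
have [i hi] := glue_stretch r0 h.
rewrite /glue_seq; case: pickP => // i' hi'.
have := hi _ r0; have := hi r.-1 _; rewrite prednK// => /(_ (leqnn _)) h1 h2.
have [ii'|ii'] := eqVneq i i'.
  rewrite -{i'}ii' in hi' *.
  have h3 : (a i <= s + r <= b i + j)%N by lia.
  have := proj2 (gap_adm (x i)) (s - a i)%N r r0.
  rewrite (_ : (s - a i + r)%N = (s + r - a i)%N); last by lia.
  rewrite -glue_in// e => /(_ _ erefl l lr).
  rewrite (_ : (s + r - a i + l)%N = (s + r + l - a i)%N); last by lia.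
  apply => m mr; have := h _ mr; rewrite (glue_in (hi _ mr)).
  by rewrite (_ : (s + m - a i)%N = (s - a i + m)%N)//; lia.
have mono : (g r <= g (b i - a i + 1 + j))%N by apply: gap_len_mono; lia.
move: ii'; rewrite -val_eqE neq_ltn => /orP[|] /sep; first lia.
by have := gap_len_gt0 D (b i' - a i' + 1 + j); have := ab i'; lia.
Qed.

End glue.

Lemma spec_gap_function : gap_function (@shift R D : gap_pmetric -> gap_pmetric) spec_gap.
Proof.
split.
- by move=> n eps _ _; rewrite /spec_gap addn1.
- move=> n n' eps _ nn' _; rewrite /spec_gap !leq_add2r; apply: gap_len_mono.
  by rewrite leq_add2r.
- move=> n eps eps' _ e0 ee'.
  have h : (scale_len eps' <= scale_len eps)%N.
    apply: Num.Theory.le_truncn; rewrite lef_pV2 ?posrE//; exact: lt_le_trans ee'.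
  by rewrite /spec_gap leq_add2r leq_add// gap_len_mono// leq_add2l.
- move=> eps k x a b e0 _ ab sep.
  set j := scale_len eps.
  (* The distance is prescribed for consecutive intervals only; it is extended to all pairs by
     induction. *)
  have sep' (i i' : 'I_k) : (i < i')%N ->
      (b i + (g (b i - a i + 1 + j) + j + 1) <= a i')%N.
    case: i' => i' ik' /=; elim: i' ik' => // i' IH ik'.
    rewrite ltnS leq_eqVlt => /orP[/eqP ii'|ii'].
      have [h1 h2] := sep i (Ordinal ik') (congr1 succn (esym ii')).
      by move: h2; rewrite /spec_gap -/j; move: h1; lia.
    have h := IH (ltnW ik') ii'.
    have [h1 _] := sep (Ordinal (ltnW ik')) (Ordinal ik') erefl.
    by have := ab (Ordinal (ltnW ik')); lia.
  exists (GapShift R (glue_admissible x ab sep')) => i n hn.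
  rewrite gap_mdistE; apply/ltW/scale_lenP => // l lj.
  rewrite !iter_shift /= (glue_in x sep' (i := i)); last by move: lj; rewrite -/j; lia.
  by congr (x i _); lia.
Qed.

Lemma le_limn_einf (u v : nat -> \bar R) : (forall n, (u n <= v n)%E) ->
  (limn_einf u <= limn_einf v)%E.
Proof.
move=> uv; rewrite !limn_einf_lim; apply: lee_lim; [exact: is_cvg_einfs|exact: is_cvg_einfs|].
apply: nearW => n; apply: le_ereal_inf_tmp => _ [k nk <-].
by apply: le_trans (uv k); apply: ereal_inf_lbound; exists k.
Qed.

Lemma le_limn_esup (u v : nat -> \bar R) : (forall n, (u n <= v n)%E) ->
  (limn_esup u <= limn_esup v)%E.
Proof.
move=> uv; rewrite !limn_esup_lim; apply: lee_lim; [exact: is_cvg_esups|exact: is_cvg_esups|].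
apply: nearW => n; apply: ge_ereal_sup => _ [k nk <-].
by apply: (le_trans (uv k)); apply: ereal_sup_ubound; exists k.
Qed.

Variable tau : \bar R.
Hypothesis gap_cvg : ((g n)%:R / n%:R : R)%:E @[n --> \oo] --> tau.

Lemma spec_gap_cvg eps : gap_ratio spec_gap eps n @[n --> \oo] --> tau.
Proof.
set j := scale_len eps.
have cinv : (n%:R^-1 : R) @[n --> \oo] --> (0 : R).
  by rewrite -cvg_shiftS; exact: cvg_harmonic.
have c1 : ((g (n + j))%:R / (n + j)%:R : R)%:E @[n --> \oo] --> tau.
  by move: gap_cvg; rewrite -(cvg_shiftn j).
have c2 : ((n + j)%:R / n%:R : R)%:E @[n --> \oo] --> 1%:E.
  apply: cvg_EFin; first by apply: nearW.
  have : (1 + j%:R * n%:R^-1 : R) @[n --> \oo] --> (1 + j%:R * 0 : R).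
    by apply: cvgD; [exact: cvg_cst|exact: cvgMr].
  rewrite mulr0 addr0; apply: cvg_trans; apply: near_eq_cvg.
  near=> n; have n0 : n%:R != 0 :> R by rewrite pnatr_eq0 -lt0n; near: n; exists 1%N.
  by rewrite /= natrD mulrDl divff.
have c3 : ((j + 1)%:R / n%:R : R)%:E @[n --> \oo] --> 0%E.
  apply: cvg_EFin; first by apply: nearW.
  have : ((j + 1)%:R * n%:R^-1 : R) @[n --> \oo] --> ((j + 1)%:R * 0 : R) by exact: cvgMr.
  by rewrite mulr0.
have : ((((g (n + j))%:R / (n + j)%:R : R)%:E * ((n + j)%:R / n%:R : R)%:E +
    ((j + 1)%:R / n%:R : R)%:E)%E) @[n --> \oo] --> (tau * 1%:E + 0)%E.
  apply: cvgeD => //; first by rewrite fin_num_adde_defl.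
  apply: cvgeM => //.
  by case: (tau) => [r| |]; [exact: mule_def_fin|
    apply: mule_def_infty_neq0; rewrite ?onee_neq0..].
rewrite mule1 adde0; apply: cvg_trans; apply: near_eq_cvg.
near=> n; have n0 : (0 < n)%N by near: n; exists 1%N.
rewrite /gap_ratio /spec_gap -/j -EFinM -EFinD; congr EFin.
rewrite -addnA [in RHS]natrD mulrDl; congr (_ + _); field.
by rewrite -natrD !pnatr_eq0 -!lt0n n0 addn_gt0 n0.
Unshelve. all: by end_near. Qed.

Lemma spec_gap_rate : gap_rate spec_gap = tau.
Proof.
apply/eqP; rewrite eq_le; apply/andP; split.
  apply: ge_ereal_sup => _ [eps /= e0 <-].
  by have [-> _] := cvg_limn_einf_sup (@spec_gap_cvg eps).
apply: ereal_sup_ubound; exists 1 => //=.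
by have [-> _] := cvg_limn_einf_sup (@spec_gap_cvg 1).
Qed.

Hypothesis lang_sizes : forall n, exists2 u, @gap_lang D u & size u = n.

(** Shadowing within [1/2] fixes the symbols exactly. A run of [n] letters is followed, at the
    distance allowed by [M], by a gap and a letter. The first gap [e] of the shadowing point
    satisfies [n <= e], so at least [g n] gaps have to fit before that letter. *)
Lemma gap_function_ge (M : nat -> R -> nat) n :
  gap_function (@shift R D : gap_pmetric -> gap_pmetric) M -> (0 < n)%N ->
  (g n <= M n 2^-1)%N.
Proof.
move=> [M0 _ _ spec] n0.
have [u Lu su] := lang_sizes n; have [v Lv sv] := lang_sizes 1.
have h0 : 0 < 2^-1 :> R by rewrite invr_gt0.
set m := M n 2^-1; have m0 : (0 < m)%N by exact: M0.
(* The second orbit begins with a gap; otherwise the run of letters could continue through to the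
   final letter without forcing anything. *)
pose x (i : 'I_2) := if val i == 0%N then run 0 Lu else run 1 Lv.
pose a (i : 'I_2) := if val i == 0%N then 0%N else (n.-1 + m)%N.
pose b (i : 'I_2) := if val i == 0%N then n.-1 else (n + m)%N.
have [||z hz] := spec 2^-1 2%N x a b h0 isT.
- by case=> -[|[|//]] /= ?; rewrite /a /b /=; lia.
- case=> -[|[|//]] /= ? [[|[|//]] /= ?] //= _; rewrite /a /b /=; split; first lia.
  by rewrite (_ : (n.-1 - 0 + 1)%N = n) -/m; lia.
have hz' (i : 'I_2) t : (a i <= t <= b i)%N -> z t = x i (t - a i)%N.
  move=> /hz; rewrite gap_mdistE => h.
  have /gap_dist_lt/(_ 0%N (leqnn _)) : gap_dist (iter (t - a i) shift (x i)) (iter t shift z) < 1%:R^-1.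
    by apply: (le_lt_trans h); rewrite invr1 invf_lt1// ltr1n.
  by rewrite !iter_shift !addn0.
have z1 t : (t < n)%N -> z t != None.
  move=> tn; rewrite (hz' ord0) /x /a /b/= /run_seq ?subn0; last by lia.
  by move: tn; rewrite -su; case: (u) => // c u' tu; rewrite (nth_map c).
have z2 : z (n.-1 + m)%N = None.
  by rewrite (hz' (@Ordinal 2 1 isT)) /x /a /b/= /run_seq ?subnn//; lia.
have z3 : z (n + m)%N != None.
  rewrite (hz' (@Ordinal 2 1 isT)) /x /a /b/= /run_seq; last by lia.
  rewrite (_ : (n + m - (n.-1 + m))%N = 1%N); last by lia.
  by case: (v) sv.
have ex : exists t, z t == None by exists (n.-1 + m)%N; rewrite z2.
case: (ex_minnP ex) => e /eqP ze emin.
have en : (n <= e)%N by rewrite leqNgt; apply/negP => /z1; rewrite ze.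
have em : (e <= n.-1 + m)%N by apply: emin; rewrite z2.
have := proj2 (gap_adm z) 0%N e (leq_trans n0 en) _ ze.
rewrite !add0n => hz3.
have h4 : (g n <= g e)%N by exact: gap_len_mono.
rewrite leqNgt; apply/negP => h5; move/eqP: z3; apply.
rewrite (_ : (n + m)%N = (e + (n + m - e))%N); last by lia.
by apply: hz3; [move=> k ke; apply: contraTN ke => /emin; rewrite -leqNgt|lia].
Qed.

Lemma gap_nonuniform_specification :
  nonuniform_specification (@shift R D : gap_pmetric -> gap_pmetric) tau.
Proof.
split; first by exists spec_gap; [exact: spec_gap_function|exact: spec_gap_rate].
move=> M gM; apply: (@le_trans _ _ (limn_einf (gap_ratio M 2^-1))); last first.
  by apply: ereal_sup_ubound; exists 2^-1 => //=; rewrite invr_gt0.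
have [<- _] := cvg_limn_einf_sup gap_cvg.
apply: le_limn_einf => -[|n]; first by rewrite /gap_ratio invr0 !mulr0.
by rewrite lee_fin ler_wpM2r ?invr_ge0// ler_nat gap_function_ge.
Qed.

End gap_specification.

(** * Counting words and topological entropy *)

Lemma big_flatten_seq (V : nmodType) (I : Type) (ss : seq (seq I)) (F : I -> V) :
  \sum_(i <- flatten ss) F i = \sum_(s <- ss) \sum_(i <- s) F i.
Proof.
by elim: ss => [|s ss IH]; rewrite ?big_nil// big_cons /= big_cat IH.
Qed.

Section gap_counting.
Context {R : realType} {D : gap_data}.
Local Notation X := (gap_shift R D).
Local Notation letter := (gap_letter D).
Local Notation S := (option letter).
Local Notation g := (gap_len D).

Definition gap_word (w : seq S) : Prop := exists x : X, mkseq x (size w) = w.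

Definition nongap (w : seq S) : nat := count (fun a => a != None) w.

Local Notation L n := (lang_words gap_word n).
Local Notation p r := (size (lang_words (@gap_lang D) r)).

Lemma nongap_cat u w : nongap (u ++ w) = (nongap u + nongap w)%N.
Proof. exact: count_cat. Qed.

Lemma nongap_some (v : seq letter) : nongap (map Some v) = size v.
Proof. by rewrite /nongap count_map -(count_predT v); apply: eq_count. Qed.

Lemma nongap_none n : nongap (nseq n None) = 0%N.
Proof. by rewrite /nongap count_nseq eqxx mul0n. Qed.

Lemma mem_gap_words (x : X) n : mkseq x n \in L n.
Proof.
rewrite mem_lang_words size_mkseq eqxx andbT; apply/asboolP; exists x.
by rewrite size_mkseq.
Qed.

Lemma gap_wordsP n w : reflect (exists x : X, w = mkseq x n) (w \in L n).
Proof.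
apply: (iffP idP) => [|[x ->]]; last exact: mem_gap_words.
by rewrite mem_lang_words => /andP[/asboolP[x xw] /eqP <-]; exists x.
Qed.

Lemma stretch_word (x : X) i r : (forall k, (k < r)%N -> x (i + k)%N != None) ->
  exists v, [/\ size v = r, gap_lang v & mkseq (fun k => x (i + k)%N) r = map Some v].
Proof.
move=> h; pose s := mkseq (fun k => x (i + k)%N) r.
have e : s = map Some (pmap id s).
  have : all isSome s.
    apply/allP => a /mapP[k]; rewrite mem_iota => /andP[_ kr] ->.
    by have := h k kr; case: (x _).
  by elim: s => //= -[a|] s IH //= /IH {1}->.
have sz : size (pmap id s) = r by rewrite -(size_map (@Some letter)) -e size_mkseq.
exists (pmap id s); split => //.
by apply: (proj1 (gap_adm x) i); rewrite sz -e.
Qed.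

Lemma mkseq_shift (x : X) i n : mkseq (fun k => x (i + k)%N) n = mkseq (iter i shift x) n.
Proof. by apply: eq_map => k; rewrite iter_shift. Qed.

Lemma mkseq_cat (T : Type) (F : nat -> T) m n :
  mkseq F (m + n) = mkseq F m ++ mkseq (fun k => F (m + k)%N) n.
Proof.
by rewrite /mkseq iotaD map_cat add0n -[X in iota X n]addn0 iotaDl -map_comp.
Qed.

Lemma first_run (x : X) n : (0 < n)%N -> x 0%N != None ->
  exists r, [/\ (0 < r <= n)%N, forall k, (k < r)%N -> x k != None &
    forall k, (k < g r)%N -> (r + k < n)%N -> x (r + k)%N = None].
Proof.
move=> n0 x0; have [ex|nex] := pselect (exists t, (t < n)%N && (x t == None)).
  case: (ex_minnP ex) => r /andP[rn /eqP xr] rmin.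
  have r0 : (0 < r)%N by case: (r) xr => // h; rewrite h in x0.
  have hr k : (k < r)%N -> x k != None.
    move=> kr; apply/negP => xk; have := rmin k.
    by rewrite xk (ltn_trans kr rn) => /(_ isT); rewrite leqNgt kr.
  exists r; split => //; first by rewrite r0 ltnW.
  by move=> k kg _; have := proj2 (gap_adm x) 0%N r r0; rewrite !add0n; apply.
exists n; split => //; first by rewrite n0 /=.
  by move=> k kn; apply/negP => xk; apply: nex; exists k; rewrite kn.
by move=> k _; rewrite ltnNge leq_addr.
Qed.

(** The minimum and the truncated subtractions also cover forced gaps that reach beyond position
    [n]; the remainder is then empty. *)
Lemma first_unit (x : X) n : (0 < n)%N -> x 0%N != None ->
  exists v, [/\ (0 < size v <= n)%N, gap_lang v &
    mkseq x n = map Some v ++ nseq (minn (g (size v)) (n - size v)) None ++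
      mkseq (iter (size v + g (size v)) shift x) (n - size v - g (size v))].
Proof.
move=> n0 x0; have [r [/andP[r0 rn] h1 h2]] := first_run n0 x0.
have [v [sv Lv ve]] := @stretch_word x 0 r h1.
exists v; rewrite sv; split => //; first by rewrite r0.
have {1}-> : n = (r + (minn (g r) (n - r) + (n - r - g r)))%N by lia.
rewrite mkseq_cat; congr (_ ++ _); first exact: ve.
rewrite mkseq_cat; congr (_ ++ _).
  apply: (@eq_from_nth _ None); rewrite size_mkseq ?size_nseq// => k kn.
  by rewrite nth_mkseq// nth_nseq kn h2//; lia.
rewrite -mkseq_shift; have [gn|gn] := leqP (g r) (n - r).
  by apply: eq_map => k; rewrite addnA.
by have -> : (n - r - g r)%N = 0%N by lia.
Qed.

Definition good (T : R) (w : seq S) : bool := T * (nongap w)%:R <= (size w)%:R.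

Section last_run.
Variable T : R.
Hypothesis T_gt0 : 0 < T.
Hypothesis gap_ratio_ge : forall r, T * r%:R <= (r + g r)%:R.

(** A gap is good, a run with all the gaps it forces is good by [gap_ratio_ge], and concatenations
    of good words are good. Only a final run whose forced gaps are cut off at [n] can be left
    over. *)
Lemma last_run (x : X) n : exists i r, [/\ (i + r <= n)%N, good T (mkseq x i),
  forall t, (i <= t < i + r)%N -> x t != None &
  forall t, (i + r <= t < n)%N -> x t = None].
Proof.
elim/ltn_ind: n x => -[|n] IH x.
  by exists 0%N, 0%N; split => //; rewrite /good mulr0.
have [x0|x0] := eqVneq (x 0%N) None.
  have [i [r [h1 h2 h3 h4]]] := IH n (ltnSn _) (shift x).
  exists i.+1, r; split => //.
  - rewrite /good -add1n mkseq_cat nongap_cat (mkseq_shift x 1) /mkseq/= x0 add0n.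
    rewrite -/(mkseq _ _) size_map size_iota; move: h2; rewrite /good size_mkseq => /le_trans; apply.
    by rewrite ler_nat.
  - by case=> // t ht; apply: (h3 t).
  - by case=> // t ht; apply: (h4 t).
have [r [/andP[r0 rn] hr hgap]] := first_run (ltn0Sn n) x0.
have [rg|rg] := leqP n.+1 (r + g r).
  exists 0%N, r; split => //; first by rewrite /good mulr0.
  move=> t /andP[rt tn]; rewrite -(subnKC rt); apply: hgap; lia.
have lt : (n.+1 - (r + g r) < n.+1)%N by lia.
have [i [r' [h1 h2 h3 h4]]] := IH _ lt (iter (r + g r) shift x).
exists (r + g r + i)%N, r'; split => //; first lia.
- have [v [sv _ ve]] := @stretch_word x 0 r hr.
  rewrite /good size_mkseq -addnA !mkseq_cat !nongap_cat.
  rewrite [mkseq x r]ve nongap_some sv.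
  have -> : mkseq (fun k => x (r + k)%N) (g r) = nseq (g r) None.
    apply: (@eq_from_nth _ None); rewrite size_mkseq ?size_nseq// => k kn.
    by rewrite nth_mkseq// nth_nseq kn hgap//; lia.
  have -> : mkseq (fun k => x (r + (g r + k))%N) i = mkseq (iter (r + g r) shift x) i.
    by rewrite -mkseq_shift; apply: eq_map => k; rewrite addnA.
  rewrite nongap_none add0n addnA natrD mulrDr [leRHS]natrD lerD//.
  by move: h2; rewrite /good size_mkseq.
- move=> t ht; rewrite (_ : t = (r + g r + (t - (r + g r)))%N); last lia.
  by rewrite -iter_shift; apply: h3; lia.
- move=> t ht; rewrite (_ : t = (r + g r + (t - (r + g r)))%N); last lia.
  by rewrite -iter_shift; apply: h4; lia.
Qed.

End last_run.

Section weighted_count.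
Variables (s kappa K : R).
Hypotheses (kappa_gt0 : 0 < kappa) (K_gt0 : 0 < K).
Hypothesis lang_growth : forall r, (p r)%:R <= K * expR (s * r%:R).
Hypothesis gap_long : forall n,
  K * \sum_(1 <= r < n.+1) expR (- (kappa * (r + g r)%:R)) <= 1 - expR (- kappa).

Let E (w : seq S) : R := expR (- (s * (nongap w)%:R)).

Let E_cat u w : E (u ++ w) = E u * E w.
Proof. by rewrite /E nongap_cat natrD mulrDr opprD expRD. Qed.

Let E_ge0 w : 0 <= E w. Proof. exact: expR_ge0. Qed.

(** A partition function in which every letter is taxed at the growth rate [s] of the language: all
    the words of one length in a run have total weight at most [K], and what remains to be counted
    is the placement of runs and gaps. *)
Definition weighted_count n : R := \sum_(w <- L n) E w.

Lemma weighted_count_ge0 n : 0 <= weighted_count n.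
Proof. exact: sumr_ge0. Qed.

Lemma weighted_count0 : weighted_count 0 = 1.
Proof.
rewrite /weighted_count (_ : L 0 = [:: [::]]); last first.
  rewrite /lang_words /= ifT//; apply/asboolP.
  by exists point.
by rewrite big_seq1 /E mulr0 oppr0 expR0.
Qed.

(* A word begins with a gap, or with a run of letters and the gaps it forces. *)
Lemma weighted_countS n : weighted_count n.+1 <= weighted_count n +
  K * \sum_(1 <= r < n.+2) weighted_count (n.+1 - r - g r).
Proof.
pose c r (v : seq letter) := map Some v ++ nseq (minn (g r) (n.+1 - r)) None.
pose cov := map (cons None) (L n) ++ flatten [seq [seq c r v ++ w |
   v <- lang_words (@gap_lang D) r, w <- L (n.+1 - r - g r)] | r <- index_iota 1 n.+2].
apply: (@le_trans _ _ (\sum_(w <- cov) E w)).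
  apply: ler_sum_subseq => //; first exact: lang_words_uniq.
  move=> w /gap_wordsP[x ->]; rewrite mem_cat.
  have [x0|x0] := eqVneq (x 0%N) None.
    apply/orP; left; apply/mapP; exists (mkseq (shift x) n); first exact: mem_gap_words.
    by rewrite -add1n mkseq_cat -[shift x]/(iter 1 shift x) -mkseq_shift /= /mkseq/= x0.
  apply/orP; right; apply/flattenP.
  have [v [/andP[v0 vn] Lv ->]] := first_unit (ltn0Sn n) x0.
  eexists; first by apply/mapP; exists (size v) => //; rewrite mem_index_iota v0 ltnS.
  apply/allpairsP; eexists (v, _); split => /=; last by rewrite /c -catA.
    by rewrite mem_lang_words eqxx andbT; apply/asboolP.
  exact: mem_gap_words.
rewrite big_cat; apply: lerD.
  rewrite big_map /weighted_count; apply: ler_sum => w _.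
  by rewrite -cat1s E_cat -[[:: _]]/(nseq 1 None) {1}/E nongap_none mulr0 oppr0 expR0 mul1r.
rewrite big_flatten_seq big_map mulr_sumr; apply: ler_sum => r _.
rewrite big_allpairs_dep/=.
under eq_bigr do under eq_bigr do rewrite E_cat.
under eq_bigr do rewrite -mulr_sumr.
rewrite -mulr_suml ler_wpM2r ?weighted_count_ge0//.
rewrite big_seq (eq_bigr (fun=> expR (- (s * r%:R)))); last first.
  move=> v; rewrite mem_lang_words => /andP[_ /eqP sv].
  by rewrite /E /c nongap_cat nongap_none nongap_some addn0 sv.
rewrite -big_seq big_const_seq count_predT iter_addr addr0 -[X in X <= _]mulr_natl.
rewrite -ler_pdivlMr ?expR_gt0// -expRN opprK; exact: lang_growth.
Qed.

Definition count_cst : R := 1 + K / kappa.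

Lemma count_cst_ge1 : 1 <= count_cst.
Proof. by rewrite lerDl divr_ge0// ltW. Qed.

(** Induction along the renewal inequality. The term with a leading gap yields the factor
    [exp (- kappa)], and [gap_long] bounds the sum over runs by the complementary factor. Runs whose
    gaps reach the end leave an empty remainder of weight 1; there are at most [n.+1] of them,
    absorbed by the linear factor and, through [kappa * n <= exp (kappa * n)], by the summand
    [K / kappa] of [count_cst]. *)
Lemma weighted_count_le n :
  weighted_count n <= count_cst * n.+1%:R * expR (kappa * n%:R).
Proof.
have C1 := count_cst_ge1; have C0 : 0 < count_cst := lt_le_trans ltr01 C1.
elim/ltn_ind: n => -[_|n IH].
  by rewrite weighted_count0 mulr0 expR0 !mulr1.
apply: (le_trans (weighted_countS n)).
set e := expR (kappa * n.+1%:R).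
have e1 : expR (kappa * n%:R) = e * expR (- kappa).
  by rewrite /e -expRD -natr1 mulrDr mulr1 addrK.
have hr r : (1 <= r < n.+2)%N -> weighted_count (n.+1 - r - g r) <=
    1 + count_cst * n.+1%:R * e * expR (- (kappa * (r + g r)%:R)).
  move=> /andP[r1 rn]; have [h|h] := leqP (r + g r) n.+1.
    have lt : (n.+1 - r - g r < n.+1)%N by have := gap_len_gt0 D r; lia.
    apply: (le_trans (IH _ lt)); rewrite -[leLHS]add0r lerD//.
    have -> : expR (kappa * (n.+1 - r - g r)%:R) = e * expR (- (kappa * (r + g r)%:R)).
      rewrite /e -expRD -mulrBr -natrB//; congr (expR (_ * _%:R)); lia.
    rewrite mulrA ler_wpM2r ?expR_ge0// ler_wpM2r ?expR_ge0//.
    by rewrite ler_wpM2l ?(ltW C0)// ler_nat; lia.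
  rewrite (_ : (n.+1 - r - g r)%N = 0%N); last lia.
  by rewrite weighted_count0 lerDl !mulr_ge0// ?expR_ge0// ltW.
have hs : \sum_(1 <= r < n.+2) weighted_count (n.+1 - r - g r) <=
    n.+1%:R + count_cst * n.+1%:R * e * \sum_(1 <= r < n.+2) expR (- (kappa * (r + g r)%:R)).
  apply: (@le_trans _ _ (\sum_(1 <= r < n.+2)
    (1 + count_cst * n.+1%:R * e * expR (- (kappa * (r + g r)%:R))))).
    by rewrite big_nat_cond [leRHS]big_nat_cond; apply: ler_sum => r /andP[/hr].
  rewrite big_split/= -mulr_sumr big_const_nat iter_addr addr0 subn1 /=.
  by [].
have {}hs := ler_wpM2l (ltW K_gt0) hs.
apply: (le_trans (lerD (IH n (ltnSn _)) hs)).
rewrite e1 mulrDr.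
have hg := gap_long n.+1.
set Sg := \sum_(1 <= r < n.+2) _ in hg *.
have A0 : 0 <= count_cst * n.+1%:R * e by rewrite !mulr_ge0// ?expR_ge0// ltW.
have hg' : K * (count_cst * n.+1%:R * e * Sg) <= count_cst * n.+1%:R * e * (1 - expR (- kappa)).
  by rewrite mulrCA ler_wpM2l.
have hK : K * n.+1%:R <= count_cst * e.
  apply: (@le_trans _ _ (K / kappa * e)).
    rewrite mulrAC ler_pdivlMr// -mulrA ler_pM2l// mulrC.
    by apply: le_trans (expR_ge1Dx _); rewrite lerDr.
  by rewrite ler_wpM2r ?expR_ge0// lerDr.
have -> : n.+2%:R = n.+1%:R + 1 :> R by rewrite natr1.
rewrite [count_cst * _ * (e * _)]mulrA mulrDr mulr1 [leRHS]mulrDl.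
rewrite mulrBr mulr1 lerBrDr in hg'.
have ar (a b c : R) : a + (b + c) = c + a + b by rewrite addrCA addrC [a + c]addrC.
by rewrite ar lerD.
Qed.

Section good_words.
Variable T : R.
Hypotheses (T_gt0 : 0 < T) (s_ge0 : 0 <= s).
Hypothesis gap_ratio_ge : forall r, T * r%:R <= (r + g r)%:R.

Definition theta : R := kappa + s / T.

(** A good word of length [n] has at most [n / T] letters, hence weight at least
    [exp (- s * n / T)]; the total weight then bounds the number of such words. *)
Lemma count_good n : (size [seq w <- L n | good T w])%:R <=
  count_cst * n.+1%:R * expR (theta * n%:R).
Proof.
have h : (size [seq w <- L n | good T w])%:R <= weighted_count n * expR (s / T * n%:R).
  rewrite -sum1_size big_filter natr_sum mulr_suml [leRHS](bigID (good T))/=.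
  rewrite -[leLHS]addr0 lerD//; last first.
    by apply: sumr_ge0 => w _; rewrite mulr_ge0 ?expR_ge0.
  rewrite big_seq_cond [leRHS]big_seq_cond; apply: ler_sum => w /andP[].
  rewrite mem_lang_words /good => /andP[_ /eqP ->] hw.
  rewrite /E -expRD -[X in X <= _]expR0 ler_expR addrC subr_ge0 -mulrA ler_wpM2l//.
  by rewrite ler_pdivlMl.
apply: (le_trans h); apply: (le_trans (ler_wpM2r (expR_ge0 _) (weighted_count_le n))).
by rewrite -[leLHS]mulrA -expRD /theta -mulrDl.
Qed.

(* A word is a good word followed by its last run of letters and by gaps. *)
Lemma count_words (s' K' : R) : 0 <= s' -> 0 < K' -> theta <= s' ->
  (forall r, (p r)%:R <= K' * expR (s' * r%:R)) ->
  forall n, (size (L n))%:R <= count_cst * K' * n.+1%:R ^+ 3 * expR (s' * n%:R).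
Proof.
move=> s'0 K'0 ths hp n.
have C0 : 0 < count_cst := lt_le_trans ltr01 count_cst_ge1.
pose cov := flatten [seq flatten [seq [seq u ++ map Some v ++ nseq (n - i - r) None |
   u <- [seq w <- L i | good T w], v <- lang_words (@gap_lang D) r] |
   r <- index_iota 0 (n - i).+1] | i <- index_iota 0 n.+1].
have sub : {subset L n <= cov}.
  move=> w /gap_wordsP[x ->]; have [i [r [h1 h2 h3 h4]]] := last_run T_gt0 gap_ratio_ge x n.
  have [v [sv Lv ve]] : exists v, [/\ size v = r, gap_lang v &
      mkseq (fun k => x (i + k)%N) r = map Some v].
    by apply: stretch_word => k kr; apply: h3; lia.
  apply/flattenP; eexists; first by apply/mapP; exists i => //; rewrite mem_index_iota; lia.
  apply/flattenP; eexists; first by apply/mapP; exists r => //; rewrite mem_index_iota; lia.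
  apply/allpairsP; exists (mkseq x i, v) => /=; split.
  - by rewrite mem_filter h2 mem_gap_words.
  - by rewrite mem_lang_words sv eqxx andbT; apply/asboolP.
  - have {1}-> : n = (i + (r + (n - i - r)))%N by lia.
    rewrite !mkseq_cat ve; congr (_ ++ (_ ++ _)).
    apply: (@eq_from_nth _ None); rewrite size_mkseq ?size_nseq// => k kn.
    by rewrite nth_mkseq// nth_nseq kn h4//; lia.
have := uniq_leq_size (lang_words_uniq _ _) sub.
rewrite -(ler_nat R) -[(size cov)]sum1_size natr_sum big_flatten_seq big_map => /le_trans; apply.
set Q := count_cst * K' * n.+1%:R * expR (s' * n%:R).
have Q0 : 0 <= Q by rewrite !mulr_ge0// ?expR_ge0// ltW.
have hQ i r : (i <= n)%N -> (r <= n - i)%N ->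
    (size [seq w <- L i | good T w])%:R * (p r)%:R <= Q.
  move=> iN rN; apply: (le_trans (ler_pM _ _ (count_good i) (hp r))) => //.
  rewrite mulrACA -expRD /Q.
  have e : expR (theta * i%:R + s' * r%:R) <= expR (s' * n%:R).
    rewrite ler_expR; apply: (@le_trans _ _ (s' * i%:R + s' * r%:R)).
      by rewrite lerD2r ler_wpM2r.
    by rewrite -mulrDr -natrD ler_wpM2l// ler_nat; lia.
  apply: ler_pM => //; rewrite ?mulr_ge0// ?expR_ge0// ?(ltW C0)// ?(ltW K'0)//.
  rewrite mulrAC ler_wpM2l// ?ler_nat// ?mulr_ge0// ltW//.
apply: (@le_trans _ _ (\sum_(i <- index_iota 0 n.+1) n.+1%:R * Q)).
  rewrite big_seq [leRHS]big_seq; apply: ler_sum => i; rewrite mem_index_iota => /andP[_ iN].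
  rewrite big_flatten_seq big_map.
  apply: (@le_trans _ _ (\sum_(r <- index_iota 0 (n - i).+1) Q)).
    rewrite big_seq [leRHS]big_seq; apply: ler_sum => r; rewrite mem_index_iota => /andP[_ rN].
    rewrite -natr_sum sum1_size size_allpairs natrM; apply: hQ; lia.
  rewrite big_const_seq count_predT iter_addr addr0 -[X in X <= _]mulr_natl size_iota subn0.
  by rewrite ler_wpM2r// ler_nat ltnS leq_subr.
rewrite big_const_seq count_predT iter_addr addr0 -[X in X <= _]mulr_natl size_iota subn0.
by rewrite le_eqVlt; apply/orP; left; apply/eqP; rewrite /Q; ring.
Qed.

End good_words.
End weighted_count.
End gap_counting.

Lemma lne_homo {R : realType} (x y : \bar R) : (x <= y)%E -> (lne x <= lne y)%E.
Proof.
move: x y => [x| |] [y| |] //=; rewrite ?leey ?leNye//.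
rewrite lee_fin => xy; case: (leP x 0) => x0; first by rewrite leNye.
have y0 := lt_le_trans x0 xy.
by rewrite ifN ?lee_fin ?ler_ln ?posrE// -ltNge.
Qed.

(** * Topological and Bowen entropy of gap shifts *)

Section gap_entropy.
Context {R : realType} {D : gap_data}.
Local Notation X := (gap_shift R D).
Local Notation S := (option (gap_letter D)).
Local Notation g := (gap_len D).
Local Notation f := (@shift R D : gap_pmetric -> gap_pmetric).
Local Notation L n := (lang_words (@gap_word R D) n).

Lemma mkseq_eqP (x y : X) n : mkseq x n = mkseq y n <-> forall k, (k < n)%N -> x k = y k.
Proof.
split=> [h k kn|h]; last by apply/eq_in_map => k; rewrite mem_iota => /andP[_]; exact: h.
by rewrite -(nth_mkseq None x kn) h nth_mkseq.
Qed.

Lemma bowen_ball_mkseq (eps : R) (x y : X) n : 0 < eps ->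
  mkseq x (n + scale_len eps) = mkseq y (n + scale_len eps) -> bowen_ball f n eps x y.
Proof.
move=> e0 /mkseq_eqP h i iN; rewrite gap_mdistE; apply: scale_lenP => // k kq.
by rewrite !iter_shift h// -addnS leq_add// ltnW.
Qed.

Lemma max_separated_ub (eps : R) n : 0 < eps ->
  (max_separated f n eps <= (size (L (n + scale_len eps)))%:R%:E)%E.
Proof.
move=> e0; apply: ge_ereal_sup => _ [A sepA <-]; rewrite lee_fin ler_nat.
set q := scale_len eps.
rewrite -(size_map (fun x : X => mkseq x (n + q)) (enum_fset A)).
apply: uniq_leq_size.
  rewrite map_inj_in_uniq ?fset_uniq// => x y xA yA e; apply: contrapT => xy.
  by apply: (sepA x y) => //; exact: bowen_ball_mkseq.
by move=> _ /mapP[x _ ->]; exact: mem_gap_words.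
Qed.

Lemma max_separated_lb (eps : R) n : eps <= 1 ->
  ((size (L n))%:R%:E <= max_separated f n eps)%E.
Proof.
move=> e1.
have h w : exists x : X, w \in L n -> mkseq x n = w.
  by have [/gap_wordsP[x ->]|nw] := boolP (w \in L n); [exists x|exists point].
pose pt w := sval (cid (h w)).
have hpt w : w \in L n -> mkseq (pt w) n = w := svalP (cid (h w)).
have inj : {in L n &, injective pt}.
  by move=> u w hu hw e; rewrite -(hpt u)// -(hpt w)// e.
apply: ereal_sup_ubound; exists (seq_fset tt (map pt (L n))); last first.
  by rewrite size_seq_fset undup_id ?size_map// map_inj_in_uniq ?lang_words_uniq.
move=> x y; rewrite !seq_fsetE => /mapP[u hu ->] /mapP[w hw ->] uw hb; apply: uw.
congr pt; rewrite -(hpt u)// -(hpt w)//; apply/mkseq_eqP => k kn.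
have := hb k kn; rewrite gap_mdistE => /lt_le_trans/(_ e1).
rewrite -[X in _ < X](invr1 R) => /(@gap_dist_lt _ _ _ _ 0%N)/(_ 0%N (leqnn _)).
by rewrite !iter_shift addn0.
Qed.

Lemma affine_mean_cvg (a b : R) : (n%:R^-1 * (a + b * n%:R) : R) @[n --> \oo] --> b.
Proof.
rewrite -cvg_shiftS.
have : (a * n.+1%:R^-1 + b : R) @[n --> \oo] --> (a * 0 + b : R).
  by apply: cvgD; [apply: cvgMr; exact: cvg_harmonic|exact: cvg_cst].
rewrite mulr0 add0r; apply: cvg_trans; apply: near_eq_cvg; near=> n.
by rewrite /= mulrDr mulrC; congr (_ + _); rewrite mulrCA mulVf ?mulr1.
Unshelve. all: by end_near. Qed.

Lemma size_gap_words_gt0 n : 0 < (size (L n))%:R :> R.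
Proof.
rewrite ltr0n; have := mem_gap_words (point : X) n.
by case: (L n).
Qed.

Lemma geometric_iota_le (r : R) a m : 0 <= r < 1 ->
  \sum_(n <- iota a m) r ^+ n <= r ^+ a / (1 - r).
Proof.
move=> /andP[r0 r1]; rewrite ler_pdivlMr ?subr_gt0//.
elim: m a => [|m IH] a; first by rewrite big_nil mul0r exprn_ge0.
rewrite big_cons mulrDl; apply: (le_trans (lerD (lexx _) (IH a.+1))).
by rewrite exprS; lra.
Qed.

(** If there is no limit, [lim] takes the default value [0], which [0 <= l] covers; so convergence
    in [eps] need not be established. *)
Lemma lim_le_of_near (u : R -> \bar R) (l : \bar R) : (0 <= l)%E ->
  (\forall eps \near 0^'+, (u eps <= l)%E) -> (lim (u eps @[eps --> 0^'+]) <= l)%E.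
Proof.
move=> l0 ul; have [cu|ncu] := pselect (cvg (u eps @[eps --> 0^'+])).
  exact: lime_le.
by rewrite dvgP.
Qed.

(** If beyond [I] a gap at [n] is followed by a letter, the last run before [n.+2] contains [n.+1]
    but not [n], so the good prefix before it is long enough. Otherwise the point consists of gaps
    from some place on, and sufficiently many of them make any prefix good. *)
Lemma good_infinitely_often (T : R) (x : X) : 0 < T ->
  (forall r, T * r%:R <= (r + g r)%:R) ->
  (forall p, exists2 n, (p <= n)%N & x n = None) ->
  forall i, exists2 n, (i <= n)%N & good T (mkseq x n).
Proof.
move=> T0 hT hx I.
have [[n In /andP[/eqP xn xSn]]|nex] :=
    pselect (exists2 n, (I <= n)%N & (x n == None) && (x n.+1 != None)).
  have [i [r [h1 h2 h3 h4]]] := last_run T0 hT x n.+2.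
  exists i => //; rewrite leqNgt; apply/negP => iI.
  have h5 : (n.+1 < i + r)%N.
    rewrite ltnNge; apply/negP => h5; move: xSn; rewrite h4 ?eqxx//.
    by rewrite h5 ltnSn.
  have := h3 n; rewrite xn eqxx => /(_ _); have -> : (i <= n < i + r)%N by lia.
  by move=> /(_ isT).
have [p Ip xp] := hx I.
have none k : x (p + k)%N = None.
  elim: k => [|k IH]; first by rewrite addn0.
  apply: contrapT => xk; apply: nex; exists (p + k)%N; first exact: leq_trans (leq_addr _ _).
  by rewrite IH eqxx -addnS; apply/eqP.
pose n := (p + Num.truncn (T * p%:R) + 1)%N.
exists n; first by rewrite /n; lia.
rewrite /good size_mkseq /n -addnA mkseq_cat nongap_cat.
have -> : mkseq (fun k => x (p + k)%N) (Num.truncn (T * p%:R) + 1) =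
    nseq (Num.truncn (T * p%:R) + 1) None.
  apply: (@eq_from_nth _ None); rewrite size_mkseq ?size_nseq// => k kn.
  by rewrite nth_mkseq// nth_nseq kn none.
rewrite nongap_none addn0 natrD.
apply: (@le_trans _ _ (T * p%:R)).
  rewrite ler_wpM2l ?(ltW T0)// ler_nat /nongap (leq_trans (count_size _ _))//.
  by rewrite size_mkseq.
by rewrite addn1 (le_trans (ltW (Num.Theory.truncnS_gt _)))// lerDr.
Qed.

Section bowen.
Variables (G : pred (seq S)) (th C : R) (F : set (@gap_pmetric R D)).
Hypotheses (C_gt0 : 0 < C) (th_ge0 : 0 <= th).
Hypothesis good_ub : forall n, (size [seq w <- L n | G w])%:R <= C * expR (th * n%:R).
Hypothesis F_good : forall x, F x -> forall i, exists2 n, (i <= n)%N & G (mkseq (x : X) n).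

(** One ball for each good prefix of length at least [N + scale_len eps] of a point of [F] gives a
    cover. A prefix of length [n] lies in a ball of order [n - scale_len eps], and [good_ub] turns
    the sum into a geometric series of ratio [exp (th - t)]. *)
Lemma bowen_C_N_le (t eps : R) N : 0 < eps -> th < t ->
  (bowen_C_N f F t eps N <= (C * expR (t * (scale_len eps)%:R) *
     (expR (th - t) ^+ (N + scale_len eps) / (1 - expR (th - t))))%:E)%E.
Proof.
move=> e0 tht; set q := scale_len eps; set r := expR (th - t).
have r01 : 0 <= r < 1 by rewrite expR_ge0 /= -expR0 ltr_expR subr_lt0.
(* Families of balls are indexed by sets of natural numbers; the indices used are the codes of these
   prefixes, and each gets a centre in [F]. *)
pose P (w : seq S) := [/\ (N + q <= size w)%N, G w & exists2 x : X, F x & mkseq x (size w) = w].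
pose wd k : seq S := odflt [::] (choice.unpickle k).
have wdK w : wd (choice.pickle w) = w by rewrite /wd choice.pickleK.
pose Dk : set nat := [set k | exists2 w, P w & choice.pickle w = k].
have hx k : exists x : X, Dk k -> F x /\ mkseq x (size (wd k)) = wd k.
  have [[w [_ _ [x Fx xw]] <-]|nD] := pselect (Dk k); last by exists point.
  by exists x; rewrite wdK.
pose xk k := sval (cid (hx k)).
have hxk k : Dk k -> F (xk k) /\ mkseq (xk k) (size (wd k)) = wd k := svalP (cid (hx k)).
apply: (le_trans (ereal_inf_lbound _)).
  exists Dk, xk, (fun k => (size (wd k) - q)%N); split; last reflexivity.
  split.
    move=> k Dk0; split; first by case: (hxk k Dk0).
    by have [w [wN _ _] <-] := Dk0; rewrite wdK; lia.
  move=> x Fx; have [n nN Gn] := F_good Fx (N + q).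
  have Pw : P (mkseq (x : X) n) by split; rewrite ?size_mkseq//; exists x; rewrite ?size_mkseq.
  have Dn : Dk (choice.pickle (mkseq (x : X) n)) by exists (mkseq (x : X) n).
  exists (choice.pickle (mkseq (x : X) n)) => //=.
  rewrite wdK size_mkseq; apply: bowen_ball_mkseq => //; rewrite -/q subnK; last first.
    by apply: leq_trans nN; exact: leq_addl.
  by have [_] := hxk _ Dn; rewrite wdK size_mkseq.
apply: ge_ereal_sup => _ [A [finA AD] <-].
rewrite fsbig_finite//= sumEFin lee_fin.
set s := fset_set A.
have sD k : k \in s -> Dk k by rewrite in_fset_set// inE => /AD.
rewrite (eq_big_seq (fun k => expR (- t * (size (wd k) - q)%:R)))//.
rewrite -(big_map wd predT (fun w => expR (- t * (size w - q)%:R))).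
pose M := (\max_(w <- map wd s) size w).+1.
apply: (@le_trans _ _ (\sum_(w <- flatten [seq [seq w <- L n | G w] | n <- iota (N + q) M])
   expR (- t * (size w - q)%:R))).
  apply: ler_sum_subseq; last by move=> w; exact: expR_ge0.
    rewrite map_inj_in_uniq ?fset_uniq// => k k' /sD[w _ <-] /sD[w' _ <-].
    by rewrite !wdK => ->.
  move=> w hw; have := hw => /mapP[k ks wE].
  have [w' [wN Gw [x Fx xw]] kE] := sD k ks.
  rewrite -kE wdK in wE; rewrite wE in hw *.
  apply/flattenP; eexists; first apply/mapP; first exists (size w') => //.
    rewrite mem_iota wN /= /M addnS ltnS (leq_trans _ (leq_addl _ _))//.
    by apply: (@leq_bigmax_seq _ _ xpredT (fun w : seq S => size w)).
  by rewrite mem_filter Gw -xw size_mkseq mem_gap_words.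
rewrite big_flatten_seq big_map.
apply: (@le_trans _ _ (\sum_(n <- iota (N + q) M) C * expR (t * q%:R) * r ^+ n)).
  rewrite big_seq [leRHS]big_seq; apply: ler_sum => n; rewrite mem_iota => /andP[nN _].
  apply: (@le_trans _ _ (expR (- t * (n - q)%:R) * (size [seq w <- L n | G w])%:R)).
    apply: ler_sum_uniq_cst => w; rewrite mem_filter mem_lang_words.
    by move=> /andP[_ /andP[_ /eqP ->]].
  apply: (le_trans (ler_wpM2l (expR_ge0 _) (good_ub n))).
  rewrite le_eqVlt; apply/orP; left; apply/eqP.
  rewrite /r -expRM_natr mulrCA -mulrA -!expRD; congr (_ * expR _).
  by rewrite natrB; [ring|apply: leq_trans nN; exact: leq_addl].
rewrite -mulr_sumr ler_wpM2l ?geometric_iota_le//.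
by rewrite mulr_ge0 ?expR_ge0// ltW.
Qed.

Lemma bowen_C_eq0 (t eps : R) : 0 < eps -> th < t -> bowen_C f F t eps = 0%E.
Proof.
move=> e0 tht; apply: cvg_lim => //.
set q := scale_len eps; set r := expR (th - t).
have r1 : r < 1 by rewrite -expR0 ltr_expR subr_lt0.
apply: (@squeeze_cvge _ _ _ _ (cst 0%E) _
   (fun N => (C * expR (t * q%:R) * (r ^+ (N + q) / (1 - r)))%:E)).
- apply: nearW => N; apply/andP; split; last exact: bowen_C_N_le.
  apply: le_ereal_inf_tmp => _ [Dk [x [n [_ ->]]]].
  by apply: esum_ge0 => k _; rewrite lee_fin expR_ge0.
- exact: cvg_cst.
- apply: cvg_EFin; first exact: nearW.
  have cr : (r ^+ (N + q) : R) @[N --> \oo] --> (0 : R).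
    rewrite (cvg_shiftn q (fun n => r ^+ n)); apply: cvg_expr.
    by rewrite ger0_norm ?expR_ge0.
  have : (C * expR (t * q%:R) * (r ^+ (N + q) * (1 - r)^-1) : R) @[N --> \oo] -->
      (C * expR (t * q%:R) * (0 * (1 - r)^-1) : R).
    by apply: cvgMr; exact: cvgMl.
  by rewrite mul0r mulr0.
Qed.

Lemma gap_bowen_htop_le : (bowen_htop f F <= th%:E)%E.
Proof.
apply: lim_le_of_near; first by rewrite lee_fin.
near=> eps; apply/lee_addgt0Pr => e e0; apply: ereal_inf_lbound.
exists (th + e); last by rewrite EFinD.
split; first by rewrite addr_ge0// ltW.
by apply: bowen_C_eq0 => //; rewrite ltrDl.
Unshelve. all: by end_near. Qed.

End bowen.

Variable h : R.
Hypothesis words_ub : forall e, 0 < e -> exists2 C : R, 0 < C &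
  forall n, (size (L n))%:R <= C * expR ((h + e) * n%:R).
Hypothesis words_lb : forall N, exists2 n, (N < n)%N & expR (h * n%:R) <= (size (L n))%:R.

Lemma htop_scale_ub (eps : R) : 0 < eps -> (htop_scale f eps <= h%:E)%E.
Proof.
move=> e0; apply/lee_addgt0Pr => e eg0.
have [C C0 hC] := words_ub eg0; set q := scale_len eps.
pose a := ln C + (h + e) * q%:R.
have cv : (n%:R^-1 * (a + (h + e) * n%:R) : R)%:E @[n --> \oo] --> (h + e)%:E.
  by apply: cvg_EFin; [exact: nearW|exact: affine_mean_cvg].
rewrite -EFinD; have [_ <-] := cvg_limn_einf_sup cv.
apply: le_limn_esup => n; rewrite EFinM.
have [->|n0] := posnP n; first by rewrite invr0 !mul0e.
rewrite lee_pmul2l ?lte_fin ?invr_gt0 ?ltr0n//.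
have p0 := size_gap_words_gt0 (n + q).
apply: (@le_trans _ _ (lne (size (L (n + q)))%:R%:E)).
  by apply: lne_homo; exact: max_separated_ub.
rewrite lne_EFin// lee_fin -ler_expR lnK ?posrE//.
apply: (le_trans (hC _)); rewrite le_eqVlt; apply/orP; left; apply/eqP.
by rewrite /a -addrA -mulrDr expRD lnK ?posrE// natrD [q%:R + _]addrC.
Qed.

(** [htop_scale] is an upper limit, so a lower bound along arbitrarily large lengths, such as the
    block lengths, is enough. *)
Lemma htop_scale_lb (eps : R) : 0 < eps -> eps <= 1 -> (h%:E <= htop_scale f eps)%E.
Proof.
move=> e0 e1; rewrite /htop_scale limn_esup_lim.
apply: lime_ge; first exact: is_cvg_esups.
apply: nearW => N; have [n Nn hn] := words_lb N.
apply: (le_trans _ (ereal_sup_ubound _)); last first.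
  by exists n => //=; exact: ltnW.
have n0 : 0 < n%:R :> R by rewrite ltr0n; exact: leq_ltn_trans Nn.
rewrite [X in (X <= _)%E](_ : _ = ((n%:R^-1)%:E * (h * n%:R)%:E)%E); last first.
  by rewrite -EFinM mulrCA mulVf ?mulr1// gt_eqF.
rewrite lee_pmul2l ?lte_fin ?invr_gt0//.
apply: (@le_trans _ _ (lne (size (L n))%:R%:E)).
  by rewrite lne_EFin ?size_gap_words_gt0// lee_fin -ler_expR lnK// posrE size_gap_words_gt0.
by apply: lne_homo; exact: max_separated_lb.
Qed.

Lemma gap_htop : htop f = h%:E.
Proof.
apply: cvg_lim => //; apply: (@cvg_trans _ (h%:E @[_ --> 0^'+])); last exact: cvg_cst.
apply: near_eq_cvg; near=> eps; apply/eqP; rewrite eq_le.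
by rewrite htop_scale_ub ?htop_scale_lb//; near: eps; exact: nbhs_right_le.
Unshelve. all: by end_near. Qed.

End gap_entropy.

(** * Entropy of invariant measures *)

Section cylinder_approximation.
Context {R : realType} {D : gap_data}.
Local Notation X := (gap_shift R D).
Local Notation T := (borel (@gap_pmetric R D)).
Local Notation S := (option (gap_letter D)).
Local Notation f := (@shift R D : gap_pmetric -> gap_pmetric).

Definition determined n (C : set X) : Prop :=
  forall x y : X, mkseq x n = mkseq y n -> C x -> C y.

Definition first_symbol (x : T) : S := (x : X) 0%N.

Lemma itinerary_first_symbol n (x : T) :
  itinerary f first_symbol n x = [ffun i : 'I_n => (x : X) i].
Proof. by apply/ffunP => i; rewrite !ffunE /first_symbol iter_shift addn0. Qed.

Lemma codom_itinerary n (x : T) :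
  [seq itinerary f first_symbol n x i | i <- enum 'I_n] = mkseq (x : X) n.
Proof.
rewrite itinerary_first_symbol (eq_map (g := (x : X) \o val)); last by move=> i; rewrite ffunE.
by rewrite map_comp val_enum_ord.
Qed.

Lemma itinerary_eqP n (x y : T) :
  itinerary f first_symbol n x = itinerary f first_symbol n y <->
  mkseq (x : X) n = mkseq (y : X) n.
Proof.
split=> [e|/mkseq_eqP e]; first by rewrite -!codom_itinerary e.
by apply/ffunP => i; rewrite !itinerary_first_symbol !ffunE e.
Qed.

Lemma measurable_first_symbol : measurable_fibers first_symbol.
Proof.
move=> a; rewrite (_ : _ @^-1` _ = cylinder [:: a]); first exact: measurable_cylinder.
by apply/seteqP; split => [x <- |x [<-]].
Qed.

Lemma measurable_determined n (C : set T) : determined n C -> measurable C.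
Proof.
move=> dC; pose V := [set v | exists2 x : T, C x & itinerary f first_symbol n x = v].
rewrite (_ : C = itinerary f first_symbol n @^-1` V).
  apply: measurable_fibers_pred; apply: measurable_itinerary; last exact: measurable_first_symbol.
  exact: measurable_shift.
apply/seteqP; split => [x Cx|x [y Cy /itinerary_eqP e]]; first by exists x.
exact: dC Cy.
Qed.

Lemma determined_le n m C : (n <= m)%N -> determined n C -> determined m C.
Proof.
move=> nm dC x y /mkseq_eqP e; apply: dC; apply/mkseq_eqP => k kn; apply: e.
exact: leq_trans nm.
Qed.

Lemma determinedC n C : determined n C -> determined n (~` C).
Proof. by move=> dC x y e nCx Cy; apply: nCx; apply: dC Cy. Qed.

Lemma determinedU n C C' : determined n C -> determined n C' -> determined n (C `|` C').
Proof. by move=> dC dC' x y e [Cx|Cx]; [left; apply: dC Cx|right; apply: dC' Cx]. Qed.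

Lemma determined_cylinder w : determined (size w) (cylinder w : set X).
Proof. by move=> x y e; rewrite /cylinder /= e. Qed.

Variable mu : probability T R.

Definition sym_diff (A C : set T) : set T := (A `\` C) `|` (C `\` A).

Definition approximable (A : set T) : Prop := measurable A /\
  forall e : R, 0 < e -> exists n C, determined n C /\ fine (mu (sym_diff A C)) <= e.

Lemma measurable_sym_diff A C : measurable A -> measurable C -> measurable (sym_diff A C).
Proof. by move=> mA mC; apply: measurableU; exact: measurableD. Qed.

Lemma fine_le_measure (A C : set T) : measurable A -> measurable C -> A `<=` C ->
  fine (mu A) <= fine (mu C).
Proof.
by move=> mA mC AC; rewrite fine_le ?fin_num_measure// le_measure ?inE.
Qed.

Lemma fine_measureU_le (A C : set T) : measurable A -> measurable C ->
  fine (mu (A `|` C)) <= fine (mu A) + fine (mu C).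
Proof.
move=> mA mC; rewrite -fineD ?fin_num_measure// fine_le ?fin_num_measure//.
- exact: measurableU.
- by rewrite fin_numD !fin_num_measure.
- exact: measureU2.
Qed.

Lemma approximable_determined n C : determined n C -> approximable C.
Proof.
move=> dC; split; first exact: measurable_determined dC.
move=> e e0; exists n, C; split => //.
by rewrite /sym_diff setDv setU0 measure0 ltW.
Qed.

Lemma approximableC A : approximable A -> approximable (~` A).
Proof.
move=> [mA hA]; split; first exact: measurableC.
move=> e /hA[n [C [dC hC]]]; exists n, (~` C); split; first exact: determinedC.
apply: le_trans hC; rewrite /sym_diff !setDE !setCK setUC [~` C `&` A]setIC.
by rewrite [~` A `&` C]setIC.
Qed.

Lemma approximableU A A' : approximable A -> approximable A' -> approximable (A `|` A').
Proof.
move=> [mA hA] [mA' hA']; split; first exact: measurableU.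
move=> e e0; have e2 : 0 < e / 2 by rewrite divr_gt0.
have [n [C [dC hC]]] := hA _ e2; have [n' [C' [dC' hC']]] := hA' _ e2.
have mC := measurable_determined dC; have mC' := measurable_determined dC'.
exists (maxn n n'), (C `|` C'); split.
  by apply: determinedU; [apply: determined_le dC|apply: determined_le dC'];
    rewrite ?leq_maxl ?leq_maxr.
apply: (@le_trans _ _ (fine (mu (sym_diff A C `|` sym_diff A' C')))).
  apply: fine_le_measure.
  - by apply: measurable_sym_diff; exact: measurableU.
  - by apply: measurableU; exact: measurable_sym_diff.
  - move=> x [[[Ax|Ax] nC]|[[Cx|Cx] nA]].
    + by left; left; split => // Cx; apply: nC; left.
    + by right; left; split => // Cx; apply: nC; right.
    + by left; right; split => // Ax; apply: nA; left.
    + by right; right; split => // Ax; apply: nA; right.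
have m1 := measurable_sym_diff mA mC; have m2 := measurable_sym_diff mA' mC'.
apply: (le_trans (fine_measureU_le m1 m2)).
by rewrite [e]splitr; exact: lerD.
Qed.

Lemma fine_bigsetU_le (I : Type) (s : seq I) (F : I -> set T) :
  (forall i, measurable (F i)) ->
  fine (mu (\big[setU/set0]_(i <- s) F i)) <= \sum_(i <- s) fine (mu (F i)).
Proof.
move=> mF; elim: s => [|i s IH]; first by rewrite !big_nil measure0.
rewrite !big_cons; apply: (le_trans (fine_measureU_le _ _)) => //.
  exact: bigsetU_measurable.
by rewrite lerD2l.
Qed.

Lemma subset_bigsetU_seq (I : eqType) (s : seq I) (F : I -> set T) a : a \in s ->
  F a `<=` \big[setU/set0]_(i <- s) F i.
Proof.
elim: s => // i s IH; rewrite inE big_cons => /orP[/eqP -> x|/IH h x /h]; first by left.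
by right.
Qed.

Lemma measure_bigcup_approx (F : nat -> set T) (e : R) : (forall n, measurable (F n)) ->
  (forall n, F n `<=` F n.+1) -> 0 < e ->
  exists N, fine (mu (\bigcup_n F n)) <= fine (mu (F N)) + e.
Proof.
move=> mF ndF e0; have mU : measurable (\bigcup_k F k) by exact: bigcupT_measurable.
have cU : mu (F N) @[N --> \oo] --> mu (\bigcup_k F k).
  apply: nondecreasing_cvg_mu => // i j ij; apply/subsetPset.
  by rewrite -(subnKC ij); elim: (j - i)%N => [|k IH]; rewrite ?addn0// addnS => x /IH/ndF.
have cf : fine (mu (F N)) @[N --> \oo] --> fine (mu (\bigcup_k F k)).
  by apply: fine_cvg; rewrite fineK// fin_num_measure.
have /cvgrPdist_lt/(_ _ e0)[N _ h] := cf.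
exists N; have := h N (leqnn N); rewrite /= => /ltr_normlW.
by rewrite ltrBlDr addrC => /ltW.
Qed.

Lemma approximable_bigcup (A : nat -> set T) : (forall k, approximable (A k)) ->
  approximable (\bigcup_k A k).
Proof.
move=> hA; have mU : measurable (\bigcup_k A k).
  by apply: bigcupT_measurable => k; case: (hA k).
split => // e e0; have e2 : 0 < e / 2 by rewrite divr_gt0.
pose U N := \big[setU/set0]_(k < N.+1) A k.
have aU N : approximable (U N).
  rewrite /U; elim: N.+1 => {N} [|N IH]; last by rewrite big_ord_recr; exact: approximableU.
  by rewrite big_ord0; apply: (@approximable_determined 0).
have mUN N : measurable (U N) by case: (aU N).
have ndU N : U N `<=` U N.+1 by rewrite /U [X in _ `<=` X]big_ord_recr; left.
have UE : \bigcup_N U N = \bigcup_k A k by exact: bigcup_bigsetU_bigcup.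
have [N hN] := measure_bigcup_approx mUN ndU e2; rewrite UE in hN.
have [_ /(_ _ e2)[n [C [dC hC]]]] := aU N.
have mC := measurable_determined dC.
exists n, C; split => //.
have sub : U N `<=` \bigcup_k A k by rewrite -UE; exact: bigcup_sup.
have m1 := measurable_sym_diff (mUN N) mC.
have m2 : measurable ((\bigcup_k A k) `\` U N) by exact: measurableD.
apply: (@le_trans _ _ (fine (mu (sym_diff (U N) C `|` ((\bigcup_k A k) `\` U N))))).
  apply: fine_le_measure; [exact: measurable_sym_diff|exact: measurableU|].
  move=> x [[Ax nC]|[Cx nA]].
    by have [Ux|nU] := pselect (U N x); [left; left|right].
  by left; right; split => // /sub.
apply: (le_trans (fine_measureU_le m1 m2)).
rewrite [e]splitr; apply: lerD => //.
rewrite measureD// ?setIidr// ?fineB ?fin_num_measure//; last first.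
  by rewrite ltey_eq fin_num_measure.
by rewrite lerBlDl.
Qed.

(** Approximable sets form a sigma-algebra, and an open set is a countable union of cylinders, which
    depend on finitely many symbols. *)
Lemma borel_approximable (A : set T) : measurable A -> approximable A.
Proof.
have h : <<s (@open X) >> `<=` approximable.
  apply: smallest_sub.
    split; first by apply: (@approximable_determined 0).
      by move=> B hB; rewrite setTD; exact: approximableC.
    exact: approximable_bigcup.
  move=> B oB; rewrite (open_bigcup_cylinder oB).
  pose c (o : option (seq S)) : set X := if o is Some w then
     (if `[< cylinder w `<=` B >] then cylinder w else set0) else set0.
  rewrite (_ : \bigcup_(w in _) _ = \bigcup_k c (choice.unpickle k)).
    have a0 : approximable set0 by apply: (@approximable_determined 0).
    have ac o : approximable (c o).
      case: o => [w|] /=; last exact: a0.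
      case: ifP => _; last exact: a0.
      exact: approximable_determined (@determined_cylinder w).
    exact: (approximable_bigcup (fun k => ac (choice.unpickle k))).
  apply/seteqP; split => [x [w wB xw]|x [k _]].
    exists (choice.pickle w); first by []; rewrite choice.pickleK /c.
    by case: asboolP.
  have hc o : c o x -> (\bigcup_(w in [set w | cylinder w `<=` B]) cylinder w) x.
    by case: o => //= w; case: asboolP => // wB xw; exists w.
  exact: hc.
by move=> mA; apply: h.
Qed.

(** Every cell is approximated within [e / k] by a set [C a] depending on [j] symbols. Outside the
    [k] symmetric differences a point lies in [C a] for its own cell [a] only, so picking such an
    [a] recovers the cell. *)
Lemma partition_approximable (k : nat) (P : T -> 'I_k) (e : R) : measurable_fibers P -> 0 < e ->
  exists j (phi : {ffun 'I_j -> S} -> 'I_k),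
    fine (mu [set x | P x != phi (itinerary f first_symbol j x)]) <= e.
Proof.
move=> mP e0; have a0 : 'I_k := P point.
have k0 : (0 < k)%N by case: (a0) => i; exact: leq_ltn_trans.
have ek : 0 < e / k%:R by rewrite divr_gt0// ltr0n.
have hA a : {nC : nat * set X | determined nC.1 nC.2 &
    fine (mu (sym_diff (P @^-1` [set a]) nC.2)) <= e / k%:R}.
  apply: cid2; have [_ /(_ _ ek)[n [C [h1 h2]]]] := borel_approximable (mP a).
  by exists (n, C).
pose n a := (s2val (hA a)).1; pose C a := (s2val (hA a)).2.
have dC a : determined (n a) (C a) := s2valP (hA a).
have hC a : fine (mu (sym_diff (P @^-1` [set a]) (C a))) <= e / k%:R := s2valP' (hA a).
pose j := \max_(a < k) n a.
have {}dC a : determined j (C a) by apply: determined_le (dC a); exact: leq_bigmax.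
pose sel (v : {ffun 'I_j -> S}) a := `[< exists2 x : T, C a x & itinerary f first_symbol j x = v >].
exists j, (fun v => if [pick a | sel v a] is Some a then a else a0).
have selE (x : T) a : sel (itinerary f first_symbol j x) a = `[< C a x >].
  apply/asboolP/asboolP => [[y Cy /itinerary_eqP e']|Cx]; last by exists x.
  exact: dC Cy.
have msd a : measurable (sym_diff (P @^-1` [set a]) (C a)).
  by apply: measurable_sym_diff => //; exact: measurable_determined (dC a).
apply: (@le_trans _ _ (fine (mu (\big[setU/set0]_(a <- index_enum 'I_k)
    sym_diff (P @^-1` [set a]) (C a))))).
  apply: fine_le_measure.
  - rewrite (_ : [set x | _] = (fun x => (P x, itinerary f first_symbol j x)) @^-1`
      [set w | w.1 != if [pick a | sel w.2 a] is Some a then a else a0]) //.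
    apply: measurable_fibers_pred; apply: measurable_fibers_pair => //.
    by apply: measurable_itinerary; [exact: measurable_shift|exact: measurable_first_symbol].
  - by apply: bigsetU_measurable => a _.
  - move=> x /= hx; apply: contrapT => nx; move/negP: hx; apply; apply/eqP.
    have nsd a : ~ sym_diff (P @^-1` [set a]) (C a) x.
      by move=> h; apply: nx; apply: (subset_bigsetU_seq (a := a)) h; rewrite mem_index_enum.
    case: pickP => [a|/(_ (P x))]; rewrite selE; [move=> /asboolP Ca|move=> /asboolP nC].
      by apply: contrapT => Pa; apply: (nsd a); right; split.
    by exfalso; apply: (nsd (P x)); left.
apply: (le_trans (fine_bigsetU_le _ msd)).
apply: (le_trans (ler_sum _ (fun a _ => hC a))).
by rewrite sumr_const card_ord -[leLHS]mulr_natr divfK// pnatr_eq0 -lt0n.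
Qed.

Lemma noise_small (k : nat) (e : R) : (0 < k)%N -> 0 < e ->
  exists2 d : R, 0 < d < 1 & - ln (1 - d) - d * ln (d / k%:R) <= e.
Proof.
move=> k0 e0; have kR : 1 <= k%:R :> R by rewrite ler1n.
have k0R : 0 < k%:R :> R by rewrite ltr0n.
set y := 4 * k%:R / e + 2 * k%:R + 2.
have ke : 0 < 4 * k%:R / e by rewrite !mulr_gt0 ?invr_gt0.
have y0 : 0 < y by rewrite /y; lra.
have y1 : 1 <= y by rewrite /y; lra.
have yk : 2 * k%:R <= y by rewrite /y; lra.
(* Then [- d * ln (d / k)] equals [d * 2 * ln y], at most [2 * k / y] as [ln y <= y]. The other term
   is at most [2 * d <= 2 * k / y], and [y] exceeds [4 * k / e]. *)
pose d := k%:R / y ^+ 2.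
have d0 : 0 < d by rewrite divr_gt0// exprn_gt0.
have dy : d = k%:R / y / y by rewrite /d expr2 invfM mulrA.
have d2 : d <= 1 / 2.
  rewrite dy ler_pdivrMr// ler_pdivrMr//; apply: (@le_trans _ _ (1 / 2 * y)); first by lra.
  by rewrite -[X in X <= _]mulr1 ler_wpM2l// mulr_ge0// ltW.
exists d; first by rewrite d0 /=; lra.
have h1 : - ln (1 - d) <= 2 * d.
  have d1 : 0 < 1 - d by lra.
  rewrite -lnV ?posrE//.
  have -> : (1 - d)^-1 = 1 + d / (1 - d) by field; rewrite gt_eqF.
  apply: (le_trans (le_ln1Dx _)).
    by apply: lt_trans (_ : 0 < _); rewrite ?ltrN10// divr_gt0.
  rewrite ler_pdivrMr//; move: d0 d2 => d0 d2.
  by have := ler_wpM2l (ltW d0) d2; lra.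
have h2 : - (d * ln (d / k%:R)) <= 2 * k%:R / y.
  have -> : d / k%:R = (y ^+ 2)^-1 by rewrite /d; field; rewrite !gt_eqF ?exprn_gt0.
  rewrite lnV ?posrE ?exprn_gt0// mulrN opprK lnXn//.
  have -> : ln y *+ 2 = 2 * ln y by rewrite mulr_natl.
  have -> : 2 * k%:R / y = d * (2 * y) by rewrite /d; field; rewrite gt_eqF.
  by rewrite ler_pM2l// ler_pM2l// ltW// ln_sublinear.
have h3 : d <= k%:R / y.
  by rewrite dy ler_pdivrMr// ler_peMr// divr_ge0// ltW.
apply: (@le_trans _ _ (4 * k%:R / y)).
  by move: h1 h2 h3; rewrite -[2 * k%:R / y]mulrA -[4 * k%:R / y]mulrA; lra.
rewrite ler_pdivrMr// -ler_pdivrMl// mulrC /y; lra.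
Qed.

Hypothesis invf : forall A : set T, measurable A -> mu (f @^-1` A) = mu A.

(** The first symbol is a generator: any partition is, up to small measure, a function of finitely
    many symbols, and [join_entropy_approx] transfers the bound. A partition whose mean entropies
    diverge has [partition_entropy] equal to the default [0], hence [0 <= b]. *)
Lemma measure_entropy_le (b : R) : 0 <= b ->
  (forall e, 0 < e -> exists C, forall n,
    law_entropy mu (itinerary f first_symbol n) <= C + (b + e) * n%:R) ->
  (measure_entropy f mu <= b%:E)%E.
Proof.
move=> b0 hb; apply: ge_ereal_sup => _ [k [P [mP ->]]].
rewrite /partition_entropy; have [cu|ncu] := pselect
    (cvg ((n%:R^-1 * join_entropy f mu P n)%:E @[n --> \oo])); last by rewrite dvgP// lee_fin.
apply/lee_addgt0Pr => e e0; have e2 : 0 < e / 2 by rewrite divr_gt0.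
have [C hC] := hb _ e2.
have k0 : (0 < k)%N by case: (P point) => i; exact: leq_ltn_trans.
have [d /andP[d0 d1] hd] := noise_small k0 e2.
have [j [phi hphi]] := partition_approximable mP d0.
pose a := C + (b + e / 2) * j%:R.
have cv : (n%:R^-1 * (a + (b + e) * n%:R) : R)%:E @[n --> \oo] --> (b + e)%:E.
  by apply: cvg_EFin; [exact: nearW|exact: affine_mean_cvg].
rewrite -EFinD -(cvg_lim _ cv)//; apply: lee_lim => //; first by apply/cvg_ex; exists (b + e)%:E.
apply: nearW => n; rewrite lee_fin ler_wpM2l ?invr_ge0// join_entropyE.
apply: (le_trans (join_entropy_approx (@measurable_shift R D) invf mP
  measurable_first_symbol d0 d1 hphi n)).
have h1 := hC (n + j)%N; have h2 := ler_wpM2l (ler0n R n) hd.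
move: h1 h2; rewrite /a natrD; lra.
Qed.

Lemma law_entropy_inj (W V : finType) (Z : T -> W) (r : W -> V) : measurable_fibers Z ->
  injective r -> law_entropy mu (r \o Z) = law_entropy mu Z.
Proof.
move=> mZ ir; congr (- _); rewrite -(law_expect_comp mu r (fun v => ln (law mu (r \o Z) v)) mZ).
apply: eq_bigr => w _; congr (_ * ln _); rewrite law_comp//.
by rewrite (eq_bigl (pred1 w)) ?big_pred1_eq// => w'; rewrite /= (inj_eq ir).
Qed.

(** The upper bound ensures convergence: [partition_entropy] is a [lim], so the mean entropies have
    to be squeezed to [b]. *)
Lemma measure_entropy_ge (b : R) :
  (forall n, n%:R * b <= law_entropy mu (itinerary f first_symbol n)) ->
  (forall e, 0 < e -> exists C, forall n,
    law_entropy mu (itinerary f first_symbol n) <= C + (b + e) * n%:R) ->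
  (b%:E <= measure_entropy f mu)%E.
Proof.
move=> lb ub; pose P (x : T) := enum_rank (first_symbol x).
apply: (le_trans _ (ereal_sup_ubound _)); last first.
  eexists; exists P; split; last reflexivity.
  move=> i; have := @measurable_fibers_comp R _ _ _ _ (@enum_rank S) measurable_first_symbol i.
  exact.
have E n : join_entropy f mu P n = law_entropy mu (itinerary f first_symbol n).
  rewrite join_entropyE -(@law_entropy_inj _ _ _ (fun v : {ffun 'I_n -> S} => [ffun i => enum_rank (v i)])).
  - congr law_entropy; apply/funext => x; apply/ffunP => i /=; by rewrite !ffunE.
  - by apply: measurable_itinerary; [exact: measurable_shift|exact: measurable_first_symbol].
  - move=> v v' /ffunP e; apply/ffunP => i; have := e i; rewrite !ffunE; exact: enum_rank_inj.
have cv : (n%:R^-1 * join_entropy f mu P n : R) @[n --> \oo] --> b.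
  apply/cvgrPdist_le => e e0; have e2 : 0 < e / 2 by rewrite divr_gt0.
  have [C hC] := ub _ e2.
  have c2 := @affine_mean_cvg R C (b + e / 2 : R).
  have /cvgrPdist_le/(_ _ e2) := c2; apply: filterS2 (nbhs_infty_gt 0) => n n0 /=.
  have n0R : 0 < n%:R :> R by rewrite ltr0n.
  rewrite E => /ler_normlP[h1 h2]; rewrite distrC ger0_norm.
    have := ler_wpM2l (ltW (_ : 0 < n%:R^-1)) (hC n); rewrite invr_gt0 => /(_ n0R).
    by move: h1; lra.
  by rewrite subr_ge0 ler_pdivlMl.
rewrite /partition_entropy (cvg_lim _ (cvg_EFin _ cv))//.
exact: nearW.
Qed.

End cylinder_approximation.

Lemma probability_ext d (T : measurableType d) (R : realType) (P Q : probability T R) :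
  (forall A, P A = Q A) -> P = Q.
Proof.
move: P Q => [P [p1 p2 p3 p4 p5 p6 p7]] [Q [q1 q2 q3 q4 q5 q6 q7]] /= /funext PQ.
subst Q.
case: p1 p2 => c a p2; case: q1 q2 => c' a' q2.
rewrite (Prop_irrelevance c' c) (Prop_irrelevance a' a) in q2 *.
case: p2 q2 => s [s']; rewrite (Prop_irrelevance s' s) {s'}.
case: p3 q3 => s3 [s']; rewrite (Prop_irrelevance s' s3) {s'}.
case: p4 q4 => s4 [s']; rewrite (Prop_irrelevance s' s4) {s'}.
case: p5 q5 => s5 [s']; rewrite (Prop_irrelevance s' s5) {s'}.
case: p6 q6 => s6 [s']; rewrite (Prop_irrelevance s' s6) {s'}.
by case: p7 q7 => s7 [s']; rewrite (Prop_irrelevance s' s7).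
Qed.

(** * Letter mass and entropy of invariant measures *)

Section gap_measures.
Context {R : realType} {D : gap_data}.
Local Notation X := (gap_shift R D).
Local Notation T := (borel (@gap_pmetric R D)).
Local Notation S := (option (gap_letter D)).
Local Notation f := (@shift R D : gap_pmetric -> gap_pmetric).
Local Notation g := (gap_len D).
Local Notation L n := (lang_words (@gap_word R D) n).

(** Two cylinders are nested or disjoint, so together with the empty set they are stable under
    intersection; being countably many, they generate the open sets. *)
Lemma cylinder_measure_unique (m1 m2 : {measure set T -> \bar R}) :
  (forall w, m1 (cylinder w) = m2 (cylinder w)) -> (m1 setT < +oo)%E ->
  forall A, measurable A -> m1 A = m2 A.
Proof.
move=> m12 fin1 A mA.
pose G : set (set T) := [set C | C = set0 \/ exists w, C = cylinder w].
have cylT : cylinder [::] = setT :> set T by apply/seteqP; split.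
apply: (@measure_unique _ _ T G (fun=> setT)) => //.
- apply/seteqP; split; last first.
    apply: smallest_sub; first exact: smallest_sigma_algebra.
    by move=> _ [->|[w ->]]; [exact: measurable0|exact: measurable_cylinder].
  apply: smallest_sub; first exact: smallest_sigma_algebra.
  move=> B oB; rewrite (open_bigcup_cylinder oB) bigcup_mkcond.
  apply: (@countable_bigcupT_measurable _ (g_sigma_algebraType G)).
    exact: countableP.
  move=> w; case: ifP => _; last exact: measurable0.
  by apply: sub_sigma_algebra; right; exists w.
- move=> U V [->|[u ->]]; first by rewrite set0I; left.
  move=> [->|[v ->]]; first by rewrite setI0; left.
  have [->|/set0P[x [xu xv]]] := eqVneq (cylinder u `&` cylinder v : set T) set0; first by left.
  right; have h (u' v' : seq S) : (size u' <= size v')%N -> cylinder u' x -> cylinder v' x ->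
      cylinder u' `&` cylinder v' = cylinder v' :> set T.
    move=> uv /cylinderP xu' /cylinderP xv'; apply/setIidr => y /cylinderP yv.
    by apply/cylinderP => k ku; rewrite -xu'// yv ?xv'//; exact: leq_trans uv.
  case: (leqP (size u) (size v)) => uv; first by exists v; exact: h.
  by exists u; rewrite setIC; apply: h => //; exact: ltnW.
- by move=> _; right; exists [::].
- by rewrite bigcup_const//; exists 0%N.
- by move=> _ [->|[w ->]]; rewrite ?measure0.
Qed.

Variable mu : probability T R.
Hypothesis invf : forall A : set T, measurable A -> mu (f @^-1` A) = mu A.

Definition letters_upto N : set T := [set x | forall k, (k < N)%N -> (x : X) k != None].
Definition gaps_upto N : set T := [set x | forall k, (k < N)%N -> (x : X) k = None].

Lemma measurable_letters_upto N : measurable (letters_upto N).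
Proof.
apply: (@measurable_determined R D N) => x y /mkseq_eqP e h k kN.
by rewrite -e// h.
Qed.

Lemma measurable_gaps_upto N : measurable (gaps_upto N).
Proof.
apply: (@measurable_determined R D N) => x y /mkseq_eqP e h k kN.
by rewrite -e// h.
Qed.

Local Notation a N := (fine (mu (letters_upto N))).
Local Notation b N := (fine (mu (gaps_upto N))).

Lemma fine_measureD (A B : set T) : measurable A -> measurable B -> B `<=` A ->
  fine (mu (A `\` B)) = fine (mu A) - fine (mu B).
Proof.
move=> mA mB BA; rewrite measureD// ?setIidr// ?fineB ?fin_num_measure//.
by rewrite ltey_eq fin_num_measure.
Qed.

(* A run of letters of length [j] is followed by more than [d] gaps; shifting the
   end of the run to the origin turns it into an event about gaps only. *)
Lemma run_end_measure j d : (0 < j)%N -> (d < g j)%N ->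
  a j - a j.+1 <= b d.+1 - b d.+2.
Proof.
move=> j0 dg.
have m1 := measurable_letters_upto; have m2 := measurable_gaps_upto.
have sub1 : letters_upto j.+1 `<=` letters_upto j.
  by move=> x h k kj; apply: h; exact: ltnW.
have sub2 : gaps_upto d.+2 `<=` f @^-1` gaps_upto d.+1.
  by move=> x h k kd; exact: h.
have ms : measurable (f @^-1` gaps_upto d.+1 : set T) by exact: measurable_shift.
rewrite -fine_measureD//.
have -> : b d.+1 - b d.+2 = fine (mu ((f @^-1` gaps_upto d.+1) `\` gaps_upto d.+2)).
  by rewrite fine_measureD// invf.
have mB : measurable ((f @^-1` gaps_upto d.+1 : set T) `\` gaps_upto d.+2).
  exact: measurableD.
rewrite -(measure_iter_preimage (@measurable_shift R D) invf j.-1 mB).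
apply: fine_le_measure.
- exact: measurableD.
- apply: measurable_iter_preimage => //; exact: measurable_shift.
- move=> x [h1 h2].
  have xj : (x : X) j = None.
    apply: contrapT => /eqP xj; apply: h2 => k; rewrite ltnS leq_eqVlt => /orP[/eqP ->//|].
    exact: h1.
  split.
    move=> k kd; rewrite -[f _]/(iter 1 f _) -iterD iter_shift.
    rewrite (_ : (1 + j.-1 + k)%N = (0 + j + k)%N); last lia.
    by apply: (proj2 (gap_adm (x : X))) => //; lia.
  move=> /(_ 0%N isT); rewrite iter_shift addn0 => xn.
  by have := h1 j.-1; rewrite prednK// xn leqnn => /(_ isT).
Qed.

(** For the [q] lengths from [q * d + 1] to [q * d + q] the forced gap exceeds [d], so each drop of
    [a] is at most [b d.+1 - b d.+2]. Telescoping over [d], with [a n] tending to zero, gives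
    [a 1 <= q * b 1], where [b 1 = 1 - a 1]. *)
Lemma letters_measure_le (q : nat) : (0 < q)%N -> (forall r, (r <= q * g r)%N) ->
  (forall e, 0 < e -> exists N, forall n, (N <= n)%N -> a n <= e) ->
  a 1 <= q%:R / (1 + q%:R).
Proof.
move=> q0 hq a0.
have step d i : (i <= q)%N -> a (q * d + 1)%N - a (q * d + i + 1)%N <= i%:R * (b d.+1 - b d.+2).
  elim: i => [|i IH] iq; first by rewrite addn0 subrr mul0r.
  have h := IH (ltnW iq).
  have dg : (d < g (q * d + i + 1))%N.
    rewrite -(ltn_pmul2l q0); apply: leq_trans (hq _); lia.
  have h3 : a (q * d + i + 1)%N - a (q * d + i + 1).+1%N <= b d.+1 - b d.+2.
    by apply: run_end_measure => //; rewrite addn1.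
  rewrite (_ : (q * d + i.+1 + 1)%N = (q * d + i + 1).+1); last lia.
  by rewrite -natr1 mulrDl mul1r; move: h h3; lra.
have sum m : a 1 - a (q * m + 1)%N <= q%:R * (b 1 - b m.+1).
  elim: m => [|m IH]; first by rewrite muln0 add0n !subrr mulr0.
  have := step m q (leqnn q); rewrite (_ : (q * m + q + 1)%N = (q * m.+1 + 1)%N); last lia.
  by move: IH; rewrite !mulrBr; lra.
have h e : 0 < e -> a 1 <= q%:R * b 1 + e.
  move=> e0; have [N hN] := a0 e e0; have := sum N.
  have : a (q * N + 1)%N <= e by apply: hN; nia.
  have : 0 <= q%:R * b N.+1 by rewrite mulr_ge0// fine_ge0.
  by rewrite mulrBr; lra.
have hb : b 1 = 1 - a 1.
  have -> : gaps_upto 1 = ~` letters_upto 1.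
    apply/seteqP; split => x h1; first by move=> h2; have := h2 0%N isT; rewrite (h1 0%N isT).
    by case=> // _; apply: contrapT => /eqP h2; apply: h1; case.
  rewrite probability_setC ?fineB ?fin_num_measure//; exact: measurable_letters_upto.
have : a 1 <= q%:R * b 1 by apply/ler_addgt0Pr.
rewrite hb ler_pdivlMr ?addr_gt0 ?ltr0n//; lra.
Qed.

Lemma law_nongap n :
  \sum_v law mu (itinerary f (@first_symbol R D) n) v *
    (nongap [seq v i | i <- enum 'I_n])%:R = n%:R * a 1.
Proof.
have mZ : measurable_fibers (itinerary f (@first_symbol R D) n).
  by apply: measurable_itinerary; [exact: measurable_shift|exact: measurable_first_symbol].
have E (v : {ffun 'I_n -> S}) : (nongap [seq v i | i <- enum 'I_n])%:R =
    \sum_(i < n) (v i != None)%:R :> R.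
  by rewrite /nongap count_map -sum1_count big_mkcond/= natr_sum big_enum;
    apply: eq_bigr => i _; case: (v i).
under eq_bigr do rewrite E mulr_sumr.
rewrite exchange_big/= -[n in RHS](card_ord n) mulr_natl -sumr_const; apply: eq_bigr => i _.
rewrite (eq_bigr (fun v : {ffun 'I_n -> S} => if v i != None then
  law mu (itinerary f (@first_symbol R D) n) v else 0)); last first.
  by move=> v _; case: ifP => _; rewrite ?mulr1 ?mulr0.
rewrite -big_mkcond law_sum//; congr fine.
rewrite -(measure_iter_preimage (@measurable_shift R D) invf i (measurable_letters_upto 1)).
congr (mu _); apply/seteqP; split => x /=; rewrite itinerary_first_symbol ffunE.
  by move=> h [|//] _; rewrite iter_shift addn0.
by move=> /(_ 0%N isT); rewrite iter_shift addn0.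
Qed.

Lemma mem_itinerary_word n v : 0 < law mu (itinerary f (@first_symbol R D) n) v ->
  [seq v i | i <- enum 'I_n] \in L n.
Proof.
move=> h; have [E|/set0P[x <-]] := eqVneq (itinerary f (@first_symbol R D) n @^-1` [set v]) set0.
  by move: h; rewrite /law E measure0 ltxx.
by rewrite codom_itinerary; exact: mem_gap_words.
Qed.

Lemma big_ffun_words (V : nmodType) n (F : seq S -> V) :
  \sum_(v : {ffun 'I_n -> S}) F [seq v i | i <- enum 'I_n] = \sum_(w <- words n) F w.
Proof.
rewrite -(big_map (fun v : {ffun 'I_n -> S} => [seq v i | i <- enum 'I_n]) predT F).
apply: perm_big; apply: uniq_perm; rewrite ?words_uniq//.
  rewrite map_inj_uniq ?index_enum_uniq// => u v /eq_in_map e; apply/ffunP => i.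
  by apply: e; rewrite mem_enum.
move=> w; rewrite mem_words; apply/mapP/eqP => [[v _ ->]|sw].
  by rewrite size_map -cardE card_ord.
exists [ffun i : 'I_n => nth None w i]; first exact: mem_index_enum.
rewrite (eq_map (g := nth None w \o val)); last by move=> i; rewrite ffunE.
rewrite map_comp val_enum_ord; apply: (@eq_from_nth _ None); rewrite ?size_map ?size_iota// sw => k kn.
by rewrite (nth_map 0%N) ?size_iota// nth_iota.
Qed.

Lemma big_ffun_gap_words n (F : seq S -> R) :
  \sum_(v : {ffun 'I_n -> S}) (if [seq v i | i <- enum 'I_n] \in L n
     then F [seq v i | i <- enum 'I_n] else 0) = \sum_(w <- L n) F w.
Proof.
rewrite (big_ffun_words _ (fun w => if w \in L n then F w else 0)) -big_mkcond/=.
rewrite -big_filter; congr bigop; rewrite /lang_words; apply: eq_in_filter => w.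
by rewrite mem_filter => ->; rewrite andbT.
Qed.

(** Gibbs' inequality against the uniform distribution on the words of length [n]. *)
Lemma law_entropy_le_count n :
  law_entropy mu (itinerary f (@first_symbol R D) n) <= ln (size (L n))%:R.
Proof.
have mZ : measurable_fibers (itinerary f (@first_symbol R D) n).
  by apply: measurable_itinerary; [exact: measurable_shift|exact: measurable_first_symbol].
have c0 := @size_gap_words_gt0 R D n.
pose q (v : {ffun 'I_n -> S}) : R :=
  if [seq v i | i <- enum 'I_n] \in L n then (size (L n))%:R^-1 else 0.
apply: (le_trans (law_entropy_gibbs (q := q) mZ _ _ _)).
- by move=> v; rewrite /q; case: ifP; rewrite // invr_ge0.
- by move=> v /mem_itinerary_word h; rewrite /q h invr_gt0.
- rewrite (big_ffun_gap_words n (fun=> (size (L n))%:R^-1)).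
  by rewrite big_const_seq count_predT iter_addr addr0 -[X in X <= _]mulr_natr mulVf ?gt_eqF.
rewrite (eq_bigr (fun v => law mu (itinerary f (@first_symbol R D) n) v * - ln (size (L n))%:R)).
  by rewrite -mulr_suml law_sum1// mul1r opprK.
move=> v _; have [->|n0] := eqVneq (law mu (itinerary f (@first_symbol R D) n) v) 0.
  by rewrite !mul0r.
have v0 : 0 < law mu (itinerary f (@first_symbol R D) n) v.
  by rewrite lt_neqAle eq_sym n0 law_ge0.
by rewrite /q (mem_itinerary_word v0) lnV.
Qed.

Lemma weighted_count_gt0 (s : R) n : 0 < @weighted_count R D s n.
Proof.
rewrite /weighted_count; have := mem_gap_words (point : X) n.
case: (L n) => // w t _; rewrite big_cons ltr_wpDr ?expR_gt0//.
by apply: sumr_ge0 => *; exact: expR_ge0.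
Qed.

(** The easy half of the variational principle at length [n]: Gibbs' inequality against the
    normalised weights of [weighted_count], with [n * a 1] as the expected number of letters. *)
Lemma law_entropy_le_weighted (s : R) n :
  law_entropy mu (itinerary f (@first_symbol R D) n) <=
    ln (@weighted_count R D s n) + s * (n%:R * a 1).
Proof.
have mZ : measurable_fibers (itinerary f (@first_symbol R D) n).
  by apply: measurable_itinerary; [exact: measurable_shift|exact: measurable_first_symbol].
set Z := @weighted_count R D s n.
have Z0 : 0 < Z := weighted_count_gt0 s n.
pose q (v : {ffun 'I_n -> S}) : R := if [seq v i | i <- enum 'I_n] \in L n then
  expR (- (s * (nongap [seq v i | i <- enum 'I_n])%:R)) / Z else 0.
apply: (le_trans (law_entropy_gibbs (q := q) mZ _ _ _)).
- by move=> v; rewrite /q; case: ifP; rewrite // divr_ge0 ?expR_ge0// ltW.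
- by move=> v /mem_itinerary_word h; rewrite /q h divr_gt0 ?expR_gt0.
- rewrite (big_ffun_gap_words n (fun w => expR (- (s * (nongap w)%:R)) / Z)).
  by rewrite -mulr_suml divff ?gt_eqF.
rewrite (eq_bigr (fun v => law mu (itinerary f (@first_symbol R D) n) v * - ln Z -
   s * (law mu (itinerary f (@first_symbol R D) n) v * (nongap [seq v i | i <- enum 'I_n])%:R))).
  rewrite sumrB -mulr_suml law_sum1// mul1r -mulr_sumr law_nongap; lra.
move=> v _; have [->|n0] := eqVneq (law mu (itinerary f (@first_symbol R D) n) v) 0.
  by rewrite !mul0r mulr0 subr0.
have v0 : 0 < law mu (itinerary f (@first_symbol R D) n) v.
  by rewrite lt_neqAle eq_sym n0 law_ge0.
rewrite /q (mem_itinerary_word v0) ln_div ?posrE ?expR_gt0// expRK; ring.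
Qed.

End gap_measures.

(** * Measures carried by one copy of the language *)

Section occ_positions.
Context {B : finType}.
Implicit Types u w : seq B.

Lemma occ_sum u w : occ u w = (\sum_(k < size w) prefix u (drop k w))%N.
Proof.
elim: w => [|a w IH]; first by rewrite big_ord0.
by rewrite /= IH big_ord_recl drop0.
Qed.

Lemma occ_sum_le u w n : size w = (n + size u)%N ->
  (\sum_(k < n) prefix u (drop k w) <= occ u w <=
   \sum_(k < n) prefix u (drop k w) + size u)%N.
Proof.
move=> sw; rewrite occ_sum sw.
rewrite -(big_mkord xpredT (fun k => prefix u (drop k w) : nat)).
rewrite -(big_mkord xpredT (fun k => prefix u (drop k w) : nat)).
have -> : (\sum_(0 <= k < n + size u) prefix u (drop k w) =
    \sum_(0 <= k < n) prefix u (drop k w) + \sum_(n <= k < n + size u) prefix u (drop k w))%N.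
  by rewrite -big_cat_nat ?leq_addr.
rewrite leq_addr leq_add2l.
apply: (@leq_trans (\sum_(n <= k < n + size u) 1)).
  by apply: leq_sum => k _; exact: leq_b1.
by rewrite sum_nat_const_nat muln1 addKn.
Qed.

End occ_positions.

Section tagged_language.
Context {R : realType} {B : finType}.
Variables (m : nat) (g : nat -> nat).
Hypotheses (B_gt2 : (2 < #|B|)%N) (m_gt0 : (0 < m)%N).
Hypotheses (g_mono : {homo g : i j / (i <= j)%N}) (g_gt0 : forall n, (0 < g n)%N).

Definition tag_lang (w : seq ('I_m * B)%type) : Prop :=
  exists i v, perm_lang v /\ w = map (pair i) v.

Lemma tag_lang_nil : tag_lang [::].
Proof.
exists (Ordinal m_gt0), [::]; split => //.
by have [u Lu su] := perm_lang_take B_gt2 0; rewrite (size0nil su) in Lu.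
Qed.

Lemma tag_lang_infix u w : infix u w -> tag_lang w -> tag_lang u.
Proof.
move=> /infixP[s [t ->]] [i [v [Lv e]]].
exists i, (take (size u) (drop (size s) v)); split.
  apply: perm_lang_infix Lv; apply: infix_trans (prefixW (prefix_take _ _)) _.
  by apply: suffixW; exact: suffix_drop.
by rewrite map_take map_drop -e drop_size_cat// take_size_cat.
Qed.

Definition tagged_data : gap_data :=
  GapData tag_lang_nil tag_lang_infix g_mono g_gt0.

Local Notation D := tagged_data.
Local Notation X := (gap_shift R D).
Local Notation T := (borel (@gap_pmetric R D)).
Local Notation S := (option ('I_m * B)).
Local Notation f := (@shift R D : gap_pmetric -> gap_pmetric).
Local Notation c := (@word_freq R B).

Lemma tag_lang_sizes n : exists2 u, @gap_lang D u & size u = n.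
Proof.
have [u Lu su] := perm_lang_take B_gt2 n.
exists (map (pair (Ordinal m_gt0)) u); last by rewrite size_map.
by exists (Ordinal m_gt0), u.
Qed.

Lemma tag_lang_count n :
  (size (lang_words (@gap_lang D) n) <= m * size (lang_words (@perm_lang B) n))%N.
Proof.
pose cov := [seq map (pair i) v | i <- enum 'I_m, v <- lang_words (@perm_lang B) n].
have -> : (m * size (lang_words (@perm_lang B) n) = size cov)%N.
  by rewrite size_allpairs size_enum_ord.
apply: uniq_leq_size; first exact: lang_words_uniq.
move=> w; rewrite mem_lang_words => /andP[/asboolP[i [v [Lv ->]]]]; rewrite size_map => sv.
apply/allpairsP; exists (i, v); split => //=; first by rewrite mem_enum.
by rewrite mem_lang_words sv andbT; apply/asboolP.
Qed.

Lemma gap_words_lb N : exists2 n, (N < n)%N &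
  expR (@lang_entropy R B * n%:R) <= (size (lang_words (@gap_word R D) n))%:R.
Proof.
exists (@block_len B N); first exact: block_len_gtn.
apply: (@le_trans _ _ (size (blocks N : seq (seq B)))%:R).
  rewrite -[leRHS]lnK ?posrE ?ltr0n ?(size_blocks_gt0 B_gt2)// ler_expR.
  rewrite -ler_pdivlMr ?(block_len_gt0R B_gt2)//; exact: lang_entropy_le.
rewrite ler_nat -(size_map (fun w : seq B => map Some (map (pair (Ordinal m_gt0)) w))).
apply: uniq_leq_size.
  rewrite map_inj_uniq ?blocks_uniq//.
  by move=> w w' /(inj_map (@Some_inj _)) /inj_map; apply => a b [].
move=> _ /mapP[w hw ->].
have Lw : @gap_lang D (map (pair (Ordinal m_gt0)) w).
  by exists (Ordinal m_gt0), w; split => //; exact: perm_lang_block hw.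
suff -> : [seq Some x | x <- map (pair (Ordinal m_gt0)) w] =
    mkseq (@run R D 0 _ Lw : X) (@block_len B N) by exact: mem_gap_words.
rewrite -(size_block B_gt2 hw).
apply: (@eq_from_nth _ None); rewrite ?size_mkseq ?size_map// => k kn.
by rewrite nth_mkseq// /= /run_seq subn0.
Qed.

Definition tag_word (i : 'I_m) (u : seq B) : seq (option (gap_letter D)) := [seq Some (i, b) | b <- u].

Lemma tag_word_inj i : injective (tag_word i).
Proof. by apply: inj_map => a b []. Qed.

Lemma size_tag_word i u : size (tag_word i u) = size u.
Proof. exact: size_map. Qed.

Definition tagged (i : 'I_m) : set X := [set x | forall n, exists b, x n = Some (i, b)].

Lemma tagged_prefix i (x : X) n : tagged i x ->
  exists v, [/\ perm_lang v, size v = n & mkseq x n = tag_word i v].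
Proof.
move=> xi; have [k|w [sw [i' [v [Lv we]]] e]] := @stretch_word R D x 0 n.
  by move=> _; have [b ->] := xi (0 + k)%N.
exists v; split => //; first by rewrite -sw we size_map.
rewrite [mkseq x n]e we /tag_word -map_comp.
case: v Lv we => // b v _ we; suff -> : i = i' by [].
have := congr1 (fun s => nth None s 0) e; rewrite we/= nth_mkseq; last first.
  by rewrite -sw we.
by have [b' ->] := xi 0%N; case.
Qed.

Lemma tagged_shift i k (x : X) : tagged i x -> tagged i (iter k shift x).
Proof. by move=> xi n; rewrite iter_shift; exact: xi. Qed.

Lemma measurable_tagged i : measurable (tagged i : set T).
Proof.
rewrite (_ : tagged i = \bigcap_n [set x : X | exists b, x n = Some (i, b)]).
  apply: bigcapT_measurable => n; apply: (@measurable_determined R D n.+1).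
  by move=> x y /mkseq_eqP e [b xb]; exists b; rewrite -e.
by apply/seteqP; split => x h n; [move=> _; exact: h|exact: (h n I)].
Qed.

Definition visits i u n (x : X) : nat :=
  (\sum_(k < n) (mkseq (iter k shift x) (size u) == tag_word i u))%N.

(** The constant is the same for all points of the copy; this uniformity is what forces the
    invariant measure on it to be unique. *)
Lemma tagged_frequency i u (e : R) : 0 < e -> exists C : R, forall x n, tagged i x ->
  `|(visits i u n x)%:R - n%:R * c u| <= n%:R * e + C.
Proof.
move=> e0; have [k hk] := block_len_unbounded B_gt2 (2 * (size u)%:R) e0.
have [C hC] := @occ_word_freq R B B_gt2 u k.
exists (`|C| + (size u)%:R * (1 + e + c u)) => x n xi.
have [v [Lv sv xv]] := tagged_prefix (n + size u) xi.
have vE : visits i u n x = (\sum_(k < n) prefix u (drop k v))%N.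
  apply: eq_bigr => j _; congr (nat_of_bool _); rewrite prefixE -(inj_eq (@tag_word_inj i)).
  congr (_ == _); rewrite /tag_word map_take map_drop -/(tag_word i v) -xv.
  rewrite -mkseq_shift; apply: (@eq_from_nth _ None).
    by rewrite size_mkseq size_takel// size_drop size_mkseq leq_subRL ?leq_add2r ltnW// ltn_addr.
  move=> l; rewrite size_mkseq => lu; rewrite nth_mkseq// nth_take// nth_drop nth_mkseq//.
  by have := ltn_ord j; lia.
have /andP[h1 h2] := occ_sum_le sv; rewrite -vE in h1 h2.
have := hC v Lv; set d := 2 * _ / _ in hk * => h3.
rewrite -(ler_nat R) in h1; rewrite -(ler_nat R) natrD in h2.
have svR : (size v)%:R = n%:R + (size u)%:R :> R by rewrite sv natrD.
have c0 : 0 <= c u := word_freq_ge0 B_gt2 u.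
have h4 : (size v)%:R * d <= n%:R * e + (size u)%:R * e.
  by rewrite svR -mulrDl ler_wpM2l// addr_ge0.
have h5 := ler_norm C.
have s1 : 0 <= (size u)%:R * c u by rewrite mulr_ge0.
move: h3; rewrite svR mulrDl ler_norml => /andP[h6 h7].
rewrite -svR in h6 h7.
by rewrite ler_norml; apply/andP; split; move: h1 h2 h4 h5 h6 h7; rewrite !mulrDr mulr1; lra.
Qed.

Section invariant.
Variable mu : probability T R.
Hypothesis invf : forall A : set T, measurable A -> mu (f @^-1` A) = mu A.
Variable i : 'I_m.
Hypothesis mui : mu (tagged i) = 1%E.

Lemma tagged_nonempty (A : set T) : measurable A -> 0 < fine (mu A) ->
  exists2 x, A x & tagged i x.
Proof.
move=> mA A0; apply: contrapT => h.
have sub : A `<=` ~` (tagged i : set T) by move=> x Ax xi; apply: h; exists x.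
have := fine_le_measure mu mA (measurableC (measurable_tagged i)) sub.
by rewrite probability_setC ?mui ?subee//= ?leNgt ?A0//; exact: measurable_tagged.
Qed.

(* By invariance the left-hand side is the mean over [A] of the frequency of visits
   to the cylinder, which is uniformly close to [c u]. *)
Lemma invariant_cylinder (A : set T) u : measurable A -> f @^-1` A = A ->
  fine (mu (A `&` @cylinder R D (tag_word i u))) = fine (mu A) * c u.
Proof.
move=> mA fA; apply: eq_of_norm_le => e e0; have e2 : 0 < e / 2 by rewrite divr_gt0.
have [C hC] := @tagged_frequency i u _ e2.
pose n := (Num.truncn (C / (e / 2))).+1.
have nC : C <= n%:R * (e / 2).
  by rewrite -ler_pdivrMr// ltW// Num.Theory.truncnS_gt.
have n0 : 0 < n%:R :> R by [].
pose N := (n + size u)%N.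
pose Y := itinerary f (@first_symbol R D) N.
pose Z (x : T) := (`[< A x >], Y x).
have mZ : measurable_fibers Z.
  apply: measurable_fibers_pair; last first.
    by apply: measurable_itinerary; [exact: measurable_shift|exact: measurable_first_symbol].
  move=> [|].
    rewrite (_ : _ @^-1` _ = A)//.
    by apply/seteqP; split => x /=; [move/asboolP|move=> Ax; apply/asboolP].
  rewrite (_ : _ @^-1` _ = ~` A); first exact: measurableC.
  by apply/seteqP; split => x /=; [move/asboolP|move=> Ax; apply/asboolP].
pose wd (v : {ffun 'I_N -> option (gap_letter D)}) := [seq v t | t <- enum 'I_N].
have wdY x : wd (Y x) = mkseq (x : X) N by exact: codom_itinerary.
pose hit (k : 'I_n) v := take (size u) (drop k (wd v)) == tag_word i u.
have hitE (k : 'I_n) x : hit k (Y x) = (mkseq (iter k shift (x : X)) (size u) == tag_word i u).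
  rewrite /hit wdY; congr (_ == _); apply: (@eq_from_nth _ None).
    by rewrite size_mkseq size_takel// size_drop size_mkseq leq_subRL ?leq_add2r ltnW// ltn_addr.
  move=> l; rewrite size_take_min size_drop size_mkseq leq_min => /andP[lu _].
  rewrite nth_mkseq// nth_take// nth_drop nth_mkseq ?iter_shift//.
  by have := ltn_ord k; rewrite /N; lia.
have mC : measurable (@cylinder R D (tag_word i u) : set T) by exact: measurable_cylinder.
have hA k : iter k f @^-1` A = A.
  by elim: k => // k IH; rewrite iter_preimageS fA.
have hk (k : 'I_n) : fine (mu (A `&` @cylinder R D (tag_word i u))) =
    \sum_(w | w.1 && hit k w.2) law mu Z w.
  rewrite law_sum//; congr fine.
  rewrite -(measure_iter_preimage (@measurable_shift R D) invf k (measurableI _ _ mA mC)).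
  congr (mu _); rewrite preimage_setI hA; apply/seteqP; split => x /=.
    move=> [Ax xc]; rewrite hitE; apply/andP; split; first exact/asboolP.
    by apply/eqP; rewrite -[RHS]xc size_tag_word.
  rewrite hitE => /andP[/asboolP Ax /eqP xc]; split => //.
  by rewrite /cylinder /= size_tag_word.
have hsum : n%:R * fine (mu (A `&` @cylinder R D (tag_word i u))) =
    \sum_w law mu Z w * (w.1%:R * (\sum_(k < n) hit k w.2)%:R).
  have -> : n%:R * fine (mu (A `&` @cylinder R D (tag_word i u))) =
      \sum_(k < n) fine (mu (A `&` @cylinder R D (tag_word i u))).
    by rewrite sumr_const card_ord mulr_natl.
  rewrite (eq_bigr _ (fun k _ => hk k)); under eq_bigr do rewrite big_mkcond/=.
  rewrite exchange_big/=; apply: eq_bigr => w _.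
  rewrite natr_sum mulr_sumr mulr_sumr; apply: eq_bigr => k _.
  by case: w.1; case: (hit k w.2); rewrite /= ?mulr1 ?mulr0 ?mul0r.
have hmuA : fine (mu A) = \sum_w law mu Z w * w.1%:R.
  rewrite (eq_bigr (fun w => if w.1 then law mu Z w else 0)); last first.
    by move=> w _; case: w.1; rewrite ?mulr1 ?mulr0.
  rewrite -big_mkcond law_sum//; congr (fine (mu _)).
  by apply/seteqP; split => x /=; [move=> Ax; apply/asboolP|move/asboolP].
have hdiff : `|n%:R * fine (mu (A `&` @cylinder R D (tag_word i u))) -
    n%:R * (fine (mu A) * c u)| <= n%:R * (e / 2) + C.
  rewrite hsum hmuA mulr_suml mulr_sumr -sumrB.
  apply: (le_trans (ler_norm_sum _ _ _)).
  have -> : n%:R * (e / 2) + C = \sum_w law mu Z w * (n%:R * (e / 2) + C).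
    by rewrite -mulr_suml law_sum1// mul1r.
  apply: ler_sum => w _.
  have [->|w0] := eqVneq (law mu Z w) 0; first by rewrite !mul0r mulr0 subrr normr0.
  have {}w0 : 0 < law mu Z w by rewrite lt_neqAle eq_sym w0 law_ge0.
  have [x xw xi] := tagged_nonempty (mZ w) w0.
  have := hC x n xi.
  have -> : visits i u n x = (\sum_(k < n) hit k w.2)%N.
    by apply: eq_bigr => k _; rewrite -xw hitE.
  move=> h; have -> : law mu Z w * (w.1%:R * (\sum_(k < n) hit k w.2)%:R) -
     n%:R * (law mu Z w * w.1%:R * c u) =
     law mu Z w * (w.1%:R * ((\sum_(k < n) hit k w.2)%:R - n%:R * c u)) by ring.
  rewrite normrM (ger0_norm (ltW w0)) ler_pM2l//.
  case: w.1 => /=; first by rewrite mul1r.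
  by rewrite mul0r normr0 (le_trans _ h).
rewrite -(ler_pM2l n0) -[n%:R in X in X <= _]ger0_norm// -normrM mulrBr.
apply: (le_trans hdiff); move: nC; lra.
Qed.

End invariant.
End tagged_language.

Section image_probability.
Context {R : realType} {X : pmetricType R} d (T1 : measurableType d).
Local Notation T := (borel X).
Variables (mu : {measure set T1 -> \bar R}) (D : set T1) (phi : T1 -> T).
Hypothesis muD : mu D = 1%E.
Hypothesis mphi : forall A : set T, measurable A -> measurable (D `&` phi @^-1` A).

(* The value [0] off the Borel sets is the one prescribed by [borel_measures]. *)
Definition image_measure (A : set T) : \bar R :=
  if `[< measurable A >] then mu (D `&` phi @^-1` A) else 0%E.

Lemma image_measureE A : measurable A -> image_measure A = mu (D `&` phi @^-1` A).
Proof. by rewrite /image_measure => mA; case: asboolP. Qed.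

Lemma image_measure0 : image_measure set0 = 0%E.
Proof. by rewrite image_measureE ?preimage_set0 ?setI0 ?measure0. Qed.

Lemma image_measure_ge0 A : (0 <= image_measure A)%E.
Proof. by rewrite /image_measure; case: ifP => // _; exact: measure_ge0. Qed.

Lemma image_measure_sigma_additive : semi_sigma_additive image_measure.
Proof.
move=> F mF tF mUF; rewrite image_measureE// preimage_bigcup setI_bigcupr.
rewrite (_ : (fun n => _) = (fun n => \sum_(0 <= i < n) mu (D `&` phi @^-1` F i))%E); last first.
  by apply/funext => n; apply: eq_bigr => i _; rewrite image_measureE.
apply: measure_semi_sigma_additive => [i||]; first exact: mphi.
  apply/trivIsetP => /= i j _ _ ij; rewrite setIACA setIid -preimage_setI.
  by move/trivIsetP : tF => /(_ _ _ _ _ ij) ->//; rewrite preimage_set0 setI0.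
by apply: bigcupT_measurable => i; exact: mphi.
Qed.

HB.instance Definition _ := isMeasure.Build _ T R image_measure
  image_measure0 image_measure_ge0 image_measure_sigma_additive.

Lemma image_measure_setT : image_measure setT = 1%E.
Proof. by rewrite image_measureE// preimage_setT setIT. Qed.

HB.instance Definition _ := Measure_isProbability.Build _ T R image_measure image_measure_setT.

(** Serves twice: for the coding of the unit interval, where [phi] is controlled on [D] only, and
    for the image of a measure under the shift, with [D] the whole space. *)
Lemma image_probability : exists2 P : probability T R, borel_measures P &
  forall A, measurable A -> P A = mu (D `&` phi @^-1` A).
Proof.
exists [the probability T R of image_measure].
  by move=> A nA /=; rewrite /image_measure; case: asboolP.
by move=> A mA /=; rewrite image_measureE.
Qed.

End image_probability.

(* The words of length [n] cut the unit interval into intervals [slot u] of length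
   [c u], in lexicographic order. *)
Section interval_coding.
Context {R : realType} {B : finType}.
Variable c : seq B -> R.
Hypotheses (c_ge0 : forall u, 0 <= c u) (c_nil : c [::] = 1).
Hypothesis c_rcons : forall u, c u = \sum_(a : B) c (rcons u a).

Definition cum u k : R := \sum_(b <- take k (enum B)) c (rcons u b).

(** Recursion on the reversed word: the slot of [rcons u a] starts where that of [u] does, shifted
    by the lengths of the slots of the earlier siblings. *)
Fixpoint rlow v : R := if v is a :: v' then rlow v' + cum (rev v') (index a (enum B)) else 0.

Definition low u : R := rlow (rev u).

Lemma low_rcons u a : low (rcons u a) = low u + cum u (index a (enum B)).
Proof. by rewrite /low rev_rcons /= revK. Qed.

Definition slot u : set R := [set` `[low u, low u + c u[%R].

Lemma slotE u t : slot u t = (low u <= t < low u + c u) :> Prop.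
Proof. by rewrite /slot /= in_itv. Qed.

Lemma cum_size u : cum u (size (enum B)) = c u.
Proof. by rewrite /cum take_size c_rcons big_enum. Qed.

Lemma cum_letter u a : cum u (index a (enum B)).+1 = cum u (index a (enum B)) + c (rcons u a).
Proof.
have ha : (index a (enum B) < size (enum B))%N by rewrite index_mem mem_enum.
by rewrite /cum (take_nth a)// big_rcons/= nth_index ?mem_enum// addrC.
Qed.

Lemma cum_le u i j : (i <= j)%N -> cum u i <= cum u j.
Proof.
move=> ij; rewrite /cum -(cat_take_drop i (take j _)) take_takel// big_cat/= lerDl.
by apply: sumr_ge0 => b _; exact: c_ge0.
Qed.

Lemma slot_nil : slot [::] = [set` `[0, 1[%R].
Proof. by rewrite /slot /low /= c_nil add0r. Qed.

Lemma slot_child u t : slot u t -> exists a, slot (rcons u a) t.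
Proof.
rewrite slotE => /andP[t0 t1].
have ex : exists k, t < low u + cum u k by exists (size (enum B)); rewrite cum_size.
pose k := ex_minn ex; have : t < low u + cum u k by rewrite /k; case: ex_minnP.
have kmin j : t < low u + cum u j -> (k <= j)%N.
  by rewrite /k; case: ex_minnP => i _; exact.
case: k kmin => [|k] kmin; first by rewrite /cum take0 big_nil addr0 ltNge t0.
have kB : (k < size (enum B))%N by apply: kmin; rewrite cum_size.
case E : (enum B) kB => [//|b0 s0]; rewrite -E => kB.
pose a := nth b0 (enum B) k; have ka : index a (enum B) = k by rewrite index_uniq ?enum_uniq.
rewrite -ka cum_letter => h; exists a; rewrite slotE low_rcons ka -addrA -[X in cum u X]ka.
rewrite ka in h *; rewrite h andbT leNgt; apply/negP => /kmin; lia.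
Qed.

Lemma slot_rcons_sub u a : slot (rcons u a) `<=` slot u.
Proof.
move=> t; rewrite !slotE low_rcons -addrA -cum_letter => /andP[h1 h2]; apply/andP; split.
  apply: le_trans h1; rewrite lerDl; apply: sumr_ge0 => b _; exact: c_ge0.
apply: (lt_le_trans h2); rewrite lerD2l -cum_size; apply: cum_le.
by rewrite index_mem mem_enum.
Qed.

Lemma slot_rcons_inj u a b t : slot (rcons u a) t -> slot (rcons u b) t -> a = b.
Proof.
wlog : a b / (index a (enum B) <= index b (enum B))%N.
  move=> H ha hb; case: (leqP (index a (enum B)) (index b (enum B))) => ab; first exact: H.
  by apply/esym; apply: H => //; exact: ltnW.
rewrite leq_eqVlt => /orP[/eqP e _ _|ab].
  by rewrite -[a](nth_index a (s := enum B)) ?mem_enum// e nth_index ?mem_enum.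
rewrite !slotE !low_rcons -!addrA -!cum_letter => /andP[_ h1] /andP[h2 _].
have := cum_le u ab; have := le_lt_trans h2 h1.
by rewrite ltrD2l => h; rewrite leNgt h.
Qed.

Lemma slot_take u k t : slot u t -> slot (take k u) t.
Proof.
elim/last_ind: u => // u a IH h; have [ku|uk] := leqP k (size u).
  by rewrite -cats1 take_cat; move: IH => /(_ (slot_rcons_sub h)); case: ltngtP ku => // ->;
    rewrite subnn take0 cats0 take_size.
by rewrite take_oversize// size_rcons.
Qed.

Lemma slot_inj u v t : size u = size v -> slot u t -> slot v t -> u = v.
Proof.
elim/last_ind: u v => [|u a IH] v; first by move/esym/size0nil ->.
elim/last_ind: v => [|v b _]; rewrite !size_rcons// => -[uv] hu hv.
have e := IH _ uv (slot_rcons_sub hu) (slot_rcons_sub hv).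
by rewrite -e in hv *; rewrite (slot_rcons_inj hu hv).
Qed.

Lemma slot_exists n t : 0 <= t < 1 -> exists2 u, size u = n & slot u t.
Proof.
move=> t01; elim: n => [|n [u su hu]]; first by exists [::]; rewrite ?slot_nil//= in_itv.
by have [a ha] := slot_child hu; exists (rcons u a); rewrite ?size_rcons ?su.
Qed.

Lemma interval_coding : exists letter : R -> nat -> B, forall t u, 0 <= t < 1 ->
  (mkseq (letter t) (size u) = u <-> slot u t).
Proof.
have [b0] : exists b : B, True.
  apply: contrapT => /forallNP h; have := c_rcons [::].
  by rewrite c_nil big1 => [/eqP|a _]; [rewrite oner_eq0|case: (h a)].
have /choice[code hcode] : forall p : R * nat, exists u, 0 <= p.1 < 1 ->
    size u = p.2 /\ slot u p.1.
  move=> [t n]; have [h|h] := boolP (0 <= t < 1); last by exists [::].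
  by have [u su hu] := slot_exists n h; exists u.
(* The letter of index [n] is read off the word of length [n.+1] whose slot contains [t]; since
   slots are nested, longer words agree with it. *)
exists (fun t n => nth b0 (code (t, n.+1)) n) => t u t01.
have main n : mkseq (fun k => nth b0 (code (t, k.+1)) k) n = code (t, n).
  have [sn hn] := hcode (t, n) t01.
  apply: (@eq_from_nth _ b0); rewrite size_mkseq ?sn// => k kn; rewrite nth_mkseq//.
  have [sk hk] := hcode (t, k.+1) t01.
  rewrite -(@slot_inj (take k.+1 (code (t, n))) _ t _ (slot_take _ hn) hk).
    by rewrite nth_take.
  by rewrite sk size_takel// sn.
rewrite main; have [su hu] := hcode (t, size u) t01; split=> [<-//|h].
exact: slot_inj hu h.
Qed.

Lemma slot_measure u : lebesgue_measure (slot u) = (c u)%:E.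
Proof.
rewrite lebesgue_measure_itv/= lte_fin ltrDl; case: ltP => h.
  by rewrite -EFinB addrC addKr.
by congr (_%:E); apply/eqP; rewrite eq_le c_ge0 h.
Qed.

Lemma measurable_slot u : measurable (slot u : set (measurableTypeR R)).
Proof. exact: measurable_itv. Qed.

End interval_coding.

(** * The measure of a copy: construction and uniqueness *)

Section tagged_measures.
Context {R : realType} {B : finType}.
Variables (m : nat) (g : nat -> nat).
Hypotheses (B_gt2 : (2 < #|B|)%N) (m_gt0 : (0 < m)%N).
Hypotheses (g_mono : {homo g : i j / (i <= j)%N}) (g_gt0 : forall n, (0 < g n)%N).

Local Notation D := (tagged_data B_gt2 m_gt0 g_mono g_gt0).
Local Notation X := (gap_shift R D).
Local Notation T := (borel (@gap_pmetric R D)).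
Local Notation f := (@shift R D : gap_pmetric -> gap_pmetric).
Local Notation c := (@word_freq R B).
Local Notation tag_word := (@tag_word B m g B_gt2 m_gt0 g_mono g_gt0).
Local Notation tagged := (@tagged R B m g B_gt2 m_gt0 g_mono g_gt0).
Local Notation cylinder := (@cylinder R D).

(** A half-open slot containing a point has positive length, so all prefixes of a coded sequence
    have positive frequency and belong to the language; this makes the sequence admissible. *)
Lemma tagged_coding i : exists phi : R -> X, forall t, 0 <= t < 1 ->
  tagged i (phi t) /\ forall u, cylinder (tag_word i u) (phi t) <-> slot c u t.
Proof.
have [letter hl] := interval_coding (word_freq_ge0 (R := R) B_gt2) (word_freq_nil B_gt2)
  (word_freq_rcons B_gt2).
have adm t : 0 <= t < 1 -> @admissible D (fun n => Some (i, letter t n)).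
  move=> t01; split=> // j v hv.
  have ve : v = map (pair i) (mkseq (fun k => letter t (j + k)%N) (size v)).
    apply: (@inj_map _ _ Some); first by move=> ? ? [].
    by rewrite -hv -!map_comp.
  exists i, (mkseq (fun k => letter t (j + k)%N) (size v)); split => //.
  apply: (@perm_lang_infix _ _ (mkseq (letter t) (j + size v))).
    rewrite mkseq_cat; exact: suffixW (suffix_suffix _ _).
  apply: (@word_freq_gt0_lang R).
  have /(hl t _ t01).1 : mkseq (letter t) (size (mkseq (letter t) (j + size v))) =
      mkseq (letter t) (j + size v) by rewrite size_mkseq.
  by rewrite slotE => /andP[h1 h2]; rewrite -(ltrD2l (low c (mkseq (letter t) (j + size v)))) addr0;
    exact: le_lt_trans h2.
have /choice[phi hphi] : forall t, exists x : X, 0 <= t < 1 -> forall n, x n = Some (i, letter t n).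
  move=> t; have [h|h] := boolP (0 <= t < 1); last by exists point.
  by exists (GapShift R (adm t h)).
exists phi => t t01; split; first by move=> n; exists (letter t n); rewrite hphi.
move=> u; rewrite -(hl t u t01) /cylinder /= size_tag_word.
have -> : mkseq (phi t) (size u) = tag_word i (mkseq (letter t) (size u)).
  by rewrite /tag_word -map_comp; apply: eq_map => k; exact: hphi.
by split => [/tag_word_inj|->].
Qed.

Lemma tagged_cylinder i w (x : X) : tagged i x -> cylinder w x ->
  exists u, w = tag_word i u.
Proof.
by move=> xi xw; have [v [_ _ e]] := tagged_prefix (size w) xi; exists v; rewrite -e xw.
Qed.

Lemma cylinder_null (P : probability T R) i w : P (tagged i) = 1%E ->
  (forall u, w <> tag_word i u) -> P (cylinder w) = 0%E.
Proof.
move=> Pi wi; apply/eqP; rewrite eq_le measure_ge0 andbT.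
have mi : measurable (tagged i : set T) by exact: measurable_tagged.
have <- : P (~` (tagged i : set T)) = 0%E by rewrite probability_setC ?Pi ?subee.
apply: le_measure; rewrite ?inE; [exact: measurable_cylinder|exact: measurableC|].
by move=> x xw xi; have [u /wi] := tagged_cylinder xi xw.
Qed.

Lemma tagged_measure_unique (P Q : probability T R) i :
  borel_measures P -> borel_measures Q -> P (tagged i) = 1%E -> Q (tagged i) = 1%E ->
  (forall u, P (cylinder (tag_word i u)) = Q (cylinder (tag_word i u))) -> P = Q.
Proof.
move=> bP bQ Pi Qi PQ; apply: probability_ext => A.
have [mA|nA] := pselect (measurable A); last by rewrite bP// bQ.
apply: cylinder_measure_unique => //; last by rewrite [X in (X < _)%E]probability_setT ltry.
move=> w; have [[u ->]|wi] := pselect (exists u, w = tag_word i u); first exact: PQ.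
have {}wi u : w <> tag_word i u by move=> uw; apply: wi; exists u.
by rewrite [LHS](@cylinder_null P i)// [RHS](@cylinder_null Q i).
Qed.

(** The image of Lebesgue measure on [[0, 1[] under the coding: the preimage of a cylinder of the
    copy is a slot, whose length is the frequency of the word. *)
Lemma tagged_measure_exists i : exists P : probability T R,
  [/\ borel_measures P, P (tagged i) = 1%E &
      forall u, P (cylinder (tag_word i u)) = (c u)%:E].
Proof.
have [phi hphi] := tagged_coding i.
pose I01 : set (measurableTypeR R) := [set` `[0 : R, 1[%R].
have mI : measurable I01 by exact: measurable_itv.
have I01E t : I01 t -> 0 <= t < 1 by rewrite /I01 /= in_itv.
have mcyl w : measurable (I01 `&` phi @^-1` cylinder w).
  have [[u ->]|wi] := pselect (exists u, w = tag_word i u).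
    rewrite (_ : _ `&` _ = I01 `&` slot c u).
      by apply: measurableI => //; exact: measurable_slot.
    by apply/seteqP; split => t [/[dup] /I01E t01 h] /(hphi t t01).2 h'; split.
  rewrite (_ : _ `&` _ = set0); first exact: measurable0.
  apply/seteqP; split => // t [/I01E t01 h]; apply: wi.
  exact: tagged_cylinder (hphi t t01).1 h.
have mphi : forall A : set T, measurable A -> measurable (I01 `&` phi @^-1` A).
  move=> A mA; suff h : measurable_fun I01 (phi : measurableTypeR R -> T) by exact: h.
  apply: (@measurability _ _ (measurableTypeR R) T I01 phi (@open (@gap_pmetric R D)) erefl).
  move=> _ [U oU <-].
  rewrite (open_bigcup_cylinder oU) preimage_bigcup setI_bigcupr bigcup_mkcond.
  apply: countable_bigcupT_measurable; first exact: countableP.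
  by move=> w; case: ifP => _; [exact: mcyl|exact: measurable0].
have muI : lebesgue_measure I01 = 1%E.
  by rewrite lebesgue_measure_itv/= lte_fin ltr01 oppr0 adde0.
have [P bP hP] := image_probability muI mphi.
exists P; split => // [|u].
  rewrite hP; last exact: measurable_tagged.
  rewrite -muI; congr lebesgue_measure; apply/setIidl => t /I01E t01.
  exact: (hphi t t01).1.
rewrite hP; last exact: measurable_cylinder.
rewrite -(slot_measure (word_freq_ge0 B_gt2)); congr lebesgue_measure.
have s01 : slot c u `<=` I01.
  move=> t h; have : slot c (take 0 u) t.
    by apply: slot_take h => //; [exact: word_freq_ge0|exact: word_freq_rcons].
  by rewrite take0 (slot_nil (word_freq_nil B_gt2)).
apply/seteqP; split => [t [/I01E t01]|t h]; first by move/(hphi t t01).2.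
by have /I01E t01 := s01 t h; split; [exact: s01|exact/(hphi t t01).2].
Qed.

End tagged_measures.

Lemma natr_le_expR (R : realType) (e : R) : 0 < e ->
  exists2 C, 0 < C & forall n, n.+1%:R <= C * expR (e * n%:R).
Proof.
move=> e0; exists (e^-1 * expR e) => [|n]; first by rewrite mulr_gt0 ?invr_gt0 ?expR_gt0.
rewrite -mulrA -expRD -{2}[e]mulr1 -mulrDr -[1 + _]/(1 + n%:R) nat1r mulrC ler_pdivlMr//.
by rewrite mulrC; apply: le_trans (expR_ge1Dx _); rewrite lerDr.
Qed.

Section fine_measure_split.
Context {R : realType} {X : pmetricType R}.
Local Notation T := (borel X).
Variable mu : probability T R.

Lemma fine_measure_split (W : finType) (Z : T -> W) (A : set T) : measurable_fibers Z ->
  measurable A -> fine (mu A) = \sum_(w : W) fine (mu (A `&` Z @^-1` [set w])).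
Proof.
move=> mZ mA; pose Z' x := (`[< A x >], Z x).
have mZ' : measurable_fibers Z'.
  apply: measurable_fibers_pair => // -[|].
    rewrite (_ : _ @^-1` _ = A)//.
    by apply/seteqP; split => x /=; [move/asboolP|move=> Ax; apply/asboolP].
  rewrite (_ : _ @^-1` _ = ~` A); first exact: measurableC.
  by apply/seteqP; split => x /=; [move/asboolP|move=> Ax; apply/asboolP].
transitivity (\sum_(w | w.1) law mu Z' w).
  rewrite law_sum//; congr (fine (mu _)).
  by apply/seteqP; split => x /=; [move=> Ax; apply/asboolP|move/asboolP].
rewrite big_mkcond/= (eq_bigr (fun p : bool * W =>
  (fun b w => if b then law mu Z' (b, w) else 0) p.1 p.2)); last by case.
rewrite -(pair_bigA _ (fun b w => if b then law mu Z' (b, w) else 0))/= big_bool/=.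
rewrite [X in _ + X]big1 ?addr0//; apply: eq_bigr => w _; congr (fine (mu _)).
apply/seteqP; split => x /=; first by move=> [/asboolP Ax ->].
by move=> [Ax <-]; congr (_, _); exact/asboolP.
Qed.

End fine_measure_split.

(** * Invariance, ergodicity and entropy of the measure of a copy *)

Section maximal_measures.
Context {R : realType} {B : finType}.
Variables (m : nat) (g : nat -> nat).
Hypotheses (B_gt2 : (2 < #|B|)%N) (m_gt0 : (0 < m)%N).
Hypotheses (g_mono : {homo g : i j / (i <= j)%N}) (g_gt0 : forall n, (0 < g n)%N).

Local Notation D := (tagged_data B_gt2 m_gt0 g_mono g_gt0).
Local Notation X := (gap_shift R D).
Local Notation T := (borel (@gap_pmetric R D)).
Local Notation f := (@shift R D : gap_pmetric -> gap_pmetric).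
Local Notation c := (@word_freq R B).
Local Notation h := (@lang_entropy R B).
Local Notation tag_word := (@tag_word B m g B_gt2 m_gt0 g_mono g_gt0).
Local Notation tagged := (@tagged R B m g B_gt2 m_gt0 g_mono g_gt0).
Local Notation cylinder := (@cylinder R D).
Local Notation L n := (lang_words (@gap_word R D) n).

Section tagged_probability.
Variables (nu : probability T R) (i : 'I_m).
Hypotheses (nu_borel : borel_measures nu) (nu_tagged : nu (tagged i) = 1%E).
Hypothesis nu_cyl : forall u, nu (cylinder (tag_word i u)) = (c u)%:E.

(** The preimage splits according to the first symbol, and the pieces are summed by
    [word_freq_cons]. *)
Lemma tagged_preimage_cylinder u : nu (f @^-1` cylinder (tag_word i u)) = (c u)%:E.
Proof.
have mA : measurable (f @^-1` cylinder (tag_word i u) : set T).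
  by apply: measurable_shift; exact: measurable_cylinder.
rewrite -[LHS]fineK ?fin_num_measure//; congr (_%:E).
rewrite (fine_measure_split nu (@measurable_first_symbol R D) mA).
have E s : f @^-1` cylinder (tag_word i u) `&` @first_symbol R D @^-1` [set s] =
    cylinder (s :: tag_word i u) :> set T.
  apply/seteqP; split => x; rewrite /cylinder /= -add1n mkseq_cat /=.
    by move=> [e <-]; rewrite -[X in _ :: X = _]/(mkseq (shift x) _) e.
  by move=> [<- e]; split.
under eq_bigr do rewrite E.
pose S : {set option (gap_letter D)} := [set Some (i, b) | b : B].
rewrite -(big_rmcond (mem S)) => [|s /imsetP sS]; last first.
  rewrite (cylinder_null nu_tagged)// => -[//|b v] [sb _].
  by apply: sS; exists b.
rewrite big_imset/=; last by move=> b b' _ _ [].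
rewrite (word_freq_cons B_gt2); apply: eq_bigr => b _.
by rewrite -[_ :: _]/(tag_word i (b :: u)) nu_cyl.
Qed.

(** The image of [nu] under the shift has the same mass on the copy and on its cylinders, hence
    equals [nu] by uniqueness. *)
Lemma tagged_invariant (A : set T) : measurable A -> nu (f @^-1` A) = nu A.
Proof.
have mf (C : set T) : measurable C -> measurable (setT `&` f @^-1` C : set T).
  by move=> mC; rewrite setTI; exact: measurable_shift.
have [P bP hP] := image_probability (probability_setT nu) mf.
suff e : P = nu by move=> mA; rewrite -[in RHS]e hP// setTI.
have mi : measurable (tagged i : set T) by exact: measurable_tagged.
apply: (tagged_measure_unique (i := i)) => // [|u]; last first.
  rewrite hP; last exact: measurable_cylinder.
  by rewrite setTI [LHS]tagged_preimage_cylinder nu_cyl.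
rewrite hP// setTI; apply/eqP; rewrite eq_le probability_le1/=; last exact: measurable_shift.
rewrite -nu_tagged; apply: le_measure; rewrite ?inE//; first exact: measurable_shift.
by move=> x; exact: (@tagged_shift _ _ _ _ _ _ _ _ i 1).
Qed.

(** For an invariant [A], [invariant_cylinder] says that [nu] restricted to [A] and [nu A] times
    [nu] agree on cylinders, hence on all Borel sets; evaluated at [A] itself, this gives
    [nu A = nu A ^ 2]. *)
Lemma tagged_ergodic : ergodic_measures f nu.
Proof.
split => // [A|A mA fA]; first exact: tagged_invariant.
pose r : {nonneg R} := NngNum (fine_ge0 (measure_ge0 nu A)).
have e w : mrestr nu mA (cylinder w) = mscale r nu (cylinder w).
  rewrite /mrestr /mscale/=.
  have [[u ->]|wi] := pselect (exists u, w = tag_word i u).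
    rewrite nu_cyl setIC -[LHS]fineK ?fin_num_measure//; last first.
      by apply: measurableI => //; exact: measurable_cylinder.
    by rewrite (invariant_cylinder tagged_invariant nu_tagged).
  have w0 : nu (cylinder w) = 0%E.
    by apply: (cylinder_null nu_tagged) => u uw; apply: wi; exists u.
  rewrite w0 mule0; apply/eqP; rewrite eq_le measure_ge0 andbT -w0.
  by apply: le_measure; rewrite ?inE//; [apply: measurableI => //|]; exact: measurable_cylinder.
have fin : (mrestr nu mA setT < +oo)%E.
  by rewrite /mrestr setTI ltey_eq fin_num_measure.
have := cylinder_measure_unique e fin mA; rewrite /= /mrestr /mscale/= setIid.
have [t nt] : exists t, nu A = t%:E.
  by exists (fine (nu A)); rewrite fineK// fin_num_measure.
rewrite nt/= => /eqP; rewrite -EFinM eqe -{1}[t]mulr1 -subr_eq0 -mulrBr mulf_eq0.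
by rewrite subr_eq0 => /orP[/eqP ->|/eqP <-]; [left|right].
Qed.

(** The words of the copy contribute exactly [word_entropy n], and every other term of the entropy
    is non-negative. *)
Lemma tagged_law_entropy_ge n :
  n%:R * h <= law_entropy nu (itinerary f (@first_symbol R D) n).
Proof.
apply: (le_trans (word_entropy_ge B_gt2 n)).
pose F (w : seq (option (gap_letter D))) : R :=
  - (fine (nu (cylinder w)) * ln (fine (nu (cylinder w)))).
have F0 w : 0 <= F w.
  rewrite /F oppr_ge0 mulr_ge0_le0 ?fine_ge0// ln_le0// -lee_fin fineK ?fin_num_measure//.
    by apply: probability_le1; exact: measurable_cylinder.
  exact: measurable_cylinder.
have -> : law_entropy nu (itinerary f (@first_symbol R D) n) = \sum_(w <- words n) F w.
  rewrite -big_ffun_words /law_entropy -sumrN; apply: eq_bigr => v _; rewrite /F /law.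
  have -> // : itinerary f (@first_symbol R D) n @^-1` [set v] =
    cylinder [seq v i0 | i0 <- enum 'I_n] :> set T.
  apply/seteqP; split => x; rewrite /cylinder /= size_map size_enum_ord -(@codom_itinerary R D).
    by move=> ->.
  by move=> /eq_in_map e; apply/ffunP => k; apply: e; rewrite mem_enum.
have -> : @word_entropy R B n = \sum_(w <- map (tag_word i) (words n)) F w.
  by rewrite big_map /word_entropy -sumrN; apply: eq_bigr => u _; rewrite /F nu_cyl.
apply: ler_sum_subseq => //; first by rewrite map_inj_uniq ?words_uniq//; exact: tag_word_inj.
by move=> _ /mapP[u + ->]; rewrite !mem_words size_tag_word.
Qed.

Hypothesis h_gt0 : 0 < h.
Hypothesis words_ub : forall e : R, 0 < e -> exists2 C : R, 0 < C &
  forall n, (size (L n))%:R <= C * expR ((h + e) * n%:R).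

Lemma tagged_measure_entropy : measure_entropy f nu = h%:E.
Proof.
have ub e : 0 < e -> exists C, forall n,
    law_entropy nu (itinerary f (@first_symbol R D) n) <= C + (h + e) * n%:R.
  move=> /words_ub[C C0 hC]; exists (ln C) => n; apply: (le_trans (law_entropy_le_count _ _)).
  rewrite -[X in _ + X]expRK -lnM ?posrE ?expR_gt0// ler_ln ?posrE ?mulr_gt0 ?expR_gt0//.
  exact: size_gap_words_gt0.
apply/eqP; rewrite eq_le; apply/andP; split.
  exact: (measure_entropy_le tagged_invariant) (ltW h_gt0) ub.
exact: measure_entropy_ge tagged_law_entropy_ge ub.
Qed.

End tagged_probability.
End maximal_measures.

(** * Measures of maximal entropy *)

Lemma nbhs_integrate_gt (R : realType) (X : pmetricType R) (mu : weak_star X)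
    (phi : continuousType X R) (r : R) : r < integrate mu phi ->
  nbhs mu [set mu' : weak_star X | r < integrate mu' phi].
Proof.
move=> h; suff cv : integrate (mu' : weak_star X) phi @[mu' --> mu] --> integrate mu phi.
  exact: (cvgr_gt _ cv _ h).
have ec : (fun psi : {ptws continuousType X R -> R} => psi phi) @ nbhs (integrate mu) -->
   integrate mu phi.
  have /cvg_sup/(_ phi) c1 : nbhs (integrate mu) --> integrate mu by exact: cvg_id.
  apply: (cvg_trans (cvg_app (fun psi : {ptws continuousType X R -> R} => psi phi) c1)).
  exact: (@initial_continuous _ _ (fun psi : {ptws continuousType X R -> R} => psi phi)).
have := @initial_continuous _ _ (@integrate R X) mu.
move=> ic; exact: (cvg_comp _ _ ic ec).
Qed.

Section symbol_test.
Context {R : realType} {D : gap_data}.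
Local Notation X := (@gap_pmetric R D).
Variable P : pred (option (gap_letter D)).

Definition symbol_test (x : X) : R := (P (x 0%N))%:R.

Lemma symbol_test_continuous : continuous symbol_test.
Proof.
move=> x; suff h : nbhs x [set y | symbol_test y = symbol_test x].
  by apply: cvg_near_cst; [exact: nbhs_filter|exact: h].
by apply/(nbhs_prefixP (R := R)); exists 1%N => y /(_ 0%N isT) e; rewrite /= /symbol_test e.
Qed.

HB.instance Definition _ := isContinuous.Build X R symbol_test symbol_test_continuous.

Definition symbol_test_fun : continuousType X R := symbol_test.

Lemma integrate_symbol_test (mu : probability (borel X) R) :
  integrate mu symbol_test_fun = fine (mu [set x : X | P (x 0%N)]).
Proof.
have mP : measurable ([set x : X | P (x 0%N)] : set (borel X)).
  by apply: (@measurable_determined R D 1) => x y /mkseq_eqP e; rewrite /= e.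
rewrite /integrate /Rintegral; congr fine.
rewrite -[in RHS](setIT [set x : X | P (x 0%N)]) -integral_indic//; apply: eq_integral => x _.
by rewrite indicE /= /symbol_test; congr ((nat_of_bool _)%:R%:E); apply/idP/idP; rewrite inE.
Qed.

End symbol_test.

(** * The two kinds of ergodic measures *)

Section entropy_dichotomy.
Context {R : realType} {B : finType}.
Variables (m : nat) (g : nat -> nat).
Hypotheses (B_gt2 : (2 < #|B|)%N) (m_gt0 : (0 < m)%N).
Hypotheses (g_mono : {homo g : i j / (i <= j)%N}) (g_gt0 : forall n, (0 < g n)%N).

Local Notation D := (tagged_data B_gt2 m_gt0 g_mono g_gt0).
Local Notation X := (gap_shift R D).
Local Notation T := (borel (@gap_pmetric R D)).
Local Notation f := (@shift R D : gap_pmetric -> gap_pmetric).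
Local Notation c := (@word_freq R B).
Local Notation h := (@lang_entropy R B).
Local Notation tag_word := (@tag_word B m g B_gt2 m_gt0 g_mono g_gt0).
Local Notation tagged := (@tagged R B m g B_gt2 m_gt0 g_mono g_gt0).
Local Notation cylinder := (@cylinder R D).
Local Notation letters_upto := (@letters_upto R D).
Local Notation L n := (lang_words (@gap_word R D) n).

Lemma no_gap_tagged (x : X) : (forall n, x n != None) -> exists i, tagged i x.
Proof.
move=> hx; have [[i b] x0] : exists p : 'I_m * B, x 0%N = Some p.
  by case: (x 0%N) (hx 0%N) => // p _; exists p.
exists i => n; have [k _|w [sw [j [v [_ we]]] e]] := @stretch_word R D x 0 n.+1; first exact: hx.
have sv : size v = n.+1 by rewrite -sw we size_map.
have E k : (k < n.+1)%N -> x k = Some (j, nth b v k).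
  move=> kn; have := congr1 (fun s => nth None s k) e.
  rewrite nth_mkseq// we => ->.
  by rewrite (nth_map (i, b)) ?size_map ?sv// (nth_map b) ?sv.
by move: (E 0%N isT); rewrite x0 => -[-> _]; exists (nth b v n); rewrite E.
Qed.

(** [tagged i] is only contained in its preimage; the union of its iterated preimages is strictly
    invariant, as ergodicity demands. *)
Definition eventually_tagged i : set T :=
  [set x | exists p, forall n, (p <= n)%N -> exists b, (x : X) n = Some (i, b)].

Lemma eventually_taggedE i : eventually_tagged i = \bigcup_p (iter p f @^-1` tagged i).
Proof.
apply/seteqP; split => [x [p hp]|x [p _ hp]].
  by exists p => // n; rewrite iter_shift; apply: hp; exact: leq_addr.
by exists p => n pn; have := hp (n - p)%N; rewrite iter_shift subnKC.
Qed.

Lemma measurable_preimage_tagged i p : measurable (iter p f @^-1` tagged i : set T).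
Proof.
apply: measurable_iter_preimage; first exact: measurable_shift.
exact: measurable_tagged.
Qed.

Lemma eventually_tagged_shift i : f @^-1` eventually_tagged i = eventually_tagged i.
Proof.
apply/seteqP; split => x [p hp].
  exists p.+1 => n pn; have [b hb] := hp n.-1 ltac:(lia).
  by exists b; rewrite -hb; congr ((x : X) _); lia.
by exists p => n pn; exact: hp n.+1 (leqW pn).
Qed.

Section ergodic.
Variable mu : probability T R.
Hypothesis mu_erg : ergodic_measures f mu.

Let invf (A : set T) : measurable A -> mu (f @^-1` A) = mu A.
Proof. by case: mu_erg => _ + _; exact. Qed.

(** The iterated preimages of [tagged i] increase and all have its mass, so their union, of mass 0
    or 1 by ergodicity, has that mass too. *)
Lemma eventually_tagged_le i : mu (tagged i) <> 1%E -> mu (tagged i) = 0%E.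
Proof.
move=> n1; have mi : measurable (tagged i : set T) by exact: measurable_tagged.
have mE : measurable (eventually_tagged i).
  by rewrite eventually_taggedE; apply: bigcupT_measurable => p; exact: measurable_preimage_tagged.
have sub : tagged i `<=` eventually_tagged i by move=> x xi; exists 0%N => n _; exact: xi.
have [_ _ /(_ _ mE (eventually_tagged_shift i))[E0|E1]] := mu_erg.
  by apply/eqP; rewrite eq_le measure_ge0 andbT -E0; apply: le_measure; rewrite ?inE.
exfalso; apply: n1; apply/eqP; rewrite eq_le probability_le1//=.
rewrite -[mu _]fineK ?fin_num_measure// lee_fin; apply/ler_addgt0Pr => e e0.
have nd p : iter p f @^-1` tagged i `<=` iter p.+1 f @^-1` tagged i.
  by move=> x; exact: (@tagged_shift _ _ _ _ _ _ _ _ i 1).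
have [N] := measure_bigcup_approx mu (measurable_preimage_tagged i) nd e0.
rewrite -eventually_taggedE E1 (measure_iter_preimage (@measurable_shift R D) invf)//.
Qed.

(** These sets decrease to the points without gaps. Such a point lies in a single copy, and all
    copies are null. *)
Lemma letters_upto_cvg0 : (forall i, mu (tagged i) <> 1%E) -> forall e : R, 0 < e ->
  exists N, forall n, (N <= n)%N -> fine (mu (letters_upto n)) <= e.
Proof.
move=> hi e e0; have mi i : measurable (tagged i : set T) by exact: measurable_tagged.
have mL := @measurable_letters_upto R D.
have le n k : (n <= k)%N -> letters_upto k `<=` letters_upto n.
  by move=> nk x hx j jn; apply: hx; exact: leq_trans nk.
have mC n : measurable (~` letters_upto n) by exact: measurableC.
have nd n : ~` letters_upto n `<=` ~` letters_upto n.+1.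
  by apply: subsetC; exact: le.
have [N hN] := measure_bigcup_approx mu mC nd e0.
exists N => n Nn; apply: (@le_trans _ _ (fine (mu (letters_upto N)))).
  by apply: fine_le_measure => //; exact: le.
have mU : measurable (\bigcup_n ~` letters_upto n) by exact: bigcupT_measurable.
have U1 : mu (\bigcup_n ~` letters_upto n) = 1%E.
  have C0 : mu (~` \bigcup_n ~` letters_upto n) = 0%E.
    apply/eqP; rewrite eq_le measure_ge0 andbT.
    pose U : set T := \big[setU/set0]_(i <- enum 'I_m) tagged i.
    have mUi : measurable U by apply: bigsetU_measurable => i _; exact: mi.
    apply: (@le_trans _ _ (mu U)).
      apply: le_measure; rewrite ?inE//; first exact: measurableC.
      move=> x hx; have [|i xi] := @no_gap_tagged x; last first.
        by apply: (@subset_bigsetU_seq R D _ (enum 'I_m) (fun i => tagged i) i) xi; rewrite mem_enum.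
      move=> k; apply/eqP => xk; apply: hx; exists k.+1 => // /(_ k (ltnSn k)).
      by rewrite xk eqxx.
    rewrite -[mu U]fineK ?fin_num_measure// lee_fin.
    apply: (le_trans (fine_bigsetU_le mu _ _)) => //.
    by rewrite big1// => i _; rewrite eventually_tagged_le.
  move: C0; rewrite probability_setC// -[mu _]fineK ?fin_num_measure// -EFinB => -[/eqP].
  by rewrite subr_eq0 => /eqP <-.
move: hN; rewrite U1 probability_setC// fineB ?fin_num_measure//=; lra.
Qed.

End ergodic.

Variables (s kappa K : R) (q : nat).
Hypotheses (kappa_gt0 : 0 < kappa) (K_gt0 : 0 < K) (s_ge0 : 0 <= s) (q_gt0 : (0 < q)%N).
Hypothesis lang_growth : forall r,
  (size (lang_words (@gap_lang D) r))%:R <= K * expR (s * r%:R).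
Hypothesis gap_long : forall n,
  K * \sum_(1 <= r < n.+1) expR (- (kappa * (r + g r)%:R)) <= 1 - expR (- kappa).
Hypothesis g_ge : forall r, (r <= q * g r)%N.
Hypothesis entropy_gap : kappa + s * (q%:R / (1 + q%:R)) < h.

(** In the second case long runs have vanishing mass, so [letters_measure_le] applies; with letter
    mass at most [rho = q / (1 + q)], the weighted bound gives entropy at most
    [kappa + s * rho < h]. *)
Lemma ergodic_dichotomy (mu : probability T R) : ergodic_measures f mu ->
  (exists i, mu (tagged i) = 1%E) \/
  fine (mu (letters_upto 1)) <= q%:R / (1 + q%:R) /\ (measure_entropy f mu < h%:E)%E.
Proof.
move=> mu_erg; have [_ invf _] := mu_erg.
have [|hi] := pselect (exists i, mu (tagged i) = 1%E); [by left|right].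
have a1 : fine (mu (letters_upto 1)) <= q%:R / (1 + q%:R).
  apply: (letters_measure_le invf q_gt0 g_ge); apply: letters_upto_cvg0 => //.
  by move=> i ei; apply: hi; exists i.
split=> //; have := entropy_gap; move: (q%:R / _) a1 => rho a1 gap.
have rho0 : 0 <= rho by apply: le_trans a1; exact: fine_ge0.
apply: (@le_lt_trans _ _ (kappa + s * rho)%:E); last by rewrite lte_fin.
apply: (measure_entropy_le invf); first by rewrite addr_ge0 ?mulr_ge0// ltW.
move=> e /natr_le_expR[C C0 hC].
have A0 : 0 < count_cst kappa K by apply: lt_le_trans (count_cst_ge1 _ _).
exists (ln (count_cst kappa K) + ln C) => n.
apply: (le_trans (law_entropy_le_weighted invf s n)).
have h1 : ln (@weighted_count R D s n) <= ln (count_cst kappa K) + ln C + (kappa + e) * n%:R.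
  have wc := weighted_count_le kappa_gt0 K_gt0 lang_growth gap_long n.
  have w0 := @weighted_count_gt0 R D s n.
  rewrite -[X in _ + X]expRK -!lnM ?posrE ?mulr_gt0 ?expR_gt0// ler_ln ?posrE//; last first.
    by rewrite !mulr_gt0 ?expR_gt0.
  apply: (le_trans wc); rewrite [(kappa + e) * _]mulrDl expRD -!mulrA ler_pM2l// [expR (kappa * _) * _]mulrC.
  by rewrite [X in _ <= X]mulrA ler_wpM2r ?expR_ge0.
have h2 : s * (n%:R * fine (mu (letters_upto 1))) <= s * rho * n%:R.
  by rewrite -mulrA [rho * _]mulrC ler_wpM2l// ler_wpM2l.
apply: (le_trans (lerD h1 h2)); rewrite !mulrDl; lra.
Qed.

Hypothesis h_gt0 : 0 < h.
Hypothesis words_ub : forall e : R, 0 < e -> exists2 C : R, 0 < C &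
  forall n, (size (L n))%:R <= C * expR ((h + e) * n%:R).
Hypothesis htop_h : htop f = h%:E.

Lemma max_entropy_measures_tagged : exists nu : 'I_m -> probability T R,
  [/\ injective nu, max_entropy_measures f = range nu &
      forall i, isolated (ergodic_measures f : set (weak_star (@gap_pmetric R D))) (nu i)].
Proof.
have /choice[nu hnu] : forall i, exists P : probability T R,
  [/\ borel_measures P, P (tagged i) = 1%E &
      forall u, P (cylinder (tag_word i u)) = (c u)%:E].
  exact: tagged_measure_exists.
have nuE i : ergodic_measures f (nu i).
  by have [h1 h2 h3] := hnu i; exact: tagged_ergodic h1 h2 h3.
have nuI (mu : probability T R) i : ergodic_measures f mu -> mu (tagged i) = 1%E -> mu = nu i.
  move=> [b inv _] mui; have [h1 h2 h3] := hnu i; apply: (tagged_measure_unique (i := i)) => // u.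
  rewrite h3 -[LHS]fineK ?fin_num_measure//; last exact: measurable_cylinder.
  have := invariant_cylinder inv mui u (@measurableT _ T) (preimage_setT f).
  by rewrite setTI probability_setT mul1r => ->.
(* The mass of the letters of copy [j] is a continuous test: it is 1 for [nu j] and 0 for the other
   [nu i], which also shows that [nu] is injective. *)
pose tag j (s : option (gap_letter D)) := if s is Some p then p.1 == j else false.
have mtag j : measurable ([set x : X | tag j (x 0%N)] : set T).
  by apply: (@measurable_determined R D 1) => x y /mkseq_eqP e; rewrite /= e.
have nu_tag i j : fine (nu i [set x : X | tag j (x 0%N)]) = (i == j)%:R.
  have [_ h2 _] := hnu i; have mi : measurable (tagged i : set T) by exact: measurable_tagged.
  have [<-|ij] := eqVneq i j.
    rewrite (_ : nu i _ = 1%E)//; apply/eqP; rewrite eq_le probability_le1//= -h2.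
    by apply: le_measure; rewrite ?inE// => x /(_ 0%N)[b xb]; rewrite /= /tag xb eqxx.
  rewrite (_ : nu i _ = 0%E)//; apply/eqP; rewrite eq_le measure_ge0 andbT.
  have <- : nu i (~` (tagged i : set T)) = 0%E by rewrite probability_setC ?h2 ?subee.
  apply: le_measure; rewrite ?inE//; first exact: measurableC.
  by move=> x /= + /(_ 0%N)[b xb]; rewrite /tag xb/= => /eqP ji; rewrite ji eqxx in ij.
exists nu; split.
- move=> i j e; apply/eqP; have := nu_tag i j; rewrite e nu_tag eqxx.
  by case: eqVneq => // _ /eqP; rewrite oner_eq0.
- apply/seteqP; split => [mu [mu_erg mu_h]|_ [i _ <-]]; last first.
    split => //; rewrite htop_h; have [h1 h2 h3] := hnu i.
    exact: (tagged_measure_entropy h1 h2 h3).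
  have [[i mui]|[_]] := ergodic_dichotomy mu_erg; first by exists i => //; rewrite -(nuI mu i).
  by rewrite mu_h htop_h ltxx.
move=> i; split; first by rewrite inE; exact: nuE.
have rho1 : q%:R / (1 + q%:R) < 1 :> R.
  by rewrite ltr_pdivrMr ?mul1r ?ltrDr// ltr_pwDl.
have rho0 : 0 <= q%:R / (1 + q%:R) :> R by rewrite divr_ge0.
move: (q%:R / _) rho0 rho1 ergodic_dichotomy => rho rho0 rho1 dich.
(* The threshold is [rho < 1]: an ergodic measure of the second kind gives all letters together at
   most [rho], and any other [nu j] gives the letters of copy [i] mass 0. *)
exists [set mu : weak_star (@gap_pmetric R D) | rho < integrate mu (symbol_test_fun (tag i))].
  by apply: nbhs_integrate_gt; rewrite integrate_symbol_test nu_tag eqxx.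
apply/seteqP; split => [mu [/= + mu_erg]|_ ->]; last first.
  by split; [rewrite /= integrate_symbol_test nu_tag eqxx|exact: nuE].
rewrite integrate_symbol_test => hrho.
have [[j muj]|[a1 _]] := dich _ mu_erg; last first.
  exfalso; move: hrho; apply/negP; rewrite -leNgt; apply: le_trans a1.
  apply: fine_le_measure => //; first exact: measurable_letters_upto.
  by move=> x /= + k; rewrite ltnS leqn0 => + /eqP ->; case: (x 0%N).
move: hrho; rewrite (nuI _ _ mu_erg muj) nu_tag; case: eqVneq => [->//|_].
by rewrite ltNge rho0.
Qed.

End entropy_dichotomy.

(** * Irregular points *)

(** The approximate mean [l] may depend on [e]; the averages are shown to form a Cauchy sequence,
    without a candidate limit. *)
Lemma cesaro_cvg (R : realType) (S : nat -> R) :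
  (forall e, 0 < e -> exists l C p, forall n, (p <= n)%N ->
     `|S n - n%:R * l| <= n%:R * e + C) ->
  cvgn (fun n => n%:R^-1 * S n).
Proof.
move=> hS; apply: cauchy_cvg; apply: cauchy_exP => e e0.
have e2 : 0 < e / 3 by rewrite divr_gt0.
have [l [C [p hp]]] := hS _ e2; exists l.
exists (maxn p (Num.truncn (C / (e / 3))).+1) => // n /=; rewrite geq_max => /andP[pn Cn].
have n0 : 0 < n%:R :> R by rewrite ltr0n; exact: leq_trans Cn.
have hC : C <= n%:R * (e / 3).
  rewrite -ler_pdivrMr//; apply: (le_trans (ltW (Num.Theory.truncnS_gt _))).
  by rewrite ler_nat.
rewrite /ball /= distrC -(ltr_pM2l n0) -{1}(ger0_norm (ltW n0)) -normrM mulrBr.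
rewrite mulrA divff ?gt_eqF// mul1r; apply: (le_lt_trans (hp n pn)).
have : 0 < n%:R * e by rewrite mulr_gt0.
by move: hC; lra.
Qed.

Section birkhoff.
Context {R : realType} {B : finType}.
Variables (m : nat) (g : nat -> nat).
Hypotheses (B_gt2 : (2 < #|B|)%N) (m_gt0 : (0 < m)%N).
Hypotheses (g_mono : {homo g : i j / (i <= j)%N}) (g_gt0 : forall n, (0 < g n)%N).

Local Notation D := (tagged_data B_gt2 m_gt0 g_mono g_gt0).
Local Notation X := (gap_shift R D).
Local Notation f := (@shift R D : gap_pmetric -> gap_pmetric).
Local Notation c := (@word_freq R B).
Local Notation tag_word := (@tag_word B m g B_gt2 m_gt0 g_mono g_gt0).
Local Notation tagged := (@tagged R B m g B_gt2 m_gt0 g_mono g_gt0).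
Local Notation visits := (@visits R B m g B_gt2 m_gt0 g_mono g_gt0).

(** Up to [e / 2], [phi] depends on the first [q] symbols only. Its Birkhoff sums then become
    combinations of visit counts, governed by the word frequencies. *)
Lemma tagged_birkhoff_sum (phi : X -> R) i (y : X) (e : R) :
  continuous (phi : @gap_pmetric R D -> R) -> tagged i y -> 0 < e ->
  exists l C, forall n, `|\sum_(k < n) phi (iter k f y) - n%:R * l| <= n%:R * e + C.
Proof.
move=> cphi yi e0; have e2 : 0 < e / 2 by rewrite divr_gt0.
have [q hq] := gap_unif_continuous cphi e2.
have /choice[v hv] : forall u, exists a : R, forall x : X,
    mkseq x q = tag_word i u -> `|phi x - a| <= e / 2.
  move=> u; have [[z zu]|nz] := pselect (exists z : X, mkseq z q = tag_word i u).
    by exists (phi z) => x xu; apply: hq; apply/mkseq_eqP; rewrite xu zu.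
  by exists 0 => x xu; exfalso; apply: nz; exists x.
(* Dividing the frequency error by [V] keeps the sum of the errors, weighted by the values [v u],
   below [e / 2]; the summand 1 makes [V] positive. *)
pose V := 1 + \sum_(u <- words q) `|v u|.
have V0 : 0 < V by rewrite ltr_pwDl// sumr_ge0.
have eV : 0 < e / 2 / V by rewrite divr_gt0.
have /choice[C hC] : forall u : seq B, exists C : R, forall n,
    `|(visits i u n y)%:R - n%:R * c u| <= n%:R * (e / 2 / V) + C.
  by move=> u; have [C hC] := @tagged_frequency R B m g B_gt2 m_gt0 g_mono g_gt0 i u _ eV;
    exists C => n; exact: hC.
exists (\sum_(u <- words q) v u * c u), (\sum_(u <- words q) `|v u| * C u) => n.
have split_sum : `|\sum_(k < n) phi (iter k f y) -
    \sum_(u <- words q) v u * (visits i u n y)%:R| <= n%:R * (e / 2).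
  have -> : \sum_(u <- words q) v u * (visits i u n y)%:R =
      \sum_(k < n) \sum_(u <- words q) v u * (mkseq (iter k shift y) (size u) == tag_word i u)%:R.
    by rewrite exchange_big/=; apply: eq_bigr => u _; rewrite natr_sum mulr_sumr.
  rewrite -sumrB; apply: (le_trans (ler_norm_sum _ _ _)).
  rewrite mulr_natl -[n in _ *+ n]card_ord -sumr_const; apply: ler_sum => k _.
  have [w [_ sw ew]] := tagged_prefix q (tagged_shift k yi).
  rewrite (bigD1_seq w) ?words_uniq ?mem_words ?sw//= ew eqxx mulr1 big_seq_cond big1 ?addr0.
    exact: hv.
  move=> u /andP[]; rewrite mem_words => /eqP su uw.
  by rewrite su ew (inj_eq (@tag_word_inj _ _ _ _ _ _ _ i)) eq_sym (negbTE uw) mulr0.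
rewrite -(subrKA (\sum_(u <- words q) v u *
  (visits i u n y)%:R)).
apply: (le_trans (ler_normD _ _)); apply: (le_trans (lerD split_sum (lexx _))).
have h2 : `|\sum_(u <- words q) v u * (visits i u n y)%:R -
    n%:R * (\sum_(u <- words q) v u * c u)| <=
    n%:R * (e / 2 / V) * (\sum_(u <- words q) `|v u|) + \sum_(u <- words q) `|v u| * C u.
  rewrite mulr_sumr -sumrB; apply: (le_trans (ler_norm_sum _ _ _)).
  rewrite mulr_sumr -big_split; apply: ler_sum => u _ /=.
  rewrite mulrCA -mulrBr normrM [X in _ <= X + _]mulrC -mulrDr.
  by rewrite ler_wpM2l.
apply: (le_trans (lerD (lexx _) h2)); rewrite addrA lerD2r.
have h3 : e / 2 / V * (\sum_(u <- words q) `|v u|) <= e / 2.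
  by rewrite mulrAC ler_pdivrMr// ler_pM2l// /V lerDr.
have h4 := ler_wpM2l (ler0n R n) h3; rewrite mulrA in h4.
apply: (le_trans (lerD (lexx _) h4)); lra.
Qed.

(** From time [p] on the orbit stays in one copy; the first [p] terms change sums and means by a
    bounded amount, which goes into the constant. *)
Lemma eventually_letter_regular (phi : X -> R) (x : X) p :
  continuous (phi : @gap_pmetric R D -> R) -> (forall n, (p <= n)%N -> x n != None) ->
  cvgn (birkhoff_average f phi x).
Proof.
move=> cphi xp; apply: cesaro_cvg => e e0.
have [i yi] : exists i, tagged i (iter p f x).
  by apply: no_gap_tagged => n; rewrite iter_shift; apply: xp; exact: leq_addr.
have [l [C hC]] := tagged_birkhoff_sum cphi yi e0.
exists l, (`|\sum_(k < p) phi (iter k f x)| + p%:R * `|l| + C), p => n pn.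
have -> : \sum_(k < n) phi (iter k f x) =
    \sum_(k < p) phi (iter k f x) + \sum_(k < n - p) phi (iter k f (iter p f x)).
  rewrite -!(big_mkord xpredT (fun k => phi (iter k f x))) (big_cat_nat (n := p))//=.
  congr (_ + _); rewrite -{1}[p]add0n big_addn big_mkord; apply: eq_bigr => k _.
  by rewrite -iterD.
have h1 := hC (n - p)%N; rewrite natrB// in h1.
have h2 := ler_norm (\sum_(k < p) phi (iter k f x)).
have h3 := ler_norm (- \sum_(k < p) phi (iter k f x)); rewrite normrN in h3.
have h4 : - (p%:R * `|l|) <= p%:R * l <= p%:R * `|l|.
  by rewrite -mulrN !ler_wpM2l// ?ler_norm// lerNl -normrN ler_norm.
have h5 : 0 <= p%:R * e by rewrite mulr_ge0// ltW.
move: h1 h4; rewrite !ler_norml !mulrBl => /andP[h6 h7] /andP[h8 h9]; apply/andP; split; lra.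
Qed.

Lemma irregular_many_gaps (x : X) : irregular_set f x ->
  forall p, exists2 n, (p <= n)%N & x n = None.
Proof.
move=> [phi cphi nx] p; apply: contrapT => hp; apply: nx.
apply: (@eventually_letter_regular phi x p) => // n pn.
by apply/eqP => xn; apply: hp; exists n.
Qed.

End birkhoff.

(** * Choice of the parameters *)

(** The bound [q] is any positive integer above [1 / t]. Adding [L] makes all gaps long without
    affecting the rate, so [q] is fixed before [L]. *)
Lemma finite_rate_gap_len (R : realType) (t : R) : 0 < t ->
  exists2 q, (0 < q)%N & forall L, exists g : nat -> nat, [/\ {homo g : i j / (i <= j)%N},
      forall n, (L <= g n)%N,
      ((g n)%:R / n%:R : R)%:E @[n --> \oo] --> t%:E,
      forall r, (1 + t) * r%:R <= (r + g r)%:R & forall r, (r <= q * g r)%N].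
Proof.
move=> t0; exists (Num.truncn t^-1).+1 => // L.
pose g n := ((Num.truncn (t * n%:R)).+1 + L)%N.
have tr n : t * n%:R <= (Num.truncn (t * n%:R)).+1%:R.
  by rewrite ltW// Num.Theory.truncnS_gt.
have gt n : t * n%:R <= (g n)%:R by rewrite natrD (le_trans (tr n))// lerDl.
have gt' n : (g n)%:R <= L.+1%:R + t * n%:R.
  rewrite /g addSnnS addnC natrD lerD2l Num.Theory.truncn_le.
  by rewrite mulr_ge0// ltW.
exists g; split => [i j ij|n||r|r].
- rewrite leq_add2r ltnS; apply: Num.Theory.le_truncn.
  by rewrite ler_pM2l// ler_nat.
- exact: leq_addl.
- apply: cvg_EFin; first exact: nearW.
  apply: (@squeeze_cvgr _ _ _ _ (fun=> t) (fun n => n%:R^-1 * (L.+1%:R + t * n%:R))).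
  + near=> n; have n0 : 0 < n%:R :> R by rewrite ltr0n; near: n; exact: nbhs_infty_gt.
    by rewrite /= ler_pdivlMr// gt mulrC ler_pM2l ?invr_gt0//= gt'.
  + exact: cvg_cst.
  + exact: affine_mean_cvg.
- by rewrite mulrDl mul1r natrD lerD2l.
- rewrite -(ler_nat R) natrM; apply: (@le_trans _ _ (t^-1 * (g r)%:R)).
    by rewrite ler_pdivlMl.
  by rewrite ler_wpM2r// ltW// Num.Theory.truncnS_gt.
Unshelve. all: by end_near. Qed.

(** Quadratic growth gives the infinite rate, and the term [n * T] secures the ratio [T] for short
    runs too. *)
Lemma infinite_rate_gap_len (R : realType) (T L : nat) : exists g : nat -> nat,
  [/\ {homo g : i j / (i <= j)%N}, forall n, (L <= g n)%N,
      ((g n)%:R / n%:R : R)%:E @[n --> \oo] --> +oo%E,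
      forall r, (T * r <= r + g r)%N & forall r, (r <= g r)%N].
Proof.
exists (fun n => n * (n + T) + L)%N; split => [i j ij|n||r|r]; last 2 first.
- by case: r => [|r]; rewrite ?muln0//; nia.
- by case: r => [|r] //; nia.
- by rewrite leq_add2r leq_mul// leq_add2r.
- exact: leq_addl.
apply/cvgeyPge => A; near=> n.
have n0 : 0 < n%:R :> R by rewrite ltr0n; near: n; exact: nbhs_infty_gt.
rewrite lee_fin ler_pdivlMr//; apply: (@le_trans _ _ (n%:R * n%:R)).
  by rewrite ler_pM2r//; near: n; exact: nbhs_infty_ger.
by rewrite -natrM ler_nat; nia.
Unshelve. all: by end_near. Qed.

(** For finite [tau] the ratio [T] is [1 + tau] exactly; for infinite [tau] it only has to exceed
    [1 / e]. The gap lengths come last because [L] will depend on [T] and [q] through the other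
    constants. *)
Lemma gap_parameters (R : realType) (tau : \bar R) (e : R) : (0 < tau)%E -> 0 < e ->
  exists i T q, [/\ (1 + tau)^-1%E = i%:E, 0 < T, T^-1 <= i + e, (0 < q)%N &
    forall L, exists g : nat -> nat, [/\ {homo g : i j / (i <= j)%N},
      forall n, (L <= g n)%N,
      ((g n)%:R / n%:R : R)%:E @[n --> \oo] --> tau,
      forall r, T * r%:R <= (r + g r)%:R & forall r, (r <= q * g r)%N]].
Proof.
case: tau => [t||//] t0 e0.
  rewrite lte_fin in t0; have [q q0 hq] := finite_rate_gap_len t0.
  have t1 : 0 < 1 + t by rewrite addr_gt0.
  exists (1 + t)^-1, (1 + t), q; split => //; first by rewrite -EFinD inver gt_eqF.
  by rewrite lerDl ltW.
exists 0, (Num.truncn e^-1).+1%:R, 1%N; split => //.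
  by rewrite add0r invf_ple ?posrE// ltW// Num.Theory.truncnS_gt.
move=> L; have [g [g1 g2 g3 g4 g5]] := infinite_rate_gap_len R (Num.truncn e^-1).+1 L.
exists g; split => // r; first by rewrite -natrM ler_nat.
by rewrite mul1n.
Qed.

(** With [x = exp (- kappa)], the sum is at most [exp (- kappa * L)] times a geometric series below
    [1 / (1 - x)], so [K * exp (- kappa * L) <= (1 - x) ^ 2] suffices. By [1 + y <= exp y] this
    holds once [kappa * L] exceeds [K / (1 - x) ^ 2]. *)
Lemma gap_long_exists (R : realType) (K kappa : R) : 0 < K -> 0 < kappa ->
  exists2 L, (0 < L)%N & forall g : nat -> nat, (forall n, (L <= g n)%N) ->
    forall n, K * \sum_(1 <= r < n.+1) expR (- (kappa * (r + g r)%:R)) <= 1 - expR (- kappa).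
Proof.
move=> K0 kappa0; set x := expR (- kappa).
have x0 : 0 < x by rewrite expR_gt0.
have x1 : 0 < 1 - x by rewrite subr_gt0 -expR0 ltr_expR oppr_lt0.
exists (Num.truncn (K / (1 - x) ^+ 2 / kappa)).+1 => // g hg n.
set L := (Num.truncn _).+1 in hg.
have hL : K * expR (- (kappa * L%:R)) <= (1 - x) ^+ 2.
  rewrite expRN ler_pdivrMr ?expR_gt0// mulrC -ler_pdivrMr ?exprn_gt0//.
  apply: le_trans (expR_ge1Dx _); apply: (@le_trans _ _ (kappa * L%:R)); last by rewrite lerDr.
  by rewrite [kappa * _]mulrC -ler_pdivrMr// ltW// Num.Theory.truncnS_gt.
have geo : (1 - x) * \sum_(1 <= r < n.+1) x ^+ r <= 1.
  have -> : (1 - x) * \sum_(1 <= r < n.+1) x ^+ r = x * (1 - x ^+ n).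
    rewrite big_add1/= big_mkord; under eq_bigr do rewrite exprS.
    by rewrite -mulr_sumr mulrCA -opprB mulNr -subrX1 opprB.
  have : 0 <= x * x ^+ n by rewrite mulr_ge0 ?exprn_ge0// ltW.
  rewrite mulrBr mulr1; move: x1; lra.
apply: (@le_trans _ _ (K * expR (- (kappa * L%:R)) * \sum_(1 <= r < n.+1) x ^+ r)).
  rewrite -mulrA ler_pM2l// mulr_sumr; apply: ler_sum => r _.
  rewrite -expRM_natl -expRD ler_expR natrD.
  have : kappa * L%:R <= kappa * (g r)%:R by rewrite ler_pM2l// ler_nat.
  lra.
apply: (@le_trans _ _ ((1 - x) ^+ 2 * \sum_(1 <= r < n.+1) x ^+ r)).
  by rewrite ler_wpM2r// sumr_ge0// => r _; rewrite exprn_ge0// ltW.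
by rewrite expr2 -mulrA -[leRHS]mulr1 ler_pM2l.
Qed.

(** * Entropies of the example *)

Section gap_example.
Context {R : realType} {B : finType}.
Variables (m : nat) (g : nat -> nat).
Hypotheses (B_gt2 : (2 < #|B|)%N) (m_gt0 : (0 < m)%N).
Hypotheses (g_mono : {homo g : i j / (i <= j)%N}) (g_gt0 : forall n, (0 < g n)%N).

Local Notation D := (tagged_data B_gt2 m_gt0 g_mono g_gt0).
Local Notation f := (@shift R D : gap_pmetric -> gap_pmetric).
Local Notation h := (@lang_entropy R B).

Variables (s kappa K T : R).
Hypotheses (h_gt0 : 0 < h) (kappa_gt0 : 0 < kappa) (K_gt0 : 0 < K) (s_ge0 : 0 <= s).
Hypothesis T_gt0 : 0 < T.
Hypothesis lang_growth : forall r,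
  (size (lang_words (@perm_lang B) r))%:R <= K / m%:R * expR (s * r%:R).
Hypothesis gap_long : forall n,
  K * \sum_(1 <= r < n.+1) expR (- (kappa * (r + g r)%:R)) <= 1 - expR (- kappa).
Hypothesis g_ratio : forall r, T * r%:R <= (r + g r)%:R.
Hypothesis theta_le : theta s kappa T <= h.

Let mR : 0 < m%:R :> R. Proof. by rewrite ltr0n. Qed.

(** The [m] copies multiply the count by at most [m], which the division by [m] in the hypothesis
    anticipates. *)
Lemma tag_lang_growth (C a : R) :
  (forall r, (size (lang_words (@perm_lang B) r))%:R <= C / m%:R * expR (a * r%:R)) ->
  forall r, (size (lang_words (@gap_lang D) r))%:R <= C * expR (a * r%:R).
Proof.
move=> hC r; have hc := tag_lang_count B_gt2 m_gt0 g_mono g_gt0 r; rewrite -(ler_nat R) in hc.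
apply: (le_trans hc); rewrite natrM -ler_pdivlMl// mulrA [m%:R^-1 * C]mulrC; exact: hC.
Qed.

Lemma tag_words_ub (e : R) : 0 < e -> exists2 C : R, 0 < C &
  forall n, (size (lang_words (@gap_word R D) n))%:R <= C * expR ((h + e) * n%:R).
Proof.
move=> e0; have e2 : 0 < e / 2 by rewrite divr_gt0.
(* One half of [e] is spent on the growth of the language, and three times [e / 6] on the cubic
   factor in [count_words]. *)
have e6 : 0 < e / 6 by rewrite divr_gt0.
have [K' K'0 hK'] := lang_count_exp B_gt2 e2; have [C C0 hC] := natr_le_expR e6.
have A0 : 0 < count_cst kappa K by apply: lt_le_trans (count_cst_ge1 _ _).
have K''0 : 0 < K' * m%:R by rewrite mulr_gt0.
exists (count_cst kappa K * (K' * m%:R) * C ^+ 3) => [|n]; first by rewrite !mulr_gt0// exprn_gt0.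
have s'0 : 0 <= h + e / 2 by rewrite addr_ge0// ltW.
have th : theta s kappa T <= h + e / 2 by rewrite (le_trans theta_le)// lerDl ltW.
have := count_words kappa_gt0 K_gt0 (tag_lang_growth lang_growth) gap_long T_gt0 s_ge0 g_ratio
  s'0 K''0 th.
move=> /(_ _ n) hw; apply: (le_trans (hw _)).
  by apply: tag_lang_growth => r; rewrite mulfK ?gt_eqF.
have hC3 : n.+1%:R ^+ 3 <= C ^+ 3 * expR (e / 2 * n%:R).
  have -> : e / 2 * n%:R = 3%:R * (e / 6 * n%:R) by field.
  by rewrite expRM_natl -exprMn lerXn2r ?nnegrE// mulr_ge0 ?expR_ge0// ltW.
move: (C ^+ 3) (n.+1%:R ^+ 3) (exprn_gt0 3 C0) hC3 => a b a0 hab.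
rewrite -!mulrA !ler_pM2l//; apply: (le_trans (ler_wpM2r (expR_ge0 _) hab)).
rewrite -[a * _ * _]mulrA -expRD ler_pM2l// ler_expR; lra.
Qed.

Lemma tag_htop : htop f = h%:E.
Proof. by apply: gap_htop => [|N]; [exact: tag_words_ub|exact: gap_words_lb]. Qed.

(** The strict inequality leaves room to absorb the linear factor in [count_good] into the
    exponential. *)
Lemma tag_bowen_htop_le (th : R) : theta s kappa T < th ->
  (bowen_htop f (irregular_set f) <= th%:E)%E.
Proof.
move=> thl; have e0 : 0 < th - theta s kappa T by rewrite subr_gt0.
have [C C0 hC] := natr_le_expR e0.
have A0 : 0 < count_cst kappa K by apply: lt_le_trans (count_cst_ge1 _ _).
have th0 : 0 <= theta s kappa T by rewrite addr_ge0 ?divr_ge0// ltW.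
apply: (@gap_bowen_htop_le _ _ (@good R D T) th (count_cst kappa K * C)).
- by rewrite mulr_gt0.
- exact: le_trans (ltW thl).
- move=> n; apply: (le_trans (count_good kappa_gt0 K_gt0 (tag_lang_growth lang_growth)
    gap_long T_gt0 s_ge0 n)).
  rewrite -!mulrA ler_pM2l//; apply: (le_trans (ler_wpM2r (expR_ge0 _) (hC n))).
  by rewrite -mulrA -expRD ler_pM2l// ler_expR; lra.
- move=> x /irregular_many_gaps hx; exact: good_infinitely_often.
Qed.

End gap_example.

Theorem theorem3 (R : realType) (tau : \bar R) (delta : R) (m : nat)
    (tau_gt0 : (0 < tau)%E) (delta_gt0 : 0 < delta)
    (delta_lt : (delta%:E < 1 - (1 + tau)^-1)%E) (m_gt0 : (0 < m)%N) :
  exists (X : pmetricType R) (f : X -> X) (M : nat -> R -> nat),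
    [/\ dynamical_system f, nonuniform_specification f tau & gap_function f M] /\
    [/\ \forall eps \near 0^'+, gap_ratio M eps n @[n --> \oo] --> tau,
        exists nu : 'I_m -> probability (borel X) R,
          [/\ injective nu,
              max_entropy_measures f = range nu &
              forall i, isolated (ergodic_measures f : set (weak_star X)) (nu i)],
        ~ carries_full_bowen_entropy f (irregular_set f) &
        (bowen_htop f (irregular_set f) <=
           ((1 + tau)^-1 + delta%:E) * htop f)%E].
Proof.
have d4 : 0 < delta / 4 by rewrite divr_gt0.
have [i [T [q [iE T0 Ti q0 hg]]]] := gap_parameters tau_gt0 d4.
rewrite iE in delta_lt *; rewrite -EFinB lte_fin in delta_lt.
(* More than [e^3] letters: [ln N > 2] then makes the entropy positive, and [N > 2] holds as
   well. *)
pose N := (Num.truncn (expR (3 : R))).+1.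
have N3 : expR 3 < N%:R :> R by exact: Num.Theory.truncnS_gt.
have N_gt2 : (2 < #|'I_N|)%N.
  rewrite card_ord -(ltr_nat R); apply: lt_trans N3.
  apply: (lt_le_trans _ (expR_ge1Dx _)); lra.
have lnN : (2 : R) < ln #|'I_N|%:R.
  rewrite card_ord; apply: (@lt_trans _ _ 3); first by rewrite ltr_nat.
  by rewrite -[ltLHS]expRK ltr_ln ?posrE ?expR_gt0// (lt_trans _ N3)// expR_gt0.
have h0 := lang_entropy_gt0 N_gt2 lnN.
set h := lang_entropy in h0.
pose rho : R := q%:R / (1 + q%:R).
have rho1 : rho < 1 by rewrite /rho ltr_pdivrMr ?mul1r ?ltrDr// addr_gt0.
(* The first bound on [eta] serves the Bowen entropy, the second one the entropy of the measures
   other than [nu]. *)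
have [eta [eta0 eta_d eta_r]] : exists eta, [/\ 0 < eta, eta <= delta / 4 & eta <= (1 - rho) / 4].
  exists (Num.min (delta / 4) ((1 - rho) / 4)).
  by rewrite lt_min d4 divr_gt0 ?subr_gt0// !ge_min !lexx orbT.
(* [s] exceeds [h] by [kappa], so the language grows at rate at most [s], up to a constant
   factor. *)
pose kappa := eta * h; pose s := h + eta * h.
have kappa0 : 0 < kappa by rewrite mulr_gt0.
have s0 : 0 <= s by rewrite addr_ge0 ?mulr_ge0// ltW.
have [K K0 hK] := lang_count_exp N_gt2 kappa0.
have m0 : 0 < m%:R :> R by rewrite ltr0n.
have Km0 : 0 < K * m%:R by rewrite mulr_gt0.
(* [L] depends on [K * m], the growth constant for all [m] copies together, and precedes the choice
   of [g]. *)
have [L L0 hL] := gap_long_exists Km0 kappa0.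
have [g [g_mono gL g_cvg g_ratio g_ge]] := hg L.
have g_gt0 n : (0 < g n)%N by exact: leq_trans (gL n).
have growth r : (size (lang_words (@perm_lang 'I_N) r))%:R <=
    K * m%:R / m%:R * expR (s * r%:R) by rewrite mulfK ?gt_eqF// hK.
(* Here [eta + rho + eta * rho <= 2 * eta + rho <= (1 + rho) / 2 < 1]. *)
have gap : kappa + s * rho < h.
  rewrite (_ : _ + _ = h * (eta + rho + eta * rho)); last by rewrite /kappa /s; ring.
  rewrite -[ltRHS]mulr1 ltr_pM2l//.
  have : eta * rho <= eta * 1 by rewrite ler_pM2l// ltW.
  move: eta_r rho1; lra.
(* As [T^-1 <= i + delta / 4 < 1], the factor [eta + T^-1 + eta * T^-1] is at most
   [i + 3 * delta / 4]. *)
have th : theta s kappa T < (i + delta) * h.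
  rewrite /theta (_ : _ + _ = h * (eta + T^-1 + eta * T^-1)); last by rewrite /kappa /s; ring.
  rewrite mulrC ltr_pM2r//.
  have : eta * T^-1 <= eta * 1 by rewrite ler_pM2l//; move: Ti delta_lt; lra.
  move: Ti eta_d delta_gt0; lra.
have idh : (i + delta) * h < h.
  by rewrite -[ltRHS]mul1r ltr_pM2r//; move: delta_lt; lra.
have thh : theta s kappa T <= h by apply: ltW; exact: lt_trans th idh.
pose D := tagged_data N_gt2 m_gt0 g_mono g_gt0.
have htopE : htop (@shift R D : gap_pmetric -> gap_pmetric) = h%:E.
  exact: (tag_htop N_gt2 m_gt0 g_mono g_gt0 h0 kappa0 Km0 s0 T0 growth (hL g gL) g_ratio thh).
have bow : (bowen_htop (@shift R D : gap_pmetric -> gap_pmetric) (irregular_set (@shift R D : gap_pmetric -> gap_pmetric)) <=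
    ((i + delta) * h)%:E)%E.
  exact: (tag_bowen_htop_le N_gt2 m_gt0 g_mono g_gt0 kappa0 Km0 s0 T0 growth (hL g gL) g_ratio th).
have sizes := @tag_lang_sizes 'I_N m g N_gt2 m_gt0 g_mono g_gt0.
exists (@gap_pmetric R D), (@shift R D), (@spec_gap R D); split; split.
- exact: gap_dynamical_system.
- exact: gap_nonuniform_specification.
- exact: spec_gap_function.
- by apply: nearW => eps; exact: spec_gap_cvg.
- apply: (max_entropy_measures_tagged kappa0 Km0 s0 q0 _ (hL g gL) g_ge gap h0) => //.
    exact: tag_lang_growth.
  exact: (tag_words_ub N_gt2 m_gt0 g_mono g_gt0 h0 kappa0 Km0 s0 T0 growth (hL g gL) g_ratio thh).
- rewrite /carries_full_bowen_entropy htopE => e.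
  by move: bow; rewrite e lee_fin leNgt idh.
- by rewrite htopE -EFinD -EFinM.
Qed.
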